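(* Let $L\in[L_0,\infty)\setminus E$ and let $u^i\in\mathcal{X}$ be a representative of a family of non-trivial zero-mean $L$-periodic solutions of $\Delta^2(\Delta u-W'(u))=0$. Then there exist $\delta_0>0$ and a $C^1$ map $(-\delta_0,\delta_0)\ni\delta\mapsto u^{\delta,i}\in\mathcal{X}$ such that $G(\delta,u^{\delta,i})=0$ for $|\delta|<\delta_0$, where $$G(\delta,u)=\delta uu_x+\Delta^2(\Delta u-W'(u)).$$ Moreover, for some constant $C$, $\|u^{\delta,i}-u^i\|_{\mathcal{X}}\le C|\delta|$.
   Context: $\mathbb{T}=\mathbb{R}/L\mathbb{Z}$, $\Delta=\partial_x^2$, $W(v)=\frac14(v^2-1)^2$. $\dot H^k_{per}$ is the space of zero-mean functions in $H^k(\mathbb{T})$, and $\mathcal{X}=\{u\in\dot H^6_{per}:u(0)=u(L)=0\}$ with the norm of $\dot H^6_{per}$. Non-trivial means nonconstant; a family is a translation orbit $\{u(\cdot+s)\}_{s\in[0,L)}$. The constants $L_0$ and $E$: for $c=(c_1,c_2)$ let $P_c(u)=2(W(u)+c_1u+c_2)$; let $\mathcal{C}$ be the set of $(c_1,c_2)$ with $c_2\in(-\frac14,0)$ for which $P_c$ has four distinct real roots $u_1<u_m<0<u_M<u_2$; let $g_1(c)=\int_{u_m}^{u_M}\frac{du}{\sqrt{P_c(u)}}$ on $\mathcal{C}$, and $E=Z\cup\{2k\pi:k\ge1\}$ with $Z$ the (Lebesgue null) set of critical values of $g_1$. $L_0>0$ is a constant such that for $0<\ell<L_0$ there is no nonconstant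 zero-mean solution of $\Delta^2(\Delta u-W'(u))=0$ with principal (smallest positive) period $\ell$, while for $\ell\in[L_0,\infty)\setminus E$ the set of $(c_1,c_2)\in\mathcal{C}$ for which $\frac12u_x^2=W(u)+c_1u+c_2$ has a zero-mean solution with principal period $\ell$ is non-empty and finite. *)

(* Defs.v *)
From HB Require Import structures.
From mathcomp Require Import all_boot all_order all_algebra.
From mathcomp Require Import all_classical all_reals all_analysis.

Set Implicit Arguments.
Unset Strict Implicit.
Unset Printing Implicit Defensive.

Import Order.TTheory GRing.Theory Num.Theory.
Import numFieldNormedType.Exports.

Local Open Scope classical_set_scope.
Local Open Scope ring_scope.

Section sobolev.
Context {R : realType}.
Implicit Types (L : R) (u v phi : R -> R) (j : nat).

Local Notation mu := (@lebesgue_measure R).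

(* Functions on the torus R/LZ are functions on R; a.e.-defined ones (weak
   derivatives, elements of L^2) matter only through their values on [0, L],
   the periodicity being carried by the test functions. *)
Definition ae_eq_torus L u v :=
  {ae mu, forall x, x \in `[0, L] -> u x = v x}.

Definition L2_torus L u :=
  measurable_fun `[0, L] u /\
  mu.-integrable `[0, L] (EFin \o (fun x => u x ^+ 2)).

Definition test_torus L phi :=
  periodic phi L /\ forall n x, derivable (phi^`(n)%classic) x 1.

Definition is_wderiv L j u v :=
  mu.-integrable `[0, L] (EFin \o v) /\
  forall phi, test_torus L phi ->
    (\int[mu]_(x in `[0, L]) (u x * (phi^`(j)%classic) x)
     = (-1) ^+ j * \int[mu]_(x in `[0, L]) (v x * phi x))%R.

(* The j-th weak derivative, unique up to a.e. equality; a junk value if u has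
   none. *)
Definition wderiv L j u : R -> R := get [set v | is_wderiv L j u v].

(* Each class of H^6(R/LZ) is represented by its continuous L-periodic
   element, which gives a meaning to the values u 0 and u L. *)
Definition H6_torus L u :=
  [/\ continuous u, periodic u L &
      forall j, (j <= 6)%N -> exists v, is_wderiv L j u v /\ L2_torus L v].

Definition Hdot6_torus L u :=
  H6_torus L u /\ (\int[mu]_(x in `[0, L]) u x = 0)%R.

Definition Hdot6_norm L u : R :=
  Num.sqrt (\sum_(j < 7) \int[mu]_(x in `[0, L]) (wderiv L j u x ^+ 2))%R.

Definition Xspace L u := [/\ Hdot6_torus L u, u 0 = 0 & u L = 0].

(* t |-> U t is a C^1 map from (-d, d) to the subspace V of functions normed
   by N, with derivative U'. *)
Definition C1_curve (V : set (R -> R)) (N : (R -> R) -> R) (d : R)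
    (U : R -> R -> R) :=
  exists U' : R -> R -> R, forall t, `|t| < d ->
    [/\ V (U t), V (U' t),
        N (fun x => h^-1 * (U (t + h) x - U t x) - U' t x) @[h --> 0^'] --> 0 &
        N (fun x => U' s x - U' t x) @[s --> t] --> 0].

End sobolev.

Section equation.
Context {R : realType}.
Implicit Types (L delta : R) (u : R -> R) (c : R * R).

Local Notation mu := (@lebesgue_measure R).

Definition W (v : R) : R := 4^-1 * (v ^+ 2 - 1) ^+ 2.

Definition laplacian L u : R -> R := wderiv L 2 u.

Definition stat_op L u : R -> R :=
  laplacian L (laplacian L (fun x => laplacian L u x - (W^`()%classic) (u x))).

Definition G L delta u : R -> R :=
  fun x => delta * u x * wderiv L 1 u x + stat_op L u x.

Definition stationary L u := ae_eq_torus L (stat_op L u) (cst 0).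

Definition nontrivial u := ~ exists a, forall x, u x = a.

Definition principal_period u (l : R) :=
  [/\ 0 < l, periodic u l & forall l', 0 < l' -> periodic u l' -> l <= l'].

Definition P c (u : R) : R := 2 * (W u + c.1 * u + c.2).

Definition four_roots c (r : R * R * R * R) :=
  let: (u1, um, uM, u2) := r in
  [/\ u1 < um, um < 0, 0 < uM & uM < u2] /\
  [/\ P c u1 = 0, P c um = 0, P c uM = 0 & P c u2 = 0].

Definition Cset : set (R * R) :=
  [set c | - 4^-1 < c.2 < 0 /\ exists r, four_roots c r].

(* P c has degree 4, so the quadruple of roots is unique for c in Cset; the
   values of g1 outside the open set Cset are never used. *)
Definition g1 c : R :=
  let: (_, um, uM, _) := get [set r | four_roots c r] in
  (\int[mu]_(x in `]um, uM[) (Num.sqrt (P c x))^-1)%R.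

Definition Zset : set R :=
  [set g1 c | c in [set c | [/\ Cset c, differentiable g1 c &
                                 forall h, 'd g1 c h = 0]]].

Definition Eset : set R :=
  Zset `|` [set 2 * k%:R * pi | k in [set k : nat | (1 <= k)%N]].

(* Solutions of the first-order equation are sought in H^6, hence are of class
   C^5: with mere C^1 regularity a solution may rest at a turning point for an
   arbitrary time, and every large period would then occur for every c. *)
Definition first_order_params (l : R) : set (R * R) :=
  [set c | Cset c /\ exists u, [/\ Hdot6_torus l u, principal_period u l &
     ae_eq_torus l (fun x => 2^-1 * wderiv l 1 u x ^+ 2)
                   (fun x => W (u x) + c.1 * u x + c.2)]].

Definition is_L0 (L0 : R) :=
  [/\ 0 < L0,
      forall l, 0 < l -> l < L0 ->
        ~ exists u, [/\ Hdot6_torus l u, nontrivial u, stationary l u &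
                        principal_period u l] &
      forall l, L0 <= l -> ~ Eset l ->
        first_order_params l !=set0 /\ finite_set (first_order_params l)].

End equation.

(* Main.v *)
Require Import Defs.
From HB Require Import structures.
From mathcomp Require Import all_boot all_order all_algebra.
From mathcomp Require Import all_classical all_reals all_analysis.
From mathcomp Require Import measurable_realfun ring lra.
Set Implicit Arguments.
Unset Strict Implicit.
Unset Printing Implicit Defensive.
Import Order.TTheory GRing.Theory Num.Theory.
Import numFieldNormedType.Exports.
Local Open Scope classical_set_scope.
Local Open Scope ring_scope.

(** Stationary zero-mean solutions satisfy u'' = u^3 - u + c1 classically.  Factoring
    the first integral shows that the mean of u lies strictly on the same side of 0 as the
    midpoint of its range, so zero mean forces the range to be symmetric and c1 = 0; since
    u(0) = 0, u is then odd.  The nonlinearity u u_x preserves oddness, so the problem can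
    be solved among odd functions, where the translation mode u_x is absent: the second
    solution of the linearized equation v'' = (3u^2 - 1) v is explicit and is not periodic,
    because \int u^2 <> 2 u_x(0)^2 L by an energy identity.  Hence the linearization has
    an explicit bounded odd periodic Green operator.  Writing J for the zero-mean
    antiderivative, G(delta, u) = 0 becomes u'' = u^3 - u - (delta/2) J^3(u^2), a fixed
    point problem for continuous functions with the sup norm; its solution and the
    derivative of its solution in delta come from two contractions, and regularity in x
    is gained afterwards from u_x = J(u_xx). *)

(** * Differentiation and integration on the line *)

(** The integrated equation carries no constants: with X = u'' - W'(u), the problem says that the
    fourth derivative of X is -delta (u^2/2)', and an odd periodic X has zero mean, so X =
    -(delta/2) J^3(u^2). This is consistent with oddness because u^2 is even and J exchanges even
    functions and odd ones. The second solution of the linearized equation comes from reduction of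
    order. The product of [p] = u' with a primitive of p^-2 is singular at the zeros of [p], but
    with p^2 = u^4/2 - u^2 + c the function c(2-4c)/p^2 is the derivative of \int(u^2 - 2c) +
    ((2-2c)u - u^3)/p, so multiplication by [p] gives a global solution. Its only non-periodic part
    is [p] times \int(u^2 - 2c), whose increment over a period must therefore be nonzero. Smoothness
    in delta is expressed by inequalities uniform in x, including a second-order Taylor estimate.
    They are stable under sums, products and bounded linear operators, and the Sobolev norm enters
    only at the end, through sup bounds on the derivatives up to order six. *)

Ltac derive_ring := apply: is_derive_eq; rewrite /GRing.scale/=; ring.

Section calculus.
Context {R : realType}.
Implicit Types (f g h F : R -> R).

(** The derivative is carried as an explicit function on the whole line, so that identities between
    functions follow from equal derivatives and one common value. *)
Definition deriv_is f f' := forall x : R, is_derive x 1 f (f' x).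

Lemma deriv_is_derivable f f' : deriv_is f f' -> forall x : R, derivable f x 1.
Proof. by move=> df x; have := df x => ?; exact: ex_derive. Qed.

Lemma deriv_is_derive1 f f' : deriv_is f f' -> (f^`()%classic) = f'.
Proof.
by move=> df; apply/funext => x; rewrite derive1E; have := df x => ?; exact: derive_val.
Qed.

Lemma deriv_is_uniq f g h : deriv_is f g -> deriv_is f h -> g = h.
Proof. by move=> /deriv_is_derive1 <- /deriv_is_derive1. Qed.

Lemma deriv_is_continuous f f' : deriv_is f f' -> continuous f.
Proof.
move=> df x; apply: differentiable_continuous.
by apply/derivable1_diffP; exact: deriv_is_derivable df x.
Qed.

Lemma deriv_is_ndecr_in f f' a b : deriv_is f f' ->
  (forall x, a < x < b -> 0 <= f' x) ->
  forall x y, a <= x -> x <= y -> y <= b -> f x <= f y.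
Proof.
move=> df f0; apply: ger0_derive1_ndecr.
- by move=> x _; exact: deriv_is_derivable df x.
- by move=> x; rewrite in_itv (deriv_is_derive1 df) => /f0.
- by apply: continuous_subspaceT; exact: deriv_is_continuous df.
Qed.

Lemma deriv_is_ndecr f f' : deriv_is f f' -> (forall x, 0 <= f' x) ->
  {homo f : x y / x <= y}.
Proof.
by move=> df f0 x y xy; apply: (@deriv_is_ndecr_in f f' x y df) => // z _; exact: f0.
Qed.

Lemma deriv_is0_cst f : deriv_is f (cst 0) -> forall x y, f x = f y.
Proof. by move=> df x y; apply: is_derive_0_is_cst => z; exact: df. Qed.

Lemma deriv_isD f f' g g' : deriv_is f f' -> deriv_is g g' ->
  deriv_is (fun x => f x + g x) (fun x => f' x + g' x).
Proof. by move=> df dg x; have := df x => ?; have := dg x => ?; derive_ring. Qed.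

Lemma deriv_isB f f' g g' : deriv_is f f' -> deriv_is g g' ->
  deriv_is (fun x => f x - g x) (fun x => f' x - g' x).
Proof. by move=> df dg x; have := df x => ?; have := dg x => ?; derive_ring. Qed.

Lemma deriv_isM f f' g g' : deriv_is f f' -> deriv_is g g' ->
  deriv_is (fun x => f x * g x) (fun x => f' x * g x + f x * g' x).
Proof. by move=> df dg x; have := df x => ?; have := dg x => ?; derive_ring. Qed.

Lemma deriv_isZ (a : R) f f' : deriv_is f f' ->
  deriv_is (fun x => a * f x) (fun x => a * f' x).
Proof. by move=> df x; have := df x => ?; derive_ring. Qed.

Lemma deriv_is_cst (a : R) : deriv_is (fun=> a) (cst 0).
Proof. by move=> x; exact: is_derive_cst. Qed.

Lemma deriv_is_id : deriv_is id (cst 1).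
Proof. by move=> x; exact: is_derive_id. Qed.

Lemma deriv_is_comp f f' g g' : deriv_is f f' -> deriv_is g g' ->
  deriv_is (f \o g) (fun x => f' (g x) * g' x).
Proof.
move=> df dg x; have h1 := df (g x); have h2 := dg x.
exact: (is_derive1_comp h1 h2).
Qed.

Lemma deriv_is_eq f g h : deriv_is f g -> g =1 h -> deriv_is f h.
Proof. by move=> df gh x; rewrite -gh; exact: df. Qed.

Lemma deriv_is_shift f f' (a : R) : deriv_is f f' ->
  deriv_is (fun x => f (x + a)) (fun x => f' (x + a)).
Proof.
move=> df; apply: (@deriv_is_eq _ (fun x => f' (x + a) * (1 + 0))).
  apply: (@deriv_is_comp f f' (fun x => x + a)) => //.
  by apply: (@deriv_isD id (cst 1)); [exact: deriv_is_id|exact: deriv_is_cst].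
by move=> x; rewrite addr0 mulr1.
Qed.

Lemma deriv_is_opp f f' : deriv_is f f' ->
  deriv_is (fun x => f (- x)) (fun x => - f' (- x)).
Proof.
move=> df; apply: (@deriv_is_eq _ (fun x => f' (- x) * (-1 * 1))).
  apply: (@deriv_is_comp f f' (fun x => - x)) => //.
  by move=> x; derive_ring.
by move=> x; ring.
Qed.

Lemma deriv_is_inj f g h (a : R) : deriv_is f h -> deriv_is g h -> f a = g a -> f = g.
Proof.
move=> df dg fga; apply/funext => x; apply/subr0_eq.
rewrite -(subrr (g a)) -{1}fga.
apply: (@deriv_is0_cst (fun x => f x - g x)).
by apply: deriv_is_eq (deriv_isB df dg) _ => y; rewrite subrr.
Qed.

Lemma deriv_is_inj_at f g h (a x : R) :
  deriv_is f h -> deriv_is g h -> f a = g a -> f x = g x.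
Proof. by move=> df dg fga; rewrite (deriv_is_inj df dg fga). Qed.

Lemma deriv_is_le_in f f' g g' a b : deriv_is f f' -> deriv_is g g' ->
  (forall x, a < x < b -> f' x <= g' x) -> a <= b -> f b - f a <= g b - g a.
Proof.
move=> df dg fg ab.
have H x : a < x < b -> 0 <= g' x - f' x by move=> /fg; rewrite subr_ge0.
have := deriv_is_ndecr_in (deriv_isB dg df) H (lexx _) ab (lexx _); lra.
Qed.

Lemma deriv_is_lip_in f f' (M a b : R) : deriv_is f f' ->
  (forall x, a < x < b -> `|f' x| <= M) -> a <= b -> `|f b - f a| <= M * (b - a).
Proof.
move=> df fM ab.
have dM : deriv_is (fun x => M * x) (fun=> M).
  by apply: deriv_is_eq (deriv_isZ M deriv_is_id) _ => x; rewrite mulr1.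
rewrite ler_norml; apply/andP; split.
  have := @deriv_is_le_in _ _ _ _ a b (deriv_isZ (-1) dM) df; rewrite /=.
  have H : forall x, a < x < b -> -1 * M <= f' x.
    by move=> x /fM; rewrite ler_norml mulN1r => /andP[].
  move=> /(_ H ab); lra.
have := @deriv_is_le_in _ _ _ _ a b df dM.
have H : forall x, a < x < b -> f' x <= M by move=> x /fM; rewrite ler_norml => /andP[].
move=> /(_ H ab); lra.
Qed.

Lemma deriv_is_lip f f' (M : R) : deriv_is f f' ->
  (forall x, `|f' x| <= M) -> forall x y, `|f x - f y| <= M * `|x - y|.
Proof.
move=> df fM x y; wlog yx : x y / y <= x => [H|].
  by case/orP: (le_total y x) => xy; [exact: H|rewrite distrC (distrC x); exact: H].
by rewrite (ger0_norm (_ : 0 <= x - y)) ?subr_ge0//; apply: deriv_is_lip_in df _ yx => z _.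
Qed.

Lemma deriv_is_odd f f' : deriv_is f f' -> (forall x, f (- x) = - f x) ->
  forall x, f' (- x) = f' x.
Proof.
move=> df fo.
have h1 := deriv_is_opp df; have h2 := deriv_isZ (-1) df.
have e : (fun x => f (- x)) = (fun x => -1 * f x) by apply/funext => x; rewrite fo mulN1r.
rewrite e in h1 => x; have := congr1 (fun f => f x) (deriv_is_uniq h1 h2); rewrite /=; lra.
Qed.

Lemma deriv_is_periodic f f' (L : R) : deriv_is f f' -> periodic f L -> periodic f' L.
Proof.
move=> df fL x.
have h1 := deriv_is_shift L df.
have e : (fun x => f (x + L)) = f by apply/funext => y; rewrite fL.
by rewrite e in h1; rewrite [RHS](congr1 (@^~ x) (deriv_is_uniq df h1)).
Qed.

(** A monotone function that repeats its values after each period is squeezed between equal values.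
    This replaces integrating a nonnegative function over a period. *)
Lemma deriv_is_periodic_ge0 f f' (L : R) : 0 < L -> deriv_is f f' ->
  periodic f L -> (forall x, 0 <= f' x) -> forall x, f' x = 0.
Proof.
move=> L0 df fL f0.
have mono := deriv_is_ndecr df f0.
have fk x : forall k, f (x + k%:R * L) = f x.
  elim=> [|k IH]; first by rewrite mul0r addr0.
  by rewrite -natr1 mulrDl mul1r addrA fL.
have cstf x y : f x = f y.
  wlog xy : x y / x <= y => [H|].
    by have [/H//|/ltW/H/esym] := leP x y.
  apply/eqP; rewrite eq_le mono//=.
  pose k := (Num.truncn ((y - x) / L)).+1.
  rewrite -(fk x k); apply: mono.
  rewrite -lerBlDl -ler_pdivrMr//; apply/ltW; rewrite /k.
  by apply: truncnS_gt; rewrite divr_ge0 // ?subr_ge0// ltW.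
have e : f = fun=> f 0 by apply/funext => x; exact: cstf.
move=> x; rewrite e in df.
by rewrite (deriv_is_uniq df (deriv_is_cst (f 0))).
Qed.

End calculus.

(** * Antiderivatives of continuous functions *)

Section primitive.
Context {R : realType}.
Implicit Types (f g h F : R -> R).
Local Notation mu := (@lebesgue_measure R).

Lemma continuous_integrable_itv f (a b : R) : continuous f ->
  mu.-integrable `[a, b] (EFin \o f).
Proof.
move=> cf; apply: continuous_compact_integrable; first exact: segment_compact.
exact: continuous_subspaceT.
Qed.

(** Integrals over sets have no orientation, so the sign is inserted by hand for negative x. The
    result is an antiderivative on the whole line, as the parity and shift arguments require. *)
Definition prim f (x : R) : R :=
  if 0 <= x then \int[mu]_(t in `]0, x]) f t else - \int[mu]_(t in `]x, 0]) f t.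

Lemma primE f (a x : R) : continuous f -> a < 0 -> a < x ->
  prim f x = \int[mu]_(t in `[a, x]) f t - \int[mu]_(t in `[a, 0]) f t.
Proof.
move=> cf a0 ax; rewrite /prim; case: ifPn => [x0|].
  rewrite (@Rintegral_itvB _ f (BLeft a) (BRight x) 0)//.
  - exact: continuous_integrable_itv.
  - by rewrite bnd_simp ltW.
rewrite -ltNge => x0; rewrite -opprB; congr (- _).
rewrite (@Rintegral_itvB _ f (BLeft a) (BRight 0) x)//.
- exact: continuous_integrable_itv.
- by rewrite bnd_simp ltW.
- by rewrite bnd_simp ltW.
Qed.

Lemma prim_deriv f : continuous f -> deriv_is (prim f) f.
Proof.
move=> cf x.
(* The base point [a] lies to the left of both 0 and x, so near x the function [prim f] is an
   integral from [a] minus a constant, to which the fundamental theorem applies. *)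
pose a := - (`|x| + 1); pose u := `|x| + 1.
have [xn xp] : - `|x| <= x /\ x <= `|x| by split; [rewrite lerNl -normrN ler_norm|rewrite ler_norm].
have a0 : a < 0 by rewrite /a; have := normr_ge0 x; lra.
have ax : a < x by rewrite /a; lra.
have xu : x < u by rewrite /u; lra.
have [dF F'] := @continuous_FTC1_closed _ f a x u xu (continuous_integrable_itv _ _ cf) ax (cf x).
set F := fun x0 : R => _ in dF F'.
have dF' : is_derive x 1 F (f x) by rewrite -F' derive1E; exact: derivableP.
have dG : is_derive x 1 (fun y => F y - F 0) (f x) by derive_ring.
apply: near_eq_is_derive dG.
near=> y; rewrite (@primE _ a) //=.
near: y; by apply: lt_nbhsr.
Unshelve. all: by end_near. Qed.

Lemma prim0 f : prim f 0 = 0.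
Proof. by rewrite /prim lexx set_itv_ge ?Rintegral_set0 ?bnd_simp// ltxx. Qed.

Lemma prim_continuous f : continuous f -> continuous (prim f).
Proof. by move=> cf; apply: deriv_is_continuous (prim_deriv cf). Qed.

Lemma prim_unique f F : continuous f -> deriv_is F f -> F 0 = 0 -> prim f = F.
Proof.
by move=> cf dF F0; apply: (deriv_is_inj (prim_deriv cf) dF (a := 0)); rewrite prim0.
Qed.

Lemma Rintegral_prim f (L : R) : 0 < L -> continuous f ->
  \int[mu]_(x in `[0, L]) f x = prim f L.
Proof.
move=> L0 cf; rewrite /prim (ltW L0) Rintegral_itv_obnd_cbnd//.
apply: integrableS (continuous_integrable_itv 0 L cf) => //; exact: subset_itv_oc_cc.
Qed.

Lemma Rintegral_deriv f f' (L : R) : 0 < L -> deriv_is f f' -> continuous f' ->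
  \int[mu]_(x in `[0, L]) f' x = f L - f 0.
Proof.
move=> L0 df cf'; rewrite Rintegral_prim//.
rewrite (@prim_unique f' (fun x => f x - f 0))//; last by rewrite subrr.
by move=> x; have := df x => ?; derive_ring.
Qed.

Lemma primD f g : continuous f -> continuous g ->
  forall x, prim (fun x => f x + g x) x = prim f x + prim g x.
Proof.
move=> cf cg x; rewrite (@prim_unique _ (fun x => prim f x + prim g x))//.
- by move=> y; apply: cvgD; [exact: cf|exact: cg].
- exact: deriv_isD (prim_deriv cf) (prim_deriv cg).
- by rewrite !prim0 addr0.
Qed.

Lemma primZ f (a : R) : continuous f ->
  forall x, prim (fun x => a * f x) x = a * prim f x.
Proof.
move=> cf x; rewrite (@prim_unique _ (fun x => a * prim f x))//.
- by move=> y; apply: cvgMr; exact: cf.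
- exact: deriv_isZ (prim_deriv cf).
- by rewrite prim0 mulr0.
Qed.

Lemma prim_norm_le f (M x : R) : continuous f -> (forall y, `|f y| <= M) ->
  `|prim f x| <= M * `|x|.
Proof.
move=> cf fM; have := deriv_is_lip (prim_deriv cf) fM x 0.
by rewrite prim0 !subr0.
Qed.

Lemma prim_norm_le_in f (M L x : R) : continuous f ->
  (forall y, 0 < y < L -> `|f y| <= M) -> 0 <= x <= L -> `|prim f x| <= M * x.
Proof.
move=> cf fM /andP[x0 xL].
have fMx y : 0 < y < x -> `|f y| <= M.
  by move=> /andP[y0 yx]; apply: fM; rewrite y0 (lt_le_trans yx).
by have := deriv_is_lip_in (prim_deriv cf) fMx x0; rewrite prim0 !subr0.
Qed.

Lemma prim_even f : continuous f -> (forall x, f (- x) = f x) ->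
  forall x, prim f (- x) = - prim f x.
Proof.
move=> cf fe x; apply/esym; rewrite -[LHS]mulN1r.
have d1 := deriv_isZ (-1) (prim_deriv cf); have d2 := deriv_is_opp (prim_deriv cf).
have e : (fun x => - f (- x)) = (fun x => -1 * f x) by apply/funext => y; rewrite fe mulN1r.
rewrite e in d2.
by apply: (deriv_is_inj_at x d1 d2 (a := 0)); rewrite oppr0 prim0 mulr0.
Qed.

Lemma prim_odd f : continuous f -> (forall x, f (- x) = - f x) ->
  forall x, prim f (- x) = prim f x.
Proof.
move=> cf fo x.
have d2 := deriv_is_opp (prim_deriv cf).
have e : (fun x => - f (- x)) = f by apply/funext => y; rewrite fo opprK.
rewrite e in d2.
by apply: (deriv_is_inj_at x d2 (prim_deriv cf) (a := 0)); rewrite oppr0.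
Qed.

Lemma prim_shift f (L : R) : continuous f -> periodic f L ->
  forall x, prim f (x + L) = prim f x + prim f L.
Proof.
move=> cf fL x.
have d1 := deriv_is_shift L (prim_deriv cf).
have e : (fun x => f (x + L)) = f by apply/funext => y; rewrite fL.
rewrite e in d1.
have d2 := deriv_isD (prim_deriv cf) (deriv_is_cst (prim f L)).
have e2 : (fun x => f x + cst 0 x) = f by apply/funext => y; rewrite addr0.
rewrite e2 in d2.
by apply: (deriv_is_inj_at x d1 d2 (a := 0)); rewrite add0r prim0 add0r.
Qed.

Lemma prim_odd_period f (L : R) : continuous f -> (forall x, f (- x) = - f x) ->
  periodic f L -> prim f L = 0.
Proof.
move=> cf fo fL.
have := prim_shift cf fL (- L); rewrite addNr prim0 prim_odd//; lra.
Qed.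

End primitive.

(** * Uniqueness for linear second-order equations *)

Section ode_uniqueness.
Context {R : realType}.
Implicit Types (w a : R -> R).

(** The exponential weight is Gronwall's device: once s is large enough in absolute value, it fixes
    the sign of the derivative of the weighted energy. *)
Lemma ode_energy w w1 a (s : R) : deriv_is w w1 -> deriv_is w1 (fun x => a x * w x) ->
  deriv_is (fun x => (w x ^+ 2 + w1 x ^+ 2) * expR (s * x))
    (fun x => (2 * (w x * w1 x) * (1 + a x) + s * (w x ^+ 2 + w1 x ^+ 2)) * expR (s * x)).
Proof.
move=> dw dw1 x; have h1 := dw x; have h2 := dw1 x.
have h3 : is_derive x 1 (fun y => s * y) s.
  by have := deriv_isZ s (@deriv_is_id R) x; rewrite mulr1.
have h4 : is_derive x 1 (fun y => expR (s * y)) (expR (s * x) * s).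
  exact: (@is_derive1_comp _ expR).
derive_ring.
Qed.

Lemma linear_ode_uniq w w1 a (M x0 : R) :
  deriv_is w w1 -> deriv_is w1 (fun x => a x * w x) ->
  (forall x, `|a x| <= M) -> w x0 = 0 -> w1 x0 = 0 -> forall x, w x = 0.
Proof.
move=> dw dw1 aM w0 w10 x.
(* Since 2 |w w1| <= w^2 + w1^2, the rate 1 + M dominates the growth of the energy. The weight k is
   used to the left of x0 and -k to the right. *)
pose k := 1 + M.
have key y : `|2 * (w y * w1 y) * (1 + a y)| <= k * (w y ^+ 2 + w1 y ^+ 2).
  rewrite normrM mulrC; apply: ler_pM => //.
    by rewrite /k (le_trans (ler_normD _ _))// normr1 lerD2l.
  have := sqr_ge0 (w y + w1 y); have := sqr_ge0 (w y - w1 y).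
  by rewrite ler_norml => h1 h2; apply/andP; split; lra.
have fin y s : (w y ^+ 2 + w1 y ^+ 2) * expR (s * y) <= 0 -> w y = 0.
  rewrite pmulr_lle0 ?expR_gt0// => h.
  have h1 := sqr_ge0 (w y); have h2 := sqr_ge0 (w1 y).
  by apply/eqP; rewrite -sqrf_eq0; apply/eqP; lra.
case/orP: (le_total x x0) => xx.
- apply: (fin x k).
  have := deriv_is_ndecr (ode_energy k dw dw1) _ xx.
  rewrite /= w0 w10 expr0n/= addr0 mul0r; apply => y.
  apply: mulr_ge0; last exact: expR_ge0.
  by have := key y; rewrite ler_norml => /andP[]; lra.
- apply: (fin x (- k)).
  have := deriv_is_ndecr (deriv_isZ (-1) (ode_energy (- k) dw dw1)) _ xx.
  rewrite /= w0 w10 expr0n/= addr0 mul0r mulr0 mulN1r oppr_ge0; apply => y.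
  rewrite mulN1r -mulNr; apply: mulr_ge0; last exact: expR_ge0.
  by have := key y; rewrite ler_norml => /andP[]; lra.
Qed.

End ode_uniqueness.

(** * The stationary equation *)

Section periodic_functions.
Context {R : realType}.
Implicit Types (f : R -> R) (L : R).

Lemma periodic_reduce L x : 0 < L ->
  exists2 y, 0 <= y <= L & forall f, periodic f L -> f x = f y.
Proof.
move=> L0; have Lge0 := ltW L0.
pose k1 := (Num.truncn (`|x| / L)).+1.
have k1P : `|x| < k1%:R * L by rewrite -ltr_pdivrMr// /k1 truncnS_gt.
pose y0 := x + k1%:R * L.
have y00 : 0 <= y0 by have := ler_norm (- x); rewrite normrN /y0; lra.
pose k2 := Num.truncn (y0 / L).
have /andP[k2l k2u] : k2%:R <= y0 / L < k2.+1%:R by apply: truncn_itv; rewrite divr_ge0.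
exists (y0 - k2%:R * L).
  rewrite ler_pdivlMr// in k2l; rewrite ltr_pdivrMr// -natr1 mulrDl mul1r in k2u.
  by apply/andP; split; lra.
move=> f fL.
rewrite -(periodicn fL k1 x) (_ : x + L *+ k1 = (y0 - k2%:R * L) + L *+ k2).
  exact: periodicn.
by rewrite /y0 -(mulr_natl L k1) -(mulr_natl L k2) subrK.
Qed.

Lemma periodic_bounded f L : 0 < L -> periodic f L -> continuous f ->
  exists2 M, 0 < M & forall x, `|f x| <= M.
Proof.
move=> L0 fL cf.
have cn : {within `[0, L], continuous (fun x => `|f x|)}.
  by apply: continuous_subspaceT => x; apply: cvg_norm; exact: cf.
have [c _ cP] := EVT_max (ltW L0) cn.
exists (`|f c| + 1); first by have := normr_ge0 (f c); lra.
move=> x; have [y yL ->//] := periodic_reduce x L0.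
by apply: le_trans (cP y _) _; rewrite ?in_itv//= lerDl.
Qed.

Lemma periodic_max f f' L : 0 < L -> deriv_is f f' -> periodic f L ->
  exists c, (forall x, f x <= f c) /\ f' c = 0.
Proof.
move=> L0 df fL.
have cn : {within `[0, L], continuous f}.
  by apply: continuous_subspaceT; exact: deriv_is_continuous df.
have [c _ cP] := EVT_max (ltW L0) cn.
have cmax x : f x <= f c.
  by have [y yL ->//] := periodic_reduce x L0; apply: cP; rewrite in_itv.
exists c; split => //.
have dc : is_derive c 1 f 0.
  apply: (@derive1_at_max _ f (c - 1) (c + 1)) => //; first lra.
  - by move=> t _; exact: deriv_is_derivable df t.
  - by rewrite in_itv/=; apply/andP; split; lra.
have dc' := df c.
by rewrite -(@derive_val _ _ _ _ _ _ _ dc') (@derive_val _ _ _ _ _ _ _ dc).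
Qed.

Lemma periodicN f L : periodic f L -> periodic (fun x => - f x) L.
Proof. by move=> fL x; rewrite fL. Qed.

Lemma periodic_min f f' L : 0 < L -> deriv_is f f' -> periodic f L ->
  exists c, (forall x, f c <= f x) /\ f' c = 0.
Proof.
move=> L0 df fL.
have dN : deriv_is (fun x => - f x) (fun x => - f' x).
  by move=> x; have := df x => ?; derive_ring.
have [c [cP c0]] := periodic_max L0 dN (periodicN fL).
by exists c; split => [x|]; [have := cP x; lra|lra].
Qed.

End periodic_functions.

Section stationary_ode.
Context {R : realType}.
Variables (u p : R -> R) (c L : R).
Hypotheses (L0 : 0 < L) (du : deriv_is u p)
  (dp : deriv_is p (fun x => u x ^+ 3 - u x + c)) (uL : periodic u L).

(** The difference of the cubes is divisible by y - u, so y - u solves a linear equation whose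
    coefficient is bounded because it is continuous and periodic. *)
Lemma ode_uniq_pair (y q : R -> R) x0 : deriv_is y q ->
  deriv_is q (fun x => y x ^+ 3 - y x + c) -> periodic y L ->
  y x0 = u x0 -> q x0 = p x0 -> y = u.
Proof.
move=> dy dq yL yx qx.
pose a x := y x ^+ 2 + y x * u x + u x ^+ 2 - 1.
have cu := deriv_is_continuous du; have cy := deriv_is_continuous dy.
have ca : continuous a.
  move=> x; rewrite /a; apply: cvgB; last exact: cvg_cst.
  apply: cvgD; first apply: cvgD.
  - by apply: cvgM; exact: cy.
  - by apply: cvgM; [exact: cy|exact: cu].
  - by apply: cvgM; exact: cu.
have aL : periodic a L by move=> x; rewrite /a uL yL.
have [M _ aM] := periodic_bounded L0 aL ca.
have d1 : deriv_is (fun x => q x - p x) (fun x => a x * (y x - u x)).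
  by apply: deriv_is_eq (deriv_isB dq dp) _ => x; rewrite /a; ring.
apply/funext => x; apply/subr0_eq.
by apply: (linear_ode_uniq (deriv_isB dy du) d1 aM (x0 := x0)); rewrite ?yx ?qx subrr.
Qed.

Lemma ode_constant x0 : p x0 = 0 -> u x0 ^+ 3 - u x0 + c = 0 -> u = cst (u x0).
Proof.
move=> p0 e0; apply/esym; refine (@ode_uniq_pair (cst (u x0)) (cst 0) x0 _ _ _ _ _) => //.
- exact: deriv_is_cst.
- by rewrite /cst e0; exact: deriv_is_cst.
Qed.

Lemma ode_energy_cst : exists e, forall x,
  p x ^+ 2 = 2^-1 * u x ^+ 4 - u x ^+ 2 + 2 * c * u x + e.
Proof.
have dE : deriv_is (fun x => p x ^+ 2 - (2^-1 * u x ^+ 4 - u x ^+ 2 + 2 * c * u x)) (cst 0).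
  move=> x; have h1 := du x; have h2 := dp x.
  rewrite [X in is_derive _ _ _ X]/=.
  apply: is_derive_eq; rewrite /GRing.scale/=; lra.
exists (p 0 ^+ 2 - (2^-1 * u 0 ^+ 4 - u 0 ^+ 2 + 2 * c * u 0)) => x.
have := deriv_is0_cst dE x 0 => /=; lra.
Qed.

Hypothesis nt : ~ exists a, forall x, u x = a.

(** A and B are the maximum and minimum of u. There u' vanishes, so both are roots of the quartic in
    the first integral, and T is the remaining factor. T is nonnegative between B and A because p^2
    is and u takes every intermediate value; a zero of T at A or B would make that value an
    equilibrium and u constant. Concavity then gives strict positivity on the whole range. *)
Lemma ode_factor : exists A B : R, [/\ B < A,
   (forall x, B <= u x <= A),
   (forall y, B <= y <= A -> 0 < - y ^+ 2 - (A + B) * y - (A ^+ 2 + A * B + B ^+ 2 - 2)),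
   (forall x, p x ^+ 2 = 2^-1 * ((A - u x) * (u x - B)) *
      (- u x ^+ 2 - (A + B) * u x - (A ^+ 2 + A * B + B ^+ 2 - 2))) &
   4 * c = (A + B) * (2 - A ^+ 2 - B ^+ 2)].
Proof.
have [xM [uM pM]] := periodic_max L0 du uL.
have [xm [um pm]] := periodic_min L0 du uL.
pose A := u xM; pose B := u xm; exists A, B.
have BA : B < A.
  rewrite lt_neqAle uM andbT; apply/eqP => BA; apply: nt; exists B => x.
  by apply/eqP; rewrite eq_le um andbT -/B BA uM.
have BuA x : B <= u x <= A by rewrite um uM.
have [e eP] := ode_energy_cst.
have eA : 2^-1 * A ^+ 4 - A ^+ 2 + 2 * c * A + e = 0 by rewrite -eP pM expr0n.
have eB : 2^-1 * B ^+ 4 - B ^+ 2 + 2 * c * B + e = 0 by rewrite -eP pm expr0n.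
have cE : 4 * c = (A + B) * (2 - A ^+ 2 - B ^+ 2).
  have AB0 : A - B != 0 by rewrite subr_eq0 gt_eqF.
  apply: (mulfI AB0).
  have -> : (A - B) * (4 * c) = 2 * (2 * c * A - 2 * c * B) by ring.
  have -> : 2 * c * A = - (2^-1 * A ^+ 4 - A ^+ 2 + e) by lra.
  have -> : 2 * c * B = - (2^-1 * B ^+ 4 - B ^+ 2 + e) by lra.
  by field.
pose T (y : R) := - y ^+ 2 - (A + B) * y - (A ^+ 2 + A * B + B ^+ 2 - 2).
have PT y : 2^-1 * y ^+ 4 - y ^+ 2 + 2 * c * y + e = 2^-1 * ((A - y) * (y - B)) * T y.
  have -> : e = - (2^-1 * A ^+ 4 - A ^+ 2 + 2 * c * A) by lra.
  have -> : c = 4^-1 * ((A + B) * (2 - A ^+ 2 - B ^+ 2)) by rewrite -cE; field.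
  by rewrite /T; field.
have Tge0 y : B < y < A -> 0 <= T y.
  move=> /andP[By yA].
  have [x ux] : exists x, u x = y.
    have cn a b : {within `[a, b], continuous u}.
      by apply: continuous_subspaceT; exact: deriv_is_continuous du.
    have [x0|/ltW x0] := leP xm xM.
      suff [x _ <-] : exists2 x, x \in `[xm, xM] & u x = y by exists x.
      apply: IVT => //.
      by rewrite -/A -/B (min_idPl (ltW BA)) (max_idPr (ltW BA)) !ltW.
    suff [x _ <-] : exists2 x, x \in `[xM, xm] & u x = y by exists x.
    apply: IVT => //.
    by rewrite -/A -/B (min_idPr (ltW BA)) (max_idPl (ltW BA)) !ltW.
  have := sqr_ge0 (p x); rewrite eP ux PT; rewrite pmulr_rge0//.
  by rewrite pmulr_rgt0 ?invr_gt0// mulr_gt0// subr_gt0.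
(* A Lipschitz constant of T on [B, A], enlarged by 1 to be positive. It carries the sign of T from
   the open interval to its ends. *)
pose C := `|A + B| + `|A| + `|B| + `|A| + `|B| + 1.
have [nA nB nAB] : [/\ 0 <= `|A|, 0 <= `|B| & 0 <= `|A + B|] by rewrite !normr_ge0.
have C0 : 0 < C by rewrite /C; lra.
have ub (y : R) : y <= `|y| /\ - y <= `|y|.
  by rewrite ler_norm -[in X in _ /\ X]normrN ler_norm.
have [[uA1 uA2] [uB1 uB2] [uAB1 uAB2]] := And3 (ub A) (ub B) (ub (A + B)).
have TAB x y : B <= x <= A -> B < y < A -> T x - T y <= `|x - y| * C /\ T y - T x <= `|x - y| * C.
  move=> /andP[h1 h2] /andP[h3 h4].
  have -> : T x - T y = (x - y) * (- (x + y + A + B)) by rewrite /T; ring.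
  have -> : T y - T x = (x - y) * (x + y + A + B) by rewrite /T; ring.
  have H : `|x + y + A + B| <= C by rewrite ler_norml /C; apply/andP; split; lra.
  split; apply: le_trans (ler_norm _) _; rewrite normrM ?normrN; exact: ler_wpM2l.
have Tge0c x : B <= x <= A -> 0 <= T x.
  move=> xAB; rewrite leNgt; apply/negP => Tx.
  (* Moving x by the fraction [eps] towards the midpoint enters the open interval and changes T by
     at most half of -T x, so T would still be negative there. *)
  pose eps := Num.min 1 (- T x / (2 * C * (A - B))).
  have AB0 : 0 < A - B by lra.
  have eps0 : 0 < eps by rewrite lt_min ltr01/= divr_gt0 ?oppr_gt0// !mulr_gt0.
  have eps1 : eps <= 1 by rewrite ge_min lexx.
  have eps2 : eps * (2 * C * (A - B)) <= - T x.
    by rewrite -ler_pdivlMr ?mulr_gt0// ge_min lexx orbT.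
  pose y := x + eps * ((A + B) / 2 - x).
  have yAB : B < y < A.
    by case/andP: xAB => h1 h2; rewrite /y; apply/andP; split; nra.
  have [_ h] := TAB x y xAB yAB.
  have := Tge0 y yAB.
  have : `|x - y| <= eps * (A - B).
    have -> : x - y = eps * (x - (A + B) / 2) by rewrite /y; ring.
    rewrite normrM (gtr0_norm eps0); apply: ler_wpM2l; first exact: ltW.
    by case/andP: xAB => h1 h2; rewrite ler_norml; apply/andP; split; lra.
  move=> /(ler_wpM2r (ltW C0)) h3; lra.
have dpA : A ^+ 3 - A + c = - 4^-1 * (A - B) * T A.
  have -> : c = 4^-1 * ((A + B) * (2 - A ^+ 2 - B ^+ 2)) by rewrite -cE; field.
  by rewrite /T; field.
have dpB : B ^+ 3 - B + c = 4^-1 * (A - B) * T B.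
  have -> : c = 4^-1 * ((A + B) * (2 - A ^+ 2 - B ^+ 2)) by rewrite -cE; field.
  by rewrite /T; field.
have TA : 0 < T A.
  rewrite lt_neqAle Tge0c ?lexx ?ltW// andbT; apply/eqP => TA0; apply: nt; exists A => x.
  by rewrite (ode_constant pM _)//= -/A dpA -TA0; ring.
have TB : 0 < T B.
  rewrite lt_neqAle Tge0c ?lexx ?ltW// andbT; apply/eqP => TB0; apply: nt; exists B => x.
  by rewrite (ode_constant pm _)//= -/B dpB -TB0; ring.
split => //.
- move=> y /andP[By yA]; rewrite -/(T y).
  have AB0 : 0 < A - B by lra.
  rewrite -(pmulr_rgt0 _ AB0).
  (* T is quadratic with leading coefficient -1, so this is its concavity inequality with the exact
     remainder. *)
  have -> : (A - B) * T y = (A - y) * T B + (y - B) * T A + (A - B) * ((A - y) * (y - B)).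
    by rewrite /T; ring.
  have h1 : 0 <= (A - y) * (y - B) by rewrite mulr_ge0// subr_ge0.
  have h2 : 0 <= (A - B) * ((A - y) * (y - B)) by rewrite mulr_ge0// ltW.
  have [e1|y1] := eqVneq y A; first by rewrite e1; nra.
  have h3 : 0 < (A - y) * T B by rewrite mulr_gt0// subr_gt0 lt_neqAle y1.
  have h4 : 0 <= (y - B) * T A by apply: mulr_ge0; [rewrite subr_ge0|exact: ltW].
  lra.
- by move=> x; rewrite eP; exact: PT.
Qed.

End stationary_ode.

(** * Zero mean and the symmetry of the range *)

Section zero_mean.
Context {R : realType}.
Implicit Types (u p : R -> R) (c L A B : R).

(** The solution moves more slowly above the midpoint m than below it when m > 0, because T takes a
    smaller value at m + w than at its reflection m - w. To compare the two halves without inverting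
    u, the ellipse 2 z^2 + (u - m)^2 = a^2 serves as a common parametrization. *)
Lemma mean_gt_midpoint u p c L A B : 0 < L -> deriv_is u p ->
  deriv_is p (fun x => u x ^+ 3 - u x + c) -> periodic u L -> B < A ->
  (forall x, B <= u x <= A) ->
  (forall y, B <= y <= A -> 0 < - y ^+ 2 - (A + B) * y - (A ^+ 2 + A * B + B ^+ 2 - 2)) ->
  (forall x, p x ^+ 2 = 2^-1 * ((A - u x) * (u x - B)) *
      (- u x ^+ 2 - (A + B) * u x - (A ^+ 2 + A * B + B ^+ 2 - 2))) ->
  4 * c = (A + B) * (2 - A ^+ 2 - B ^+ 2) ->
  0 < A + B -> 0 < prim u L.
Proof.
move=> L0 du dp uL BA uAB.
pose T (y : R) := - y ^+ 2 - (A + B) * y - (A ^+ 2 + A * B + B ^+ 2 - 2).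
move=> T0 pE cE AB0; rewrite -/(T _) in T0.
have {}pE x : p x ^+ 2 = 2^-1 * ((A - u x) * (u x - B)) * T (u x) := pE x.
have {}T0 y : B <= y <= A -> 0 < T y := T0 y.
pose T' (y : R) := - 2 * y - (A + B).
have dT : deriv_is T T' by move=> y; rewrite /T /T'; derive_ring.
pose m := (A + B) / 2; pose a := (A - B) / 2.
(* This function satisfies (u - m) = -2 z' / sqrt(T(u)), and 2 z^2 = (A - u)(u - B) is even about
   m. *)
pose z x := p x * (Num.sqrt (T (u x)))^-1.
have dz : deriv_is z (fun x => - 2^-1 * (u x - m) * Num.sqrt (T (u x))).
  move=> x; have Tx := T0 _ (uAB x).
  have h1 := du x; have h2 := dp x.
  have h3 := is_derive1_comp (dT (u x)) h1.
  have h4 := is_derive1_comp (g := T \o u) (is_derive1_sqrt Tx) h3.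
  have s0 : Num.sqrt (T (u x)) != 0 by rewrite gt_eqF// sqrtr_gt0.
  have h5 := is_deriveV (f := Num.sqrt \o (T \o u)) s0 h4.
  have h6 := is_deriveM h2 h5.
  apply: is_derive_eq; rewrite /GRing.scale/=.
  have sE : Num.sqrt (T (u x)) ^+ 2 = T (u x) by rewrite sqr_sqrtr// ltW.
  have pEx := pE x; rewrite -sE in pEx; move: pEx.
  have : Num.sqrt (T (u x)) ^+ 2 = T (u x) := sE.
  move: (Num.sqrt _) s0 => s s0 sT pEx.
  have -> : p x * (- s ^- 2 * ((2 * s)^-1 * (T' (u x) * p x))) =
     - (p x ^+ 2) * T' (u x) * 2^-1 * s ^- 3 by field.
  rewrite pEx.
  have -> : u x ^+ 3 - u x + c = 4^-1 * ((A + B - 2 * u x) * s ^+ 2 +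
     ((A - u x) * (u x - B)) * T' (u x)).
    have -> : c = 4^-1 * ((A + B) * (2 - A ^+ 2 - B ^+ 2)) by rewrite -cE; field.
    by rewrite sT /T /T'; field.
  by rewrite /m; field.
have zE x : 2 * z x ^+ 2 = (A - u x) * (u x - B).
  have Tx := T0 _ (uAB x).
  by rewrite /z exprMn exprVn pE sqr_sqrtr ?(ltW Tx)//; field; rewrite gt_eqF.
(* The lower of the two values of u with a given z. Hence r (z x) is u x itself below m and its
   reflection above m. *)
pose r y := m - Num.sqrt (a ^+ 2 - 2 * y ^+ 2).
have rB y : B <= r y <= A.
  have h : Num.sqrt (a ^+ 2 - 2 * y ^+ 2) <= a.
    have a0 : 0 <= a by rewrite /a; lra.
    rewrite -{2}(ger0_norm a0) -sqrtr_sqr; apply: ler_wsqrtr.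
    by have := sqr_ge0 y; lra.
  have := sqrtr_ge0 (a ^+ 2 - 2 * y ^+ 2).
  by rewrite /r /m; move: h; rewrite /a => h1 h2; apply/andP; split; lra.
pose g y := (Num.sqrt (T (r y)))^-1.
have cg : continuous g.
  move=> y; apply: cvgV; first by rewrite gt_eqF// sqrtr_gt0 T0.
  apply: continuous_comp; last exact: sqrt_continuous.
  apply: continuous_comp; last exact: (deriv_is_continuous dT).
  apply: cvgB; first exact: cvg_cst.
  apply: continuous_comp; last exact: sqrt_continuous.
  apply: cvgB; first exact: cvg_cst.
  apply: cvgMr; exact: exprn_continuous.
have rz x : r (z x) = m - `|u x - m|.
  rewrite /r zE -sqrtr_sqr; congr (_ - Num.sqrt _).
  by rewrite /a /m; field.
have cu := deriv_is_continuous du.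
(* The last term is periodic in x. Below m it cancels the derivative of the other two; above m it
   falls short of it, so F is nondecreasing and the mean of u is at least m. *)
pose F x := prim u x - m * x + 2 * prim g (z x).
pose F' x := u x - m * 1 + 2 * (g (z x) * (- 2^-1 * (u x - m) * Num.sqrt (T (u x)))).
have dF : deriv_is F F'.
  apply: deriv_isD; first apply: deriv_isB.
  - exact: prim_deriv.
  - by apply: deriv_isZ; exact: deriv_is_id.
  - by apply: deriv_isZ; apply: deriv_is_comp dz; exact: prim_deriv.
have F0 x : 0 <= F' x.
  rewrite /F' /g rz mulr1.
  have -> : u x - m + 2 * ((Num.sqrt (T (m - `|u x - m|)))^-1 *
      (- 2^-1 * (u x - m) * Num.sqrt (T (u x)))) =
     (u x - m) * (1 - (Num.sqrt (T (m - `|u x - m|)))^-1 * Num.sqrt (T (u x))).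
    by set i := (Num.sqrt (T (m - _)))^-1; set j := Num.sqrt (T (u x)); field.
  have Tx := T0 _ (uAB x).
  have [um|um] := leP 0 (u x - m).
    apply: mulr_ge0 => //; rewrite subr_ge0 mulrC.
    have Tr : 0 < T (m - (u x - m)).
      by have := T0 _ (rB (z x)); rewrite rz ger0_norm.
    rewrite ger0_norm// ler_pdivrMr ?sqrtr_gt0// mul1r; apply: ler_wsqrtr.
    have -> : T (m - (u x - m)) = T (u x) + 8 * m * (u x - m) by rewrite /T /m; field.
    have m0 : 0 <= m by rewrite /m; lra.
    have := mulr_ge0 m0 um; lra.
  rewrite ltr0_norm// opprK.
  have -> : m + (u x - m) = u x by ring.
  by rewrite mulVf ?subrr ?mulr0// gt_eqF// sqrtr_gt0.
have := deriv_is_ndecr dF F0 (ltW L0).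
have zL : z L = z 0.
  by rewrite /z -[L]add0r (deriv_is_periodic du uL) uL.
rewrite /F zL prim0 mulr0 => h.
have : 0 < m * L by rewrite mulr_gt0// /m; lra.
lra.
Qed.

(** The comparison is applied to u and to -u, which solves the equation with -c and range
    [-A, ... -B] reflected about 0. Both signs of A + B are excluded, and c is a multiple of A +
    B. *)
Lemma zero_mean_ode_const u p c L : 0 < L -> deriv_is u p ->
  deriv_is p (fun x => u x ^+ 3 - u x + c) -> periodic u L ->
  (~ exists a, forall x, u x = a) -> prim u L = 0 -> c = 0.
Proof.
move=> L0 du dp uL nt u0.
have [A [B [BA uAB T0 pE cE]]] := ode_factor L0 du dp uL nt.
suff AB0 : A + B = 0 by rewrite AB0 mul0r in cE; lra.
apply/eqP; rewrite eq_le !leNgt; apply/andP; split; apply/negP => AB0.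
  by have := mean_gt_midpoint L0 du dp uL BA uAB T0 pE cE AB0; rewrite u0 ltxx.
have dNu := deriv_isZ (-1) du.
have dNp : deriv_is (fun x => -1 * p x)
    (fun x => (-1 * u x) ^+ 3 - (-1 * u x) + - c).
  by apply: deriv_is_eq (deriv_isZ (-1) dp) _ => x; ring.
have NuL : periodic (fun x => -1 * u x) L by move=> x; rewrite uL.
have : 0 < prim (fun x => -1 * u x) L.
  apply: (@mean_gt_midpoint _ _ (- c) L (- B) (- A)) dNu dNp NuL _ _ _ _ _ _ => //.
  - lra.
  - by move=> x; have /andP[h1 h2] := uAB x; apply/andP; split; lra.
  - move=> y /andP[h1 h2].
    have := T0 (- y); rewrite lerNr lerNl h1 h2 => /(_ isT).
    by congr (_ < _); ring.
  - by move=> x; rewrite exprMn pE; ring.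
  - by rewrite mulrN cE; ring.
  - lra.
by rewrite primZ ?u0 ?mulr0 ?ltxx//; exact: deriv_is_continuous du.
Qed.

End zero_mean.

(** * The linearized operator on odd functions *)

Definition odd_periodic {R : realType} (L : R) (f : R -> R) :=
  [/\ continuous f, periodic f L & forall x, f (- x) = - f x].

Section green.
Context {R : realType}.
Variables (u p : R -> R) (L : R).
Hypotheses (L0 : 0 < L) (du : deriv_is u p)
  (dp : deriv_is p (fun x => u x ^+ 3 - u x)) (uL : periodic u L) (u0 : u 0 = 0)
  (nt : ~ exists a, forall x, u x = a).

Let dp0 : deriv_is p (fun x => u x ^+ 3 - u x + 0).
Proof. by apply: deriv_is_eq dp _ => x; rewrite addr0. Qed.

(** The function - u (- x) solves the same equation with the same value and slope at 0, because u 0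
    = 0. *)
Lemma stationary_odd x : u (- x) = - u x.
Proof.
have d1 : deriv_is (fun x => - u (- x)) (fun x => p (- x)).
  apply: (@deriv_is_eq _ _ (fun x => -1 * - p (- x))).
    have := deriv_isZ (-1) (deriv_is_opp du).
    by under [X in deriv_is X]eq_fun do rewrite mulN1r.
  by move=> y; ring.
have d2 : deriv_is (fun x => p (- x)) (fun x => (- u (- x)) ^+ 3 - (- u (- x)) + 0).
  by apply: deriv_is_eq (deriv_is_opp dp) _ => y; ring.
have pL : periodic (fun x => - u (- x)) L.
  by move=> y /=; rewrite -[in RHS](subrK L (- y)) uL opprD.
have e : (fun x => - u (- x)) = u.
  by apply: (ode_uniq_pair L0 du dp0 uL (x0 := 0) d1 d2 pL) => /=; rewrite oppr0 ?u0 ?oppr0.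
by rewrite -[in RHS]e /= opprK.
Qed.

Let c := p 0 ^+ 2.

Lemma stationary_energy x : p x ^+ 2 = 2^-1 * u x ^+ 4 - u x ^+ 2 + c.
Proof.
have [e eP] := ode_energy_cst du dp0.
have -> : c = e by rewrite /c eP u0; ring.
by rewrite eP; ring.
Qed.

Lemma slope_neq0 : c != 0.
Proof.
rewrite sqrf_eq0; apply/eqP => p0; apply: nt; exists 0 => x.
have -> := ode_constant L0 du dp0 uL (x0 := 0) p0 _; rewrite u0//.
by ring.
Qed.

(** At c = 1/2 the first integral is (u^2 - 1)^2 / 2, the level of the heteroclinic orbits: the
    maximum of u would be an equilibrium. *)
Lemma slope_neq_half : 2 - 4 * c != 0.
Proof.
apply/eqP => c2.
have [A [B [BA uAB T0 pE cE]]] := ode_factor L0 du dp0 uL nt.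
have [xM [uM pM]] := periodic_max L0 du uL.
have h : (u xM ^+ 2 - 1) ^+ 2 = 0.
  have := stationary_energy xM; rewrite pM expr0n/= => h.
  have -> : (u xM ^+ 2 - 1) ^+ 2 = 2 * (2^-1 * u xM ^+ 4 - u xM ^+ 2 + c) + (2 - 4 * c) / 2.
    by field.
  by rewrite -h c2; ring.
have {}h : u xM ^+ 2 = 1 by move/eqP : h; rewrite sqrf_eq0 subr_eq0 => /eqP.
apply: nt; exists (u xM) => x.
have -> // := ode_constant L0 du dp0 uL (x0 := xM) pM _.
by rewrite exprSr h; ring.
Qed.

Let cu := deriv_is_continuous du.

Let cu2 : continuous (fun x => u x ^+ 2).
Proof. by move=> x; apply: cvgM; exact: cu. Qed.

Let I := prim (fun x => u x ^+ 2).

Let kappa := I L - 2 * c * L.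

(** The first integral makes p^2 the derivative of F, and F is periodic if kappa = 0. A periodic
    function with nonnegative derivative is constant, which forces p = 0. *)
Lemma period_nondegenerate : kappa != 0.
Proof.
apply/eqP => k0.
pose F x := 3^-1 * (u x * p x) - 3^-1 * (I x - 2 * c * x).
have dF : deriv_is F (fun x => p x ^+ 2).
  move=> x; have h1 := du x; have h2 := dp x; have h3 := prim_deriv cu2 x.
  apply: is_derive_eq; rewrite /GRing.scale/= stationary_energy.
  have := stationary_energy x; lra.
have FL : periodic F L.
  move=> x; rewrite /F uL (deriv_is_periodic du uL) /I prim_shift -/I//; last first.
    by move=> y; rewrite uL.
  have -> : I L = 2 * c * L by apply/eqP; rewrite -subr_eq0; apply/eqP.
  by ring.
have p2 x : p x ^+ 2 = 0.
  by apply: (deriv_is_periodic_ge0 L0 dF FL) => y; exact: sqr_ge0.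
by have := slope_neq0; rewrite /c p2 eqxx.
Qed.

(* p = u' and v span the solutions of the linearized equation w'' = (3 u^2 - 1) w. *)
Let v x := p x * (I x - 2 * c * x) + (2 - 2 * c) * u x - u x ^+ 3.
Let v1 x := (u x ^+ 3 - u x) * (I x - 2 * c * x) + p x * (2 - 4 * c - 2 * u x ^+ 2).

Let dv : deriv_is v v1.
Proof.
move=> x; have h1 := du x; have h2 := dp x; have h3 := prim_deriv cu2 x.
rewrite /v /v1; derive_ring.
Qed.

Let dv1 : deriv_is v1 (fun x => (3 * u x ^+ 2 - 1) * v x).
Proof.
move=> x; have h1 := du x; have h2 := dp x; have h3 := prim_deriv cu2 x.
rewrite /v1; apply: is_derive_eq; rewrite /GRing.scale/= /v.
have := congr1 (fun t => 4 * u x * t) (stationary_energy x).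
rewrite /= -/(I x); lra.
Qed.

Let v_shift x : v (x + L) = v x + kappa * p x.
Proof.
rewrite /v uL (deriv_is_periodic du uL) /I prim_shift -/I//; last by move=> y; rewrite uL.
by rewrite /kappa; ring.
Qed.

Let p_even x : p (- x) = p x.
Proof. exact: (deriv_is_odd du stationary_odd). Qed.

Let v_odd x : v (- x) = - v x.
Proof.
have I_odd : I (- x) = - I x.
  by apply: prim_even => // y; rewrite stationary_odd sqrrN.
by rewrite /v p_even stationary_odd I_odd; ring.
Qed.

(** The constant Wronskian of [p] and [v], read off at 0 where u and v vanish. It is nonzero by
    [slope_neq0] and [slope_neq_half]. *)
Let wr := c * (2 - 4 * c).

Let wronskian x : p x * v1 x - (u x ^+ 3 - u x) * v x = wr.
Proof.
transitivity (p x ^+ 2 * (2 - 4 * c - 2 * u x ^+ 2) -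
    (u x ^+ 3 - u x) * ((2 - 2 * c) * u x - u x ^+ 3)); first by rewrite /v1 /v; ring.
by rewrite stationary_energy /wr; field.
Qed.

Let cp := deriv_is_continuous dp.
Let cv := deriv_is_continuous dv.
Let A (f : R -> R) := prim (fun x => p x * f x).
Let B (f : R -> R) := prim (fun x => v x * f x).

(** Variation of constants with base point 0. Over one period the first two terms change by -p times
    B f L when f is odd, while v gains kappa * p; the coefficient of the last term is the one that
    restores periodicity. *)
Definition green (f : R -> R) (x : R) :=
  wr^-1 * (v x * A f x - p x * B f x + B f L / kappa * v x).
Let green1 (f : R -> R) (x : R) :=
  wr^-1 * (v1 x * A f x - (u x ^+ 3 - u x) * B f x + B f L / kappa * v1 x).

Let cpf f : continuous f -> continuous (fun x => p x * f x).
Proof. by move=> cf x; apply: cvgM; [exact: cp|exact: cf]. Qed.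
Let cvf f : continuous f -> continuous (fun x => v x * f x).
Proof. by move=> cf x; apply: cvgM; [exact: cv|exact: cf]. Qed.

Lemma green_deriv f : continuous f -> exists2 g, deriv_is (green f) g &
  deriv_is g (fun x => (3 * u x ^+ 2 - 1) * green f x + f x).
Proof.
move=> cf; exists (green1 f) => x.
  have h1 := dp x; have h2 := dv x.
  have h3 := prim_deriv (cpf cf) x; have h4 := prim_deriv (cvf cf) x.
  by rewrite /green /green1; derive_ring.
have h1 := dp x; have h2 := dv1 x; have h5 := du x.
have h3 := prim_deriv (cpf cf) x; have h4 := prim_deriv (cvf cf) x.
rewrite /green1; apply: is_derive_eq; rewrite /GRing.scale/= -/(A f x) -/(B f x).
have wr0 : wr != 0 by rewrite mulf_neq0 ?slope_neq0 ?slope_neq_half.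
(* Writing f through the constant Wronskian turns the remaining goal into a polynomial identity. *)
have e : f x = wr^-1 * ((p x * v1 x - (u x ^+ 3 - u x) * v x) * f x).
  by rewrite wronskian mulrA mulVf// mul1r.
rewrite [in RHS]e /green; ring.
Qed.

Lemma greenD f g x : continuous f -> continuous g ->
  green (fun x => f x + g x) x = green f x + green g x.
Proof.
move=> cf cg; rewrite /green /A /B.
have e1 : (fun x => p x * (f x + g x)) = (fun x => p x * f x + p x * g x).
  by apply/funext => y; rewrite mulrDr.
have e2 : (fun x => v x * (f x + g x)) = (fun x => v x * f x + v x * g x).
  by apply/funext => y; rewrite mulrDr.
have [c1 c2 c3 c4] := And4 (cpf cf) (cpf cg) (cvf cf) (cvf cg).
rewrite e1 e2 !primD//.
by ring.
Qed.

Lemma greenZ f (a : R) x : continuous f ->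
  green (fun x => a * f x) x = a * green f x.
Proof.
move=> cf; rewrite /green /A /B.
have e1 : (fun x => p x * (a * f x)) = (fun x => a * (p x * f x)).
  by apply/funext => y; rewrite mulrCA.
have e2 : (fun x => v x * (a * f x)) = (fun x => a * (v x * f x)).
  by apply/funext => y; rewrite mulrCA.
have [c1 c2] := conj (cpf cf) (cvf cf).
rewrite e1 e2 !primZ//.
by ring.
Qed.

Lemma green_odd_periodic f : odd_periodic L f -> odd_periodic L (green f).
Proof.
move=> [cf fL fo].
have pL := deriv_is_periodic du uL.
have pfL : periodic (fun x => p x * f x) L by move=> x; rewrite pL fL.
have pfo x : p (- x) * f (- x) = - (p x * f x) by rewrite p_even fo mulrN.
have AL : A f L = 0 by apply: prim_odd_period => //; exact: cpf.
have AP x : A f (x + L) = A f x.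
  by rewrite /A prim_shift//; [rewrite -/(A f L) AL addr0|exact: cpf].
have Ao x : A f (- x) = A f x by apply: prim_odd => //; exact: cpf.
have Bo x : B f (- x) = - B f x.
  by apply: prim_even; [exact: cvf|move=> y; rewrite v_odd fo mulrNN].
(* The increment of [B f] follows from that of v by comparing derivatives and the values at 0. *)
have BP x : B f (x + L) = B f x + kappa * A f x + B f L.
  have d1 := deriv_is_shift L (prim_deriv (cvf cf)).
  have d2 : deriv_is (fun x => B f x + kappa * A f x + B f L)
      (fun x => v (x + L) * f (x + L)).
    move=> y; have h3 := prim_deriv (cpf cf) y; have h4 := prim_deriv (cvf cf) y.
    by rewrite v_shift fL; derive_ring.
  by apply: (deriv_is_inj_at x d1 d2 (a := 0)); rewrite add0r /B /A !prim0 mulr0 !add0r.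
have [g dg _] := green_deriv cf.
split.
- exact: deriv_is_continuous dg.
- move=> x; rewrite /green v_shift pL AP BP.
  have := period_nondegenerate; move: (kappa) => k k0.
  by congr (_ * _); field.
- by move=> x; rewrite /green v_odd p_even Ao Bo; ring.
Qed.

(** Since v grows linearly, the estimate is made on [0, L] only and carried to the line by the
    periodicity of [green f]. *)
Lemma green_bounded : exists2 C, 0 < C & forall f M, odd_periodic L f ->
  (forall x, `|f x| <= M) -> forall x, `|green f x| <= C * M.
Proof.
have bnd (h : R -> R) : continuous h -> exists2 D, 0 < D & forall x, 0 <= x <= L -> `|h x| <= D.
  move=> ch.
  have cn : {within `[0, L], continuous (fun x => `|h x|)}.
    by apply: continuous_subspaceT => x; apply: cvg_norm; exact: ch.
  have [y _ yP] := EVT_max (ltW L0) cn.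
  exists (`|h y| + 1); first by have := normr_ge0 (h y); lra.
  by move=> x xL; apply: (le_trans (yP x _)); rewrite ?in_itv ?lerDl.
have [P P0 PP] := bnd _ cp; have [V V0 VP] := bnd _ cv.
pose C := `|wr^-1| * (V * (P * L) + P * (V * L) + V * L / `|kappa| * V) + 1.
have k0 : 0 < `|kappa| by rewrite normr_gt0 period_nondegenerate.
exists C.
  apply: ltr_wpDl => //; apply: mulr_ge0 => //.
  by rewrite !addr_ge0// !mulr_ge0 ?invr_ge0 ?(ltW V0) ?(ltW P0) ?(ltW L0) ?(ltW k0).
move=> f M fOP fM x.
have [cf _ _] := fOP; have [_ gP _] := green_odd_periodic fOP.
have [y yL ->//] := periodic_reduce x L0.
have M0 : 0 <= M := le_trans (normr_ge0 _) (fM 0).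
have Ab z : 0 <= z <= L -> `|A f z| <= P * L * M.
  move=> zL; have H t : 0 < t < L -> `|p t * f t| <= P * M.
    by move=> /andP[t0 tL]; rewrite normrM; apply: ler_pM => //; apply: PP; rewrite !ltW.
  apply: le_trans (prim_norm_le_in (cpf cf) H zL) _.
  case/andP: zL => z0 zL; rewrite [leRHS]mulrAC.
  by apply: ler_wpM2l => //; apply: mulr_ge0 => //; exact: ltW.
have Bb z : 0 <= z <= L -> `|B f z| <= V * L * M.
  move=> zL; have H t : 0 < t < L -> `|v t * f t| <= V * M.
    by move=> /andP[t0 tL]; rewrite normrM; apply: ler_pM => //; apply: VP; rewrite !ltW.
  apply: le_trans (prim_norm_le_in (cvf cf) H zL) _.
  case/andP: zL => z0 zL; rewrite [leRHS]mulrAC.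
  by apply: ler_wpM2l => //; apply: mulr_ge0 => //; exact: ltW.
have LL : 0 <= L <= L by rewrite ltW// lexx.
have -> : C * M = `|wr^-1| * (V * (P * L * M) + P * (V * L * M) + V * L * M / `|kappa| * V) + M.
  by rewrite /C; ring.
apply: ler_wpDr => //; rewrite /green normrM; apply: ler_wpM2l => //.
apply: (le_trans (ler_normD _ _)); apply: lerD.
  apply: (le_trans (ler_normB _ _)); apply: lerD; rewrite normrM; apply: ler_pM => //; auto.
rewrite !normrM normfV; apply: ler_pM; rewrite ?mulr_ge0 ?invr_ge0//; last exact: VP.
by apply: ler_wpM2r; rewrite ?invr_ge0//; exact: Bb.
Qed.

End green.

(** * Perturbation of the stationary solution *)

Section bounded_operators.
Context {R : realType}.
Variable (L : R).
Hypothesis L0 : 0 < L.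
Implicit Types (f g : R -> R) (K S : (R -> R) -> R -> R).

Definition cper (f : R -> R) := continuous f /\ periodic f L.

Lemma cper_cst (a : R) : cper (fun=> a).
Proof. by split=> // x; exact: cvg_cst. Qed.

Lemma cperD f g : cper f -> cper g -> cper (fun x => f x + g x).
Proof.
move=> [cf fL] [cg gL]; split=> x; last by rewrite fL gL.
by apply: cvgD; [exact: cf|exact: cg].
Qed.

Lemma cperB f g : cper f -> cper g -> cper (fun x => f x - g x).
Proof.
move=> [cf fL] [cg gL]; split=> x; last by rewrite fL gL.
by apply: cvgB; [exact: cf|exact: cg].
Qed.

Lemma cperN f : cper f -> cper (fun x => - f x).
Proof.
move=> [cf fL]; split=> x; last by rewrite fL.
by apply: cvgN; exact: cf.
Qed.

Lemma cperM f g : cper f -> cper g -> cper (fun x => f x * g x).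
Proof.
move=> [cf fL] [cg gL]; split=> x; last by rewrite fL gL.
by apply: cvgM; [exact: cf|exact: cg].
Qed.

Lemma cperX f n : cper f -> cper (fun x => f x ^+ n).
Proof.
move=> [cf fL]; split=> x; last by rewrite fL.
by apply: (@continuous_comp _ _ _ f (fun y => y ^+ n)); [exact: cf|exact: exprn_continuous].
Qed.

(** Boundedness for the sup norm, expressed through arbitrary pointwise bounds M so that no norm on
    functions is needed. *)
Definition bounded_op (K : (R -> R) -> R -> R) (C : R) :=
  [/\ forall f, cper f -> cper (K f),
      forall f g, cper f -> cper g -> forall x, K (fun y => f y + g y) x = K f x + K g x,
      forall a f, cper f -> forall x, K (fun y => a * f y) x = a * K f x &
      forall f M, cper f -> (forall x, `|f x| <= M) -> forall x, `|K f x| <= C * M].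

Lemma bounded_op_sub K C f g x : bounded_op K C -> cper f -> cper g ->
  K (fun y => f y - g y) x = K f x - K g x.
Proof.
move=> [Kp KD KZ Kb] pf pg.
have -> : (fun y => f y - g y) = (fun y => f y + -1 * g y).
  by apply/funext => y; rewrite mulN1r.
rewrite KD//; last exact: (cperM (cper_cst _)).
by rewrite KZ// mulN1r.
Qed.

Lemma bounded_op_comp K S C D : bounded_op K C -> bounded_op S D ->
  bounded_op (K \o S) (C * D).
Proof.
move=> [Kp KD KZ Kb] [Sp SD SZ Sb]; split => /=.
- by move=> f pf; apply: Kp; exact: Sp.
- move=> f g pf pg x; rewrite -KD; [|exact: Sp..].
  by congr (K _ _); apply/funext => y; exact: SD.
- move=> a f pf x; rewrite -KZ; last exact: Sp.
  by congr (K _ _); apply/funext => y; exact: SZ.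
- move=> f M pf fM x; rewrite -mulrA; apply: Kb; first exact: Sp.
  exact: Sb.
Qed.

Lemma bounded_opZ K C (a : R) : bounded_op K C ->
  bounded_op (fun f x => a * K f x) (`|a| * C).
Proof.
move=> [Kp KD KZ Kb]; split => /=.
- by move=> f pf; apply: cperM; [exact: cper_cst|exact: Kp].
- by move=> f g pf pg x; rewrite KD// mulrDr.
- by move=> b f pf x; rewrite KZ// mulrCA.
- by move=> f M pf fM x; rewrite normrM -mulrA; apply: ler_wpM2l => //; exact: Kb.
Qed.

Definition mean f := prim f L / L.

Lemma mean_deriv f f' : deriv_is f f' -> cper f -> continuous f' -> mean f' = 0.
Proof.
move=> df [cf fL] cf'; rewrite /mean -Rintegral_prim//.
by rewrite (Rintegral_deriv L0 df cf') -[L in f L]add0r fL subrr mul0r.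
Qed.

Lemma bounded_op_mean : bounded_op (fun f _ => mean f) 1.
Proof.
split.
- by move=> f pf; exact: cper_cst.
- by move=> f g [cf _] [cg _] _; rewrite /mean primD// mulrDl.
- by move=> a f [cf _] _; rewrite /mean primZ// mulrA.
- move=> f M [cf _] fM _; rewrite mul1r /mean normrM normfV (gtr0_norm L0).
  by rewrite ler_pdivrMr//; have := prim_norm_le L cf fM; rewrite (gtr0_norm L0).
Qed.

(** The operator J of the overview. Removing the drift mean f * x first makes it defined and
    periodic for f of any mean, with derivative f - mean f. *)
Definition antider f x :=
  prim f x - mean f * x - mean (fun y => prim f y - mean f * y).

Let g f x := prim f x - mean f * x.

Let g_deriv f : continuous f -> deriv_is (g f) (fun x => f x - mean f).
Proof.
move=> cf; apply: deriv_isB; first exact: prim_deriv.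
by apply: deriv_is_eq (deriv_isZ (mean f) deriv_is_id) _ => x; rewrite mulr1.
Qed.

Let g_cper f : cper f -> cper (g f).
Proof.
move=> [cf fL]; split; first exact: deriv_is_continuous (g_deriv cf).
move=> x; rewrite /g prim_shift// mulrDr /mean divfK ?gt_eqF//; ring.
Qed.

Lemma antider_deriv f : cper f -> deriv_is (antider f) (fun x => f x - mean f).
Proof.
move=> [cf fL]; apply: deriv_is_eq (deriv_isB (g_deriv cf) (deriv_is_cst _)) _ => x.
by rewrite subr0.
Qed.

Lemma antider_cper f : cper f -> cper (antider f).
Proof. by move=> pf; apply: (cperB (g_cper pf)); exact: cper_cst. Qed.

Lemma mean_cst (a : R) : mean (fun=> a) = a.
Proof.
rewrite /mean (@prim_unique _ _ (fun x => a * x)).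
- by rewrite mulfK// gt_eqF.
- by move=> x; exact: cvg_cst.
- by apply: deriv_is_eq (deriv_isZ a deriv_is_id) _ => x; rewrite mulr1.
- by rewrite mulr0.
Qed.

Lemma mean_antider f : cper f -> mean (antider f) = 0.
Proof.
move=> pf.
have := bounded_op_sub 0 bounded_op_mean (g_cper pf) (cper_cst (mean (g f))).
by rewrite mean_cst subrr.
Qed.

Let bounded_op_g : bounded_op g (2 * L).
Proof.
have [_ mD mZ mb] := bounded_op_mean.
split.
- exact: g_cper.
- move=> f1 f2 p1 p2 x; rewrite /g mD//.
  by case: p1 p2 => [c1 _] [c2 _]; rewrite primD//; ring.
- by move=> a f pf x; rewrite /g mZ//; case: pf => [cf _]; rewrite primZ//; ring.
- move=> f M pf fM x.
  have [_ gL] := g_cper pf; have [y /andP[y0 yL] ->//] := periodic_reduce x L0.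
  have [cf _] := pf.
  have M0 : 0 <= M := le_trans (normr_ge0 _) (fM 0).
  have h1 : `|prim f y| <= M * L.
    apply: le_trans (prim_norm_le y cf fM) _.
    by rewrite ger0_norm//; exact: ler_wpM2l.
  have h2 : `|mean f * y| <= M * L.
    rewrite normrM (ger0_norm y0); apply: ler_pM => //.
    by have := mb f M pf fM 0; rewrite mul1r.
  rewrite /g; apply: le_trans (ler_normB _ _) _; lra.
Qed.

Lemma bounded_op_antider : bounded_op antider (4 * L).
Proof.
have [gp gD gZ gb] := bounded_op_g; have [_ mD mZ mb] := bounded_op_mean.
have e f : antider f = fun x => g f x - mean (g f) by [].
split.
- exact: antider_cper.
- move=> f1 f2 p1 p2 x; rewrite !e gD//.
  have -> : g (fun y => f1 y + f2 y) = fun y => g f1 y + g f2 y.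
    by apply/funext => y; exact: gD.
  by rewrite (mD _ _ (gp _ p1) (gp _ p2) 0) opprD addrACA.
- move=> a f pf x; rewrite !e gZ//.
  have -> : g (fun y => a * f y) = fun y => a * g f y by apply/funext => y; exact: gZ.
  by rewrite (mZ _ _ (gp _ pf) 0) -mulrBr.
- move=> f M pf fM x; rewrite e.
  have h1 := gb f M pf fM x.
  have h2 := mb _ _ (gp _ pf) (gb f M pf fM) 0.
  apply: le_trans (ler_normB _ _) _; lra.
Qed.

(** Two zero-mean functions with the same derivative coincide. This recovers a derivative in x from
    the next one. *)
Lemma antiderK f f' : deriv_is f f' -> cper f -> continuous f' -> mean f = 0 ->
  antider f' = f.
Proof.
move=> df pf cf' f0.
have m0 := mean_deriv df pf cf'.
have pf' : cper f' by split=> //; apply: deriv_is_periodic df pf.2.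
have d1 : deriv_is (antider f') f'.
  by apply: deriv_is_eq (antider_deriv pf') _ => x; rewrite m0 subr0.
have e : f = fun x => antider f' x + (f 0 - antider f' 0).
  apply: (deriv_is_inj (a := 0) df); last by rewrite addrC subrK.
  by apply: deriv_is_eq (deriv_isD d1 (deriv_is_cst _)) _ => x; rewrite addr0.
have [_ mD _ _] := bounded_op_mean.
have := mD _ _ (antider_cper pf') (cper_cst (f 0 - antider f' 0)) 0.
rewrite -e f0 mean_antider// add0r mean_cst => h.
by rewrite [RHS]e -h; apply/funext => x; rewrite addr0.
Qed.

Lemma antider_odd f : cper f -> (forall x, f (- x) = - f x) ->
  forall x, antider f (- x) = antider f x.
Proof.
move=> [cf fL] fo x.
have m0 : mean f = 0 by rewrite /mean (prim_odd_period cf fo fL) mul0r.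
by rewrite /antider m0 prim_odd// !mul0r.
Qed.

Lemma antider_even f : cper f -> (forall x, f (- x) = f x) ->
  forall x, antider f (- x) = - antider f x.
Proof.
move=> pf fe; have [cf fL] := pf.
have go x : g f (- x) = - g f x by rewrite /g prim_even//; ring.
have [cg gL] := g_cper pf.
move=> x; rewrite /antider -/(g f x) -/(g f (- x)) -/(g f) go.
by rewrite /mean prim_odd_period// mul0r !subr0.
Qed.

(** The Green operator preserves periodicity only on odd functions. Precomposing with this
    projection gives an operator on all continuous periodic functions whose values are always
    odd. *)
Definition odd_part f x := 2^-1 * (f x - f (- x)).

Lemma cper_opp f : cper f -> cper (fun x => f (- x)).
Proof.
move=> [cf fL]; split.
  by move=> x; apply: continuous_comp; [exact: cvgN|exact: cf].
by move=> x; rewrite opprD -{1}(fL (- x - L)) subrK.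
Qed.

Lemma odd_part_odd_periodic f : cper f -> odd_periodic L (odd_part f).
Proof.
move=> pf; have [cg gL] := cperM (cper_cst 2^-1) (cperB pf (cper_opp pf)).
split; [exact: cg|exact: gL|].
by move=> x; rewrite /odd_part opprK; ring.
Qed.

Lemma odd_part_id f : (forall x, f (- x) = - f x) -> odd_part f = f.
Proof. by move=> fo; apply/funext => x; rewrite /odd_part fo; field. Qed.

Lemma odd_partD f h : odd_part (fun x => f x + h x) = fun x => odd_part f x + odd_part h x.
Proof. by apply/funext => x; rewrite /odd_part; ring. Qed.

Lemma odd_partZ a f : odd_part (fun x => a * f x) = fun x => a * odd_part f x.
Proof. by apply/funext => x; rewrite /odd_part; ring. Qed.

Lemma odd_part_bounded f M : (forall x, `|f x| <= M) -> forall x, `|odd_part f x| <= M.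
Proof.
move=> fM x; rewrite /odd_part normrM gtr0_norm//.
have := fM x; have := fM (- x); have := ler_normB (f x) (f (- x)); lra.
Qed.

End bounded_operators.

(** * Contractions with ratio one half in the sup norm *)

Section contraction.
Context {R : realType}.
Implicit Types (f g : R -> R).

Lemma le_geometric (z a C : R) : (forall n, z <= a + C * 2^-1 ^+ n) -> z <= a.
Proof.
move=> H; rewrite leNgt; apply/negP => az.
have za0 : 0 < z - a by rewrite subr_gt0.
pose n := Num.truncn (`|C| / (z - a)).
have nP : `|C| / (z - a) < n.+1%:R.
  exact: truncnS_gt.
have h1 : `|C| < n.+1%:R * (z - a) by rewrite -ltr_pdivrMr.
have h2 : n.+1%:R <= 2 ^+ n :> R by rewrite -natrX ler_nat ltn_expl.
have p0 : 0 < 2 ^+ n :> R by rewrite exprn_gt0.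
have h3 : `|C| < (z - a) * 2 ^+ n.
  by apply: (lt_le_trans h1); rewrite mulrC ler_wpM2l// ltW.
have := H n; rewrite exprVn -lerBlDl ler_pdivlMr// => h4.
by have := ler_norm C; lra.
Qed.

(** Iterating e |-> e/2 + c from any finite bound converges to 2c. An equation with small
    coefficients thus bounds its solution by its source terms. *)
Lemma norm_le_halving f (c e0 : R) : (forall x, `|f x| <= e0) ->
  (forall e, (forall x, `|f x| <= e) -> forall x, `|f x| <= e / 2 + c) ->
  forall x, `|f x| <= 2 * c.
Proof.
move=> f0 H x; apply: (@le_geometric _ _ (e0 - 2 * c)) => n; move: x.
elim: n => [|n IH] x; first by rewrite expr0 mulr1 addrC subrK.
apply: le_trans (H _ IH x) _; rewrite exprS; lra.
Qed.

(** The intervals around [w n x] of radius 2 C 2^-n are nested, so the supremum of their lower ends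
    lies in all of them; this gives the limit and its rate together. *)
Lemma uniform_geometric_limit (w : nat -> R -> R) (C : R) :
  (forall n x, `|w n.+1 x - w n x| <= C * 2^-1 ^+ n) ->
  exists f, forall n x, `|f x - w n x| <= 2 * C * 2^-1 ^+ n.
Proof.
move=> wC.
pose lo n x := w n x - 2 * C * 2^-1 ^+ n; pose hi n x := w n x + 2 * C * 2^-1 ^+ n.
have C0 n : 0 <= C * 2^-1 ^+ n := le_trans (normr_ge0 _) (wC n 0).
have loS x m n : lo n x <= lo (m + n)%N x.
  elim: m => // m IH; apply: (le_trans IH); rewrite addSn /lo exprS.
  by have := wC (m + n)%N x; rewrite ler_norml => /andP[]; have := C0 (m + n)%N; lra.
have hiS x m n : hi (m + n)%N x <= hi n x.
  elim: m => // m IH; apply: le_trans IH; rewrite addSn /hi exprS.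
  by have := wC (m + n)%N x; rewrite ler_norml => /andP[]; have := C0 (m + n)%N; lra.
have lohi x m n : lo m x <= hi n x.
  apply: (le_trans (loS x n m)); apply: le_trans (hiS x m n); rewrite [(m + n)%N]addnC.
  by rewrite /lo /hi; have := C0 (n + m)%N; lra.
pose A x := [set lo n x | n in [set: nat]].
have supA x : has_sup (A x).
  by split; [exists (lo 0%N x), 0%N|exists (hi 0%N x) => _ [n _ <-]; exact: lohi].
exists (fun x => sup (A x)) => n x.
have h1 : lo n x <= sup (A x) by apply: ub_le_sup; [exact: (supA x).2|exists n].
have h2 : sup (A x) <= hi n x.
  by apply: ge_sup => [|_ [m _ <-]]; [exact: (supA x).1|exact: lohi].
by move: h1 h2; rewrite /lo /hi ler_norml => h1 h2; apply/andP; split; lra.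
Qed.

Lemma geometric_limit_cper (w : nat -> R -> R) f (C L : R) :
  (forall n x, `|f x - w n x| <= C * 2^-1 ^+ n) -> (forall n, cper L (w n)) -> cper L f.
Proof.
move=> fw wp; split.
  move=> x; apply/cvgrPdist_le => /= e e0.
  have [n nP] : exists n, C * 2^-1 ^+ n <= e / 3.
    apply: contrapT => /forallNP H.
    have /le_geometric : forall n, e / 3 <= 0 + C * 2^-1 ^+ n.
      by move=> n; rewrite add0r; apply/ltW; rewrite ltNge; apply/negP/H.
    by lra.
  have /cvgrPdist_le/(_ (e / 3)) := (wp n).1 x.
  have e3 : 0 < e / 3 by lra.
  move=> /(_ e3); apply: filterS => y.
  have := fw n x; have := fw n y; rewrite !ler_norml => /andP[? ?] /andP[? ?] /andP[? ?].
  by apply/andP; split; lra.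
move=> x; apply/eqP; rewrite -subr_eq0 -normr_le0; apply: (@le_geometric _ _ (2 * C)) => n.
have := fw n x; have := fw n (x + L); rewrite (wp n).2 !ler_norml => /andP[? ?] /andP[? ?].
by apply/andP; split; lra.
Qed.

Lemma contraction_fixpoint (L r : R) (T : (R -> R) -> R -> R) : 0 <= r ->
  (forall f, cper L f -> (forall x, `|f x| <= r) ->
     cper L (T f) /\ forall x, `|T f x| <= r) ->
  (forall f g e, cper L f -> (forall x, `|f x| <= r) ->
     cper L g -> (forall x, `|g x| <= r) -> (forall x, `|f x - g x| <= e) ->
     forall x, `|T f x - T g x| <= e / 2) ->
  exists f, [/\ cper L f, forall x, `|f x| <= r & T f = f].
Proof.
move=> r0 Tr Tc.
pose w n := iter n T (cst 0).
have wP n : cper L (w n) /\ forall x, `|w n x| <= r.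
  elim: n => [|n [IH1 IH2]]; last exact: Tr.
  by split=> [|x]; [exact: cper_cst|rewrite normr0].
have wC n x : `|w n.+1 x - w n x| <= r * 2^-1 ^+ n.
  elim: n x => [|n IH] x; first by rewrite mulr1 subr0; exact: (wP 1%N).2.
  rewrite exprSr mulrA.
  by apply: Tc IH x; [exact: (wP n.+1).1|exact: (wP n.+1).2|exact: (wP n).1|exact: (wP n).2].
have [f fw] := uniform_geometric_limit wC.
have pf := geometric_limit_cper fw (fun n => (wP n).1).
have fr x : `|f x| <= r.
  apply: (@le_geometric _ _ (2 * r)) => n.
  have := fw n x; have := (wP n).2 x; rewrite !ler_norml => /andP[? ?] /andP[? ?].
  by apply/andP; split; lra.
exists f; split => //; apply/funext => x; apply/eqP; rewrite -subr_eq0 -normr_le0.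
apply: (@le_geometric _ _ (2 * r)) => n.
have h1 := Tc _ _ _ pf fr (wP n).1 (wP n).2 (fw n) x.
have := fw n.+1 x; move: h1; rewrite -/(w n.+1) exprS.
have -> : T (w n) x = w n.+1 x by [].
by rewrite !ler_norml => /andP[? ?] /andP[? ?]; apply/andP; split; lra.
Qed.

End contraction.

Section norm_bounds.
Context {R : realDomainType}.

Lemma normM_le (a b A B : R) : `|a| <= A -> `|b| <= B -> `|a * b| <= A * B.
Proof. by move=> aA bB; rewrite normrM; apply: ler_pM. Qed.

Lemma normD_le (a b A B : R) : `|a| <= A -> `|b| <= B -> `|a + b| <= A + B.
Proof. by move=> aA bB; apply: le_trans (ler_normD _ _) _; exact: lerD. Qed.

Lemma normB_le (a b A B : R) : `|a| <= A -> `|b| <= B -> `|a - b| <= A + B.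
Proof. by move=> aA bB; apply: le_trans (ler_normB _ _) _; exact: lerD. Qed.

End norm_bounds.

Ltac cper_auto := repeat match goal with
  | H : cper _ ?f |- cper _ ?f => exact: H
  | H : cper _ ?f |- cper _ (fun x => ?f x) => exact: H
  | |- cper _ (fun _ => ?a) => apply: cper_cst
  | |- cper ?L (fun x => @?f x - @?g x) => apply: (@cperB _ L f g)
  | |- cper ?L (fun x => @?f x + @?g x) => apply: (@cperD _ L f g)
  | |- cper ?L (fun x => - @?f x) => apply: (@cperN _ L f)
  | |- cper ?L (fun x => @?f x * @?g x) => apply: (@cperM _ L f g)
  | |- cper ?L (fun x => @?f x ^+ ?n) => apply: (@cperX _ L f n)
  end.

(* Uniform second-order form of "t |-> U t is C^1 into the continuous L-periodic
   functions with the sup norm, with derivative V", for |t| < d. *)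
Definition C11 {R : realType} (L d : R) (U V : R -> R -> R) :=
  (forall t, `|t| < d -> cper L (U t) /\ cper L (V t)) /\
  exists2 C, 0 <= C & forall t s x, `|t| < d -> `|s| < d ->
    [/\ `|U t x| <= C, `|V t x| <= C, `|U s x - U t x| <= C * `|s - t|,
        `|V s x - V t x| <= C * `|s - t| &
        `|U s x - U t x - (s - t) * V t x| <= C * (s - t) ^+ 2].

Lemma C11_intro {R : realType} (L d c1 c2 c3 c4 c5 : R) (U V : R -> R -> R) :
  (forall t, `|t| < d -> cper L (U t)) -> (forall t, `|t| < d -> cper L (V t)) ->
  (forall t x, `|t| < d -> `|U t x| <= c1) -> (forall t x, `|t| < d -> `|V t x| <= c2) ->
  (forall t s x, `|t| < d -> `|s| < d -> `|U s x - U t x| <= c3 * `|s - t|) ->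
  (forall t s x, `|t| < d -> `|s| < d -> `|V s x - V t x| <= c4 * `|s - t|) ->
  (forall t s x, `|t| < d -> `|s| < d ->
     `|U s x - U t x - (s - t) * V t x| <= c5 * (s - t) ^+ 2) -> C11 L d U V.
Proof.
move=> pU pV h1 h2 h3 h4 h5; split; first by move=> t td; split; [exact: pU|exact: pV].
have le (c n : R) : `|c| <= n -> c <= n by apply: le_trans; exact: ler_norm.
have [n1 n2 n3] := And3 (normr_ge0 c1) (normr_ge0 c2) (normr_ge0 c3).
have [n4 n5] := conj (normr_ge0 c4) (normr_ge0 c5).
exists (`|c1| + `|c2| + `|c3| + `|c4| + `|c5|); first by rewrite !addr_ge0.
move=> t s x td sd; split.
- by apply: (le_trans (h1 t x td)); apply: le; lra.
- by apply: (le_trans (h2 t x td)); apply: le; lra.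
- by apply: (le_trans (h3 t s x td sd)); apply: ler_wpM2r => //; apply: le; lra.
- by apply: (le_trans (h4 t s x td sd)); apply: ler_wpM2r => //; apply: le; lra.
- by apply: (le_trans (h5 t s x td sd)); apply: ler_wpM2r; [exact: sqr_ge0|apply: le; lra].
Qed.

(** * The quantitative implicit function argument *)

Section implicit.
Context {R : realType}.
Variables (L CK CQ : R) (K Q : (R -> R) -> R -> R) (u0 : R -> R).
Hypotheses (L0 : 0 < L) (CK0 : 0 <= CK) (CQ0 : 0 <= CQ)
  (HK : bounded_op L K CK) (HQ : bounded_op L Q CQ) (pu0 : cper L u0).

Let cperK f : cper L f -> cper L (K f). Proof. by case: HK => + _ _ _; exact. Qed.
Let cperQ f : cper L f -> cper L (Q f). Proof. by case: HQ => + _ _ _; exact. Qed.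

Let boundK f M : cper L f -> (forall x, `|f x| <= M) -> forall x, `|K f x| <= CK * M.
Proof. by case: HK => _ _ _ +; exact. Qed.
Let boundQ f M : cper L f -> (forall x, `|f x| <= M) -> forall x, `|Q f x| <= CQ * M.
Proof. by case: HQ => _ _ _ +; exact. Qed.

(** The two smallness conditions make the terms linear in f contribute at most half of its bound.
    Lipschitz dependence, the Taylor remainder and the vanishing of [w] at t = 0 all reduce to this
    estimate. *)
Lemma implicit_estimate (a b f rho sigma : R -> R) (tau alpha beta d c1 c2 : R) :
  cper L a -> cper L b -> cper L f -> cper L rho -> cper L sigma ->
  (forall x, `|a x| <= alpha) -> (forall x, `|b x| <= beta) -> `|tau| <= d ->
  CK * alpha <= 4^-1 -> CQ * beta * d <= 4^-1 ->
  (forall x, `|rho x| <= c1) -> (forall x, `|sigma x| <= c2) ->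
  (forall x, f x = K (fun y => a y * f y + rho y) x + tau * Q (fun y => b y * f y) x
    + Q sigma x) ->
  forall x, `|f x| <= 2 * (CK * c1 + CQ * c2).
Proof.
move=> pa pb pf pr ps aA bB td Ka Qb r1 s2 fE.
have [e0 _ e0P] := periodic_bounded L0 pf.2 pf.1.
apply: (norm_le_halving e0P) => e fe x.
have e_ge0 : 0 <= e := le_trans (normr_ge0 _) (fe 0).
have h1 : `|K (fun y => a y * f y + rho y) x| <= CK * (alpha * e + c1).
  by apply: boundK => [|y]; [cper_auto|apply: normD_le => //; exact: normM_le].
have h2 : `|tau * Q (fun y => b y * f y) x| <= d * (CQ * (beta * e)).
  apply: normM_le => //; apply: boundQ => [|y]; first cper_auto.
  exact: normM_le.
have h3 : `|Q sigma x| <= CQ * c2 by apply: boundQ.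
rewrite fE; apply: le_trans (normD_le (normD_le h1 h2) h3) _.
have := ler_wpM2r e_ge0 Ka; have := ler_wpM2r e_ge0 Qb; lra.
Qed.

(** The unknown is w = u - u0. The terms 3 u0 w^2 + w^3 are what remains of u^3 once the part linear
    in w has been absorbed in K, and the equation for v is the formal derivative in t of the
    equation for w. *)
Lemma implicit_solution : exists (d : R) (w v : R -> R -> R),
  [/\ 0 < d, C11 L d w v,
     forall t x, `|t| < d -> w t x =
       K (fun y => 3 * u0 y * w t y ^+ 2 + w t y ^+ 3) x + t * Q (fun y => (u0 y + w t y) ^+ 2) x,
     forall t x, `|t| < d -> v t x =
       K (fun y => (6 * u0 y * w t y + 3 * w t y ^+ 2) * v t y) x +
       Q (fun y => (u0 y + w t y) ^+ 2) x + 2 * t * Q (fun y => (u0 y + w t y) * v t y) x &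
     forall x, w 0 x = 0].
Proof.
have [M0 M00 M0P] := periodic_bounded L0 pu0.2 pu0.1.
pose M := M0 + 1.
have M1 : 1 <= M by rewrite /M; lra.
(* On the ball of radius r the cubic terms have Lipschitz constant at most 6 M r, so K makes it at
   most 1/4. *)
pose r := (24 * M * (CK + 1))^-1.
have den : 1 <= M * (CK + 1).
  have := mulr_ge0 (le_trans ler01 M1) CK0; lra.
have r0 : 0 < r by rewrite invr_gt0; lra.
have rE : r * (24 * M * (CK + 1)) = 1 by rewrite mulVf// gt_eqF//; lra.
have r1 : r <= 1 by nra.
have K1 : CK * (6 * M * r) <= 4^-1 by nra.
(* For |t| < d the forcing term has size at most r/8 and Lipschitz constant at most 1/4. Together
   with the bound on K this gives a contraction with ratio 1/2. *)
pose d := r / (8 * M ^+ 2 * (CQ + 1)).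
have den2 : 1 <= M ^+ 2 * (CQ + 1).
  have M2 : 1 <= M ^+ 2 by exact: exprn_ege1.
  have := mulr_ge0 (le_trans ler01 M2) CQ0; lra.
have d0 : 0 < d by rewrite divr_gt0//; lra.
have dE : d * (8 * M ^+ 2 * (CQ + 1)) = r by rewrite /d divfK// gt_eqF//; lra.
have Q1 : CQ * (2 * M ^+ 2) * d <= r / 4 by nra.
have Q2 : CQ * (2 * M) * d <= 4^-1.
  have : CQ * (2 * M) * d <= CQ * (2 * M ^+ 2) * d.
    by apply: ler_wpM2r; [exact: ltW|apply: ler_wpM2l => //; nra].
  by lra.
have d1 : d <= 1 by nra.
have u0M x : `|u0 x| <= M - 1 by rewrite /M addrK.
have [Kp KD KZ Kb] := HK; have [Qp QD QZ Qb] := HQ.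
have KB f g x : cper L f -> cper L g -> K (fun y => f y - g y) x = K f x - K g x.
  exact: bounded_op_sub HK.
have QB f g x : cper L f -> cper L g -> Q (fun y => f y - g y) x = Q f x - Q g x.
  exact: bounded_op_sub HQ.
have ball (f : R -> R) x : `|f x| <= r -> `|u0 x + f x| <= M.
  by move=> fr; apply: le_trans (normD_le (u0M x) fr) _; lra.
(* The divided difference of 3 u0 f^2 + f^3 between f and g. At f = g = w t it is the coefficient of
   v in the linearized equation. *)
have ball2 (f g : R -> R) x : `|f x| <= r -> `|g x| <= r ->
    `|3 * u0 x * (f x + g x) + (f x ^+ 2 + f x * g x + g x ^+ 2)| <= 6 * M * r.
  move=> fr gr.
  have h1 : `|3 * u0 x * (f x + g x)| <= 3 * (M - 1) * (r + r).
    by apply: normM_le; [apply: normM_le => //; rewrite ger0_norm|exact: normD_le].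
  have h2 : `|f x ^+ 2 + f x * g x + g x ^+ 2| <= r * r + r * r + r * r.
    by apply: normD_le; [apply: normD_le|]; exact: normM_le.
  by apply: le_trans (normD_le h1 h2) _; nra.
have fix1 t : `|t| < d -> exists f, [/\ cper L f, forall x, `|f x| <= r &
    (fun x => K (fun y => 3 * u0 y * f y ^+ 2 + f y ^+ 3) x +
      t * Q (fun y => (u0 y + f y) ^+ 2) x) = f].
  move=> td; apply: contraction_fixpoint; first exact: ltW.
  - move=> f pf fr; split.
      apply: cperD; first by apply: cperK; cper_auto.
      by apply: cperM; [exact: cper_cst|apply: cperQ; cper_auto].
    move=> x.
    have h1 : `|K (fun y => 3 * u0 y * f y ^+ 2 + f y ^+ 3) x| <= CK * (3 * M * (r * r)).
      apply: boundK => [|y]; first cper_auto.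
      have h : `|3 * u0 y * f y ^+ 2 + f y ^+ 3| <= 3 * (M - 1) * (r * r) + r * (r * r).
        apply: normD_le; last by rewrite exprS; apply: normM_le => //; exact: normM_le.
        by apply: normM_le; [apply: normM_le => //; rewrite ger0_norm|exact: normM_le].
      by apply: le_trans h _; nra.
    have h2 : `|t * Q (fun y => (u0 y + f y) ^+ 2) x| <= d * (CQ * (M * M)).
      apply: normM_le; first exact: ltW.
      by apply: boundQ => [|y]; [cper_auto|apply: normM_le; exact: ball].
    apply: le_trans (normD_le h1 h2) _.
    have := ler_wpM2r (ltW r0) K1; nra.
  - move=> f g e pf fr pg gr fge x.
    have e_ge0 : 0 <= e := le_trans (normr_ge0 _) (fge 0).
    set A := K _ x; set B := Q _ x; set A' := K _ x; set B' := Q _ x.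
    have -> : A + t * B - (A' + t * B') = (A - A') + t * (B - B') by ring.
    rewrite /A /A' /B /B' -KB; [|cper_auto..].
    rewrite -QB; [|cper_auto..].
    have h1 : `|K (fun y => 3 * u0 y * f y ^+ 2 + f y ^+ 3 - (3 * u0 y * g y ^+ 2 + g y ^+ 3)) x|
       <= CK * (6 * M * r * e).
      apply: boundK => [|y]; first cper_auto.
      have -> : 3 * u0 y * f y ^+ 2 + f y ^+ 3 - (3 * u0 y * g y ^+ 2 + g y ^+ 3) =
        (3 * u0 y * (f y + g y) + (f y ^+ 2 + f y * g y + g y ^+ 2)) * (f y - g y) by ring.
      by apply: normM_le => //; exact: ball2.
    have h2 : `|t * Q (fun y => (u0 y + f y) ^+ 2 - (u0 y + g y) ^+ 2) x| <=
       d * (CQ * ((M + M) * e)).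
      apply: normM_le; first exact: ltW.
      apply: boundQ => [|y]; first cper_auto.
      have -> : (u0 y + f y) ^+ 2 - (u0 y + g y) ^+ 2 =
        ((u0 y + f y) + (u0 y + g y)) * (f y - g y) by ring.
      by apply: normM_le => //; apply: normD_le; exact: ball.
    apply: le_trans (normD_le h1 h2) _.
    by have := ler_wpM2r e_ge0 K1; have := ler_wpM2r e_ge0 Q2; lra.
have /choice[w wP] : forall t, exists f, `|t| < d -> [/\ cper L f, forall x, `|f x| <= r &
    (fun x => K (fun y => 3 * u0 y * f y ^+ 2 + f y ^+ 3) x +
      t * Q (fun y => (u0 y + f y) ^+ 2) x) = f].
  move=> t; have [td|td] := boolP (`|t| < d); last by exists (cst 0).
  by have [f fP] := fix1 t td; exists f.
have pw t : `|t| < d -> cper L (w t) by move=> /wP[].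
have wr t x : `|t| < d -> `|w t x| <= r by move=> /wP[].
have wE t x : `|t| < d -> w t x =
    K (fun y => 3 * u0 y * w t y ^+ 2 + w t y ^+ 3) x + t * Q (fun y => (u0 y + w t y) ^+ 2) x.
  by move=> /wP[_ _ e]; rewrite -[in LHS]e.
have uM t x : `|t| < d -> `|u0 x + w t x| <= M by move=> td; apply: ball; exact: wr.
have a0E t x : 6 * u0 x * w t x + 3 * w t x ^+ 2 =
  3 * u0 x * (w t x + w t x) + (w t x ^+ 2 + w t x * w t x + w t x ^+ 2) by ring.
have aM t x : `|t| < d -> `|6 * u0 x * w t x + 3 * w t x ^+ 2| <= 6 * M * r.
  by move=> td; rewrite a0E; apply: ball2; exact: wr.
(* The source Q((u0 + w)^2) is at most half of r', and the terms linear in v contribute at most the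
   other half. The same number is the Lipschitz constant of w in t. *)
have [r' r'0 r'E] : exists2 r', 0 <= r' & r' = 2 * (CQ * (M * M)).
  by exists (2 * (CQ * (M * M))) => //; rewrite !mulr_ge0//; lra.
have fix2 t : `|t| < d -> exists f, [/\ cper L f, forall x, `|f x| <= r' &
    (fun x => K (fun y => (6 * u0 y * w t y + 3 * w t y ^+ 2) * f y) x +
      Q (fun y => (u0 y + w t y) ^+ 2) x + 2 * t * Q (fun y => (u0 y + w t y) * f y) x) = f].
  move=> td; have pwt := pw t td.
  have tQ f e x : cper L f -> (forall x, `|f x| <= e) ->
      `|2 * t * Q (fun y => (u0 y + w t y) * f y) x| <= 2 * d * (CQ * (M * e)).
    move=> pf fe; apply: normM_le.
      by apply: normM_le; [rewrite ger0_norm|exact: ltW].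
    by apply: boundQ => [|y]; [cper_auto|apply: normM_le => //; exact: uM].
  have tK f e x : cper L f -> (forall x, `|f x| <= e) ->
      `|K (fun y => (6 * u0 y * w t y + 3 * w t y ^+ 2) * f y) x| <= CK * (6 * M * r * e).
    by move=> pf fe; apply: boundK => [|y]; [cper_auto|apply: normM_le => //; exact: aM].
  apply: contraction_fixpoint => //.
  - move=> f pf fr; split.
      apply: cperD; last by apply: cperM; [exact: cper_cst|apply: cperQ; cper_auto].
      by apply: cperD; [apply: cperK; cper_auto|apply: cperQ; cper_auto].
    move=> x.
    have h1 := tK f r' x pf fr; have h3 := tQ f r' x pf fr.
    have h2 : `|Q (fun y => (u0 y + w t y) ^+ 2) x| <= CQ * (M * M).
      by apply: boundQ => [|y]; [cper_auto|apply: normM_le; exact: uM].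
    apply: le_trans (normD_le (normD_le h1 h2) h3) _.
    by have := ler_wpM2r r'0 K1; have := ler_wpM2r r'0 Q2; lra.
  - move=> f g e pf fr pg gr fge x.
    have e_ge0 : 0 <= e := le_trans (normr_ge0 _) (fge 0).
    set A := K _ x; set B := Q _ x; set D := Q _ x; set A' := K _ x; set D' := Q _ x.
    have -> : A + B + 2 * t * D - (A' + B + 2 * t * D') = (A - A') + 2 * t * (D - D') by ring.
    rewrite /A /A' /D /D' -KB; [|cper_auto..].
    rewrite -QB; [|cper_auto..].
    have pfg : cper L (fun y => f y - g y) by cper_auto.
    have h1 := tK _ e x pfg fge; have h3 := tQ _ e x pfg fge.
    have e1 : (fun y => (6 * u0 y * w t y + 3 * w t y ^+ 2) * f y -
        (6 * u0 y * w t y + 3 * w t y ^+ 2) * g y) =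
      (fun y => (6 * u0 y * w t y + 3 * w t y ^+ 2) * (f y - g y)).
      by apply/funext => y; rewrite mulrBr.
    have e2 : (fun y => (u0 y + w t y) * f y - (u0 y + w t y) * g y) =
      (fun y => (u0 y + w t y) * (f y - g y)).
      by apply/funext => y; rewrite mulrBr.
    rewrite e1 e2; apply: le_trans (normD_le h1 h3) _.
    by have := ler_wpM2r e_ge0 K1; have := ler_wpM2r e_ge0 Q2; lra.
have /choice[v vP] : forall t, exists f, `|t| < d -> [/\ cper L f, forall x, `|f x| <= r' &
    (fun x => K (fun y => (6 * u0 y * w t y + 3 * w t y ^+ 2) * f y) x +
      Q (fun y => (u0 y + w t y) ^+ 2) x + 2 * t * Q (fun y => (u0 y + w t y) * f y) x) = f].
  move=> t; have [td|td] := boolP (`|t| < d); last by exists (cst 0).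
  by have [f fP] := fix2 t td; exists f.
have pv t : `|t| < d -> cper L (v t) by move=> /vP[].
have vr t x : `|t| < d -> `|v t x| <= r' by move=> /vP[].
have vE t x : `|t| < d -> v t x =
    K (fun y => (6 * u0 y * w t y + 3 * w t y ^+ 2) * v t y) x +
      Q (fun y => (u0 y + w t y) ^+ 2) x + 2 * t * Q (fun y => (u0 y + w t y) * v t y) x.
  by move=> /vP[_ _ e]; rewrite -[in LHS]e.
have pu t : `|t| < d -> cper L (fun x => u0 x + w t x).
  by move=> td; have pwt := pw t td; cper_auto.
have Q00 x : Q (fun=> 0) x = 0.
  apply/eqP; rewrite -normr_le0 -[leRHS](mulr0 CQ).
  by apply: boundQ => [|y]; [exact: cper_cst|rewrite normr0].
(* Subtracting the two equations turns the nonlinear terms into divided differences and leaves (s -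
   t)(u0 + w s)^2 as the only source. *)
have lip t s : `|t| < d -> `|s| < d -> forall x, `|w s x - w t x| <= r' * `|s - t|.
  move=> td sd x; have pws := pw s sd; have pwt := pw t td.
  have -> : r' * `|s - t| = 2 * (CK * 0 + CQ * (`|s - t| * (M * M))) by rewrite r'E; ring.
  apply: (@implicit_estimate
     (fun y => 3 * u0 y * (w s y + w t y) + (w s y ^+ 2 + w s y * w t y + w t y ^+ 2))
     (fun y => (u0 y + w s y) + (u0 y + w t y)) (fun y => w s y - w t y) (fun=> 0)
     (fun y => (s - t) * (u0 y + w s y) ^+ 2) t (6 * M * r) (2 * M) d) => //.
  1-5: cper_auto.
  - by move=> y; apply: ball2; exact: wr.
  - move=> y; have -> : 2 * M = M + M by ring.
    by apply: normD_le; exact: uM.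
  - exact: ltW.
  - by move=> y; rewrite normr0.
  - by move=> y; apply: normM_le => //; apply: normM_le; exact: uM.
  move=> y; rewrite (wE s y sd) (wE t y td).
  set k1 := K _ y; set q1 := Q _ y; set k2 := K _ y; set q2 := Q _ y.
  set k3 := K _ y; set q3 := Q _ y; set q4 := Q _ y.
  have -> : k3 = k1 - k2.
    by rewrite /k1 /k2 -KB; [congr (K _ _); apply/funext => z; ring|cper_auto..].
  have -> : q3 = q1 - q2.
    by rewrite /q1 /q2 -QB; [congr (Q _ _); apply/funext => z; ring|cper_auto..].
  have -> : q4 = (s - t) * q1 by rewrite /q1 -QZ//; cper_auto.
  by ring.
have r2 t s x : `|t| < d -> `|s| < d -> `|(w s x - w t x) ^+ 2| <= r' ^+ 2 * (s - t) ^+ 2.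
  move=> td sd; have -> : r' ^+ 2 * (s - t) ^+ 2 = (r' * `|s - t|) * (r' * `|s - t|).
    by rewrite -[(s - t) ^+ 2]real_normK ?num_real//; ring.
  by apply: normM_le; exact: lip.
have w2 t s x : `|t| < d -> `|s| < d -> `|w s x - w t x| <= 2.
  by move=> td sd; apply: le_trans (normB_le (wr s x sd) (wr t x td)) _; lra.
pose c1 := (3 * M + 2) * r' ^+ 2; pose c2 := r' ^+ 2 + 2 * M * r'.
have second t s : `|t| < d -> `|s| < d -> forall x,
    `|w s x - w t x - (s - t) * v t x| <= 2 * (CK * (c1 * (s - t) ^+ 2) + CQ * (c2 * (s - t) ^+ 2)).
  move=> td sd x; have pws := pw s sd; have pwt := pw t td; have pvt := pv t td.
  (* The coefficients are the derivatives at w t. The sources are the exact Taylor remainders,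
     quadratic in s - t by the Lipschitz bound for w. *)
  apply: (@implicit_estimate
     (fun y => 6 * u0 y * w t y + 3 * w t y ^+ 2)
     (fun y => 2 * (u0 y + w t y)) (fun y => w s y - w t y - (s - t) * v t y)
     (fun y => (3 * (u0 y + w t y) + (w s y - w t y)) * (w s y - w t y) ^+ 2)
     (fun y => s * (w s y - w t y) ^+ 2 + 2 * (u0 y + w t y) * ((s - t) * (w s y - w t y)))
     t (6 * M * r) (2 * M) d) => //.
  1-5: cper_auto.
  - by move=> y; exact: aM.
  - by move=> y; apply: normM_le; [rewrite ger0_norm|exact: uM].
  - exact: ltW.
  - move=> y; rewrite /c1 -mulrA; apply: normM_le; last exact: r2.
    by apply: normD_le; [apply: normM_le; [rewrite ger0_norm|exact: uM]|exact: w2].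
  - move=> y; have -> : c2 * (s - t) ^+ 2 =
        1 * (r' ^+ 2 * (s - t) ^+ 2) + 2 * M * (`|s - t| * (r' * `|s - t|)).
      by rewrite /c2 -[(s - t) ^+ 2]real_normK ?num_real//; ring.
    apply: normD_le; apply: normM_le => //.
    + by apply: le_trans d1; exact: ltW.
    + exact: r2.
    + by apply: normM_le; [rewrite ger0_norm|exact: uM].
    + by apply: normM_le => //; exact: lip.
  move=> y; rewrite (wE s y sd) (wE t y td) (vE t y td).
  set k1 := K _ y; set q1 := Q _ y; set k2 := K _ y; set q2 := Q _ y.
  set k5 := K _ y; set q5 := Q _ y; set k3 := K _ y; set q3 := Q _ y; set q4 := Q _ y.
  have -> : k3 = k1 - k2 - (s - t) * k5.
    rewrite /k1 /k2 /k5 -KB; [|cper_auto..]; rewrite -KZ; last by cper_auto.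
    by rewrite -KB; [congr (K _ _); apply/funext => z; ring|cper_auto..].
  have qE : t * q3 + q4 = s * (q1 - q2) - 2 * t * (s - t) * q5.
    rewrite /q1 /q2 /q5 /q3 /q4 -QB; [|cper_auto..].
    rewrite -!QZ; [|cper_auto..].
    rewrite -QB; [|cper_auto..].
    by rewrite -QD; [congr (Q _ _); apply/funext => z; ring|cper_auto..].
  by rewrite -[RHS]addrA qE; ring.
pose c3 := 6 * M * r' * r'; pose c4 := 4 * M * r' + 2 * r' ^+ 2.
have lipv t s : `|t| < d -> `|s| < d -> forall x,
    `|v s x - v t x| <= 2 * (CK * (c3 * `|s - t|) + CQ * (c4 * `|s - t|)).
  move=> td sd x; have pws := pw s sd; have pwt := pw t td.
  have pvs := pv s sd; have pvt := pv t td.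
  apply: (@implicit_estimate
     (fun y => 6 * u0 y * w t y + 3 * w t y ^+ 2)
     (fun y => 2 * (u0 y + w t y)) (fun y => v s y - v t y)
     (fun y => 3 * ((u0 y + w s y) + (u0 y + w t y)) * (w s y - w t y) * v s y)
     (fun y => ((u0 y + w s y) + (u0 y + w t y)) * (w s y - w t y) +
        2 * t * ((w s y - w t y) * v s y) + 2 * (s - t) * ((u0 y + w s y) * v s y))
     t (6 * M * r) (2 * M) d) => //.
  1-5: cper_auto.
  - by move=> y; exact: aM.
  - by move=> y; apply: normM_le; [rewrite ger0_norm|exact: uM].
  - exact: ltW.
  - move=> y; have -> : c3 * `|s - t| = 3 * (M + M) * (r' * `|s - t|) * r' by rewrite /c3; ring.
    apply: normM_le; last exact: vr.
    apply: normM_le; last exact: lip.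
    by apply: normM_le; [rewrite ger0_norm|apply: normD_le; exact: uM].
  - move=> y; have -> : c4 * `|s - t| = (M + M) * (r' * `|s - t|) +
        2 * 1 * (r' * `|s - t| * r') + 2 * `|s - t| * (M * r') by rewrite /c4; ring.
    apply: normD_le; first apply: normD_le.
    + by apply: normM_le; [apply: normD_le; exact: uM|exact: lip].
    + apply: normM_le; last by apply: normM_le; [exact: lip|exact: vr].
      by apply: normM_le; [rewrite ger0_norm|apply: le_trans d1; exact: ltW].
    + apply: normM_le; last by apply: normM_le; [exact: uM|exact: vr].
      by apply: normM_le; [rewrite ger0_norm|].
  move=> y; rewrite (vE s y sd) (vE t y td).
  set k1 := K _ y; set q1 := Q _ y; set q2 := Q _ y; set k2 := K _ y.
  set q5 := Q _ y; set q6 := Q _ y; set k3 := K _ y; set q3 := Q _ y; set q4 := Q _ y.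
  have -> : k3 = k1 - k2.
    rewrite /k1 /k2 -KB; [|cper_auto..].
    by congr (K _ _); apply/funext => z; ring.
  have qE : t * q3 + q4 = (q1 - q5) + (2 * s * q2 - 2 * t * q6).
    rewrite /q1 /q2 /q5 /q3 /q4 /q6 -!QZ; [|cper_auto..].
    rewrite -!QB; [|cper_auto..].
    by rewrite -!QD; [congr (Q _ _); apply/funext => z; ring|cper_auto..].
  by rewrite -[RHS]addrA qE; ring.
exists d, w, v; split => //.
- apply: (@C11_intro _ _ _ r r' r' (2 * (CK * c3 + CQ * c4)) (2 * (CK * c1 + CQ * c2))) => //.
  + by move=> t s x td sd; exact: lip.
  + move=> t s x td sd.
    have -> : 2 * (CK * c3 + CQ * c4) * `|s - t| = 2 * (CK * (c3 * `|s - t|) + CQ * (c4 * `|s - t|)).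
      by ring.
    exact: lipv.
  + move=> t s x td sd.
    have -> : 2 * (CK * c1 + CQ * c2) * (s - t) ^+ 2 =
        2 * (CK * (c1 * (s - t) ^+ 2) + CQ * (c2 * (s - t) ^+ 2)) by ring.
    exact: second.
- have d00 : `|0 : R| < d by rewrite normr0.
  have pw0 := pw 0 d00.
  move=> x; apply/eqP; rewrite -normr_le0.
  suff : `|w 0 x| <= 2 * (CK * 0 + CQ * 0) by rewrite !mulr0 addr0 mulr0.
  (* At t = 0 one factor w of the nonlinear term is treated as the unknown, which leaves no source
     at all. *)
  apply: (@implicit_estimate
     (fun y => 3 * u0 y * w 0 y + w 0 y ^+ 2) (fun=> 0) (w 0) (fun=> 0) (fun=> 0)
     0 (6 * M * r) (2 * M) d) => //.
  1-4: cper_auto.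
  + move=> y; have wy := wr 0 y d00.
    have h : `|3 * u0 y * w 0 y + w 0 y ^+ 2| <= 3 * (M - 1) * r + r * r.
      apply: normD_le; last exact: normM_le.
      by apply: normM_le => //; apply: normM_le => //; rewrite ger0_norm.
    by apply: le_trans h _; nra.
  + by move=> y; rewrite normr0; lra.
  + by rewrite normr0 ltW.
  + by move=> y; rewrite normr0.
  + by move=> y; rewrite normr0.
  move=> y; rewrite (wE 0 y d00) Q00 !mul0r !addr0.
  by congr (K _ _); apply/funext => z; ring.
Qed.

End implicit.

(** * Calculus of families depending differentiably on the parameter *)

Section C11_calculus.
Context {R : realType}.
Variables (L d : R).
Hypothesis L0 : 0 < L.
Implicit Types (U V : R -> R -> R).

Lemma C11_cst f : cper L f -> C11 L d (fun _ => f) (fun _ _ => 0).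
Proof.
move=> pf; have [M _ fM] := periodic_bounded L0 pf.2 pf.1.
apply: (@C11_intro _ _ _ M 0 0 0 0) => //.
- by move=> t _; exact: cper_cst.
- by move=> t x _; rewrite normr0.
- by move=> t s x _ _; rewrite subrr normr0 mul0r.
- by move=> t s x _ _; rewrite subrr normr0 mul0r.
- by move=> t s x _ _; rewrite subrr mulr0 subrr normr0 mul0r.
Qed.

Lemma C11_time : C11 L d (fun t _ => t) (fun _ _ => 1).
Proof.
apply: (@C11_intro _ _ _ d 1 1 0 0) => //.
- by move=> t _; exact: cper_cst.
- by move=> t _; exact: cper_cst.
- by move=> t x /ltW.
- by move=> t x _; rewrite normr1.
- by move=> t s x _ _; rewrite mul1r.
- by move=> t s x _ _; rewrite subrr normr0 mul0r.
- by move=> t s x _ _; rewrite mulr1 subrr normr0 mul0r.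
Qed.

Lemma C11D U V U' V' : C11 L d U V -> C11 L d U' V' ->
  C11 L d (fun t x => U t x + U' t x) (fun t x => V t x + V' t x).
Proof.
move=> [pU [C C0 UC]] [pU' [D D0 UD]].
apply: (@C11_intro _ _ _ (C + D) (C + D) (C + D) (C + D) (C + D)).
- by move=> t /[dup] /pU[? _] /pU'[? _]; exact: cperD.
- by move=> t /[dup] /pU[_ ?] /pU'[_ ?]; exact: cperD.
- move=> t x td; have [? _ _ _ _] := UC t t x td td; have [? _ _ _ _] := UD t t x td td.
  exact: normD_le.
- move=> t x td; have [_ ? _ _ _] := UC t t x td td; have [_ ? _ _ _] := UD t t x td td.
  exact: normD_le.
- move=> t s x td sd; have [_ _ ? _ _] := UC t s x td sd; have [_ _ ? _ _] := UD t s x td sd.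
  by rewrite mulrDl opprD addrACA; exact: normD_le.
- move=> t s x td sd; have [_ _ _ ? _] := UC t s x td sd; have [_ _ _ ? _] := UD t s x td sd.
  by rewrite mulrDl opprD addrACA; exact: normD_le.
- move=> t s x td sd; have [_ _ _ _ ?] := UC t s x td sd; have [_ _ _ _ ?] := UD t s x td sd.
  have -> : U s x + U' s x - (U t x + U' t x) - (s - t) * (V t x + V' t x) =
    (U s x - U t x - (s - t) * V t x) + (U' s x - U' t x - (s - t) * V' t x) by ring.
  by rewrite [leRHS]mulrDl; exact: normD_le.
Qed.

Lemma C11M U V U' V' : C11 L d U V -> C11 L d U' V' ->
  C11 L d (fun t x => U t x * U' t x) (fun t x => V t x * U' t x + U t x * V' t x).
Proof.
move=> [pU [C C0 UC]] [pU' [D D0 UD]].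
apply: (@C11_intro _ _ _ (C * D) (C * D + C * D) (C * D + C * D)
  (C * D + C * D + (C * D + C * D)) (C * D + C * D + C * D)).
- by move=> t /[dup] /pU[? _] /pU'[? _]; exact: cperM.
- by move=> t /[dup] /pU[? ?] /pU'[? ?]; cper_auto.
- move=> t x td; have [? _ _ _ _] := UC t t x td td; have [? _ _ _ _] := UD t t x td td.
  exact: normM_le.
- move=> t x td; have [? ? _ _ _] := UC t t x td td; have [? ? _ _ _] := UD t t x td td.
  by apply: normD_le; exact: normM_le.
- move=> t s x td sd; have [Ut _ Ul _ _] := UC t s x td sd.
  have [_ _ Ul' _ _] := UD t s x td sd; have [Us' _ _ _ _] := UD s s x sd sd.
  have -> : U s x * U' s x - U t x * U' t x =
    (U s x - U t x) * U' s x + U t x * (U' s x - U' t x) by ring.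
  have -> : (C * D + C * D) * `|s - t| = C * `|s - t| * D + C * (D * `|s - t|) by ring.
  by apply: normD_le; exact: normM_le.
- move=> t s x td sd; have [Ut Vt Ul Vl _] := UC t s x td sd.
  have [_ _ Ul' Vl' _] := UD t s x td sd; have [Us' Vs' _ _ _] := UD s s x sd sd.
  have -> : V s x * U' s x + U s x * V' s x - (V t x * U' t x + U t x * V' t x) =
    ((V s x - V t x) * U' s x + V t x * (U' s x - U' t x)) +
    ((U s x - U t x) * V' s x + U t x * (V' s x - V' t x)) by ring.
  have -> : (C * D + C * D + (C * D + C * D)) * `|s - t| =
    (C * `|s - t| * D + C * (D * `|s - t|)) + (C * `|s - t| * D + C * (D * `|s - t|)) by ring.
  by apply: normD_le; apply: normD_le; exact: normM_le.
- move=> t s x td sd; have [Ut Vt _ _ U2] := UC t s x td sd.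
  have [_ _ Ul' _ U2'] := UD t s x td sd; have [Us' _ _ _ _] := UD s s x sd sd.
  have -> : U s x * U' s x - U t x * U' t x - (s - t) * (V t x * U' t x + U t x * V' t x) =
    (U s x - U t x - (s - t) * V t x) * U' s x + ((s - t) * V t x) * (U' s x - U' t x) +
    U t x * (U' s x - U' t x - (s - t) * V' t x) by ring.
  have -> : (C * D + C * D + C * D) * (s - t) ^+ 2 =
    C * (s - t) ^+ 2 * D + (`|s - t| * C) * (D * `|s - t|) + C * (D * (s - t) ^+ 2).
    by rewrite -[(s - t) ^+ 2]real_normK ?num_real//; ring.
  by apply: normD_le; [apply: normD_le|]; apply: normM_le => //; exact: normM_le.
Qed.

Lemma C11_op T D U V : bounded_op L T D -> C11 L d U V ->
  C11 L d (fun t => T (U t)) (fun t => T (V t)).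
Proof.
move=> HT [pU [C C0 UC]]; have [Tp TD TZ Tb] := HT.
have TB f g x : cper L f -> cper L g -> T (fun y => f y - g y) x = T f x - T g x.
  exact: bounded_op_sub HT.
apply: (@C11_intro _ _ _ (D * C) (D * C) (D * C) (D * C) (D * C)).
- by move=> t /pU[? _]; exact: Tp.
- by move=> t /pU[_ ?]; exact: Tp.
- move=> t x td; have [pUt _] := pU t td; apply: Tb => // y.
  by have [? _ _ _ _] := UC t t y td td.
- move=> t x td; have [_ pVt] := pU t td; apply: Tb => // y.
  by have [_ ? _ _ _] := UC t t y td td.
- move=> t s x td sd; have [pUt _] := pU t td; have [pUs _] := pU s sd.
  rewrite -TB// -mulrA; apply: Tb => [|y]; first cper_auto.
  by have [_ _ ? _ _] := UC t s y td sd.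
- move=> t s x td sd; have [_ pUt] := pU t td; have [_ pUs] := pU s sd.
  rewrite -TB// -mulrA; apply: Tb => [|y]; first cper_auto.
  by have [_ _ _ ? _] := UC t s y td sd.
- move=> t s x td sd; have [pUt pVt] := pU t td; have [pUs _] := pU s sd.
  rewrite -TB// -TZ// -TB; [|cper_auto..].
  rewrite -mulrA; apply: Tb => [|y]; first cper_auto.
  by have [_ _ _ _ ?] := UC t s y td sd.
Qed.

Lemma C11_ext U V U' V' : (forall t, `|t| < d -> U t = U' t /\ V t = V' t) ->
  C11 L d U V -> C11 L d U' V'.
Proof.
move=> e [pU [C C0 UC]]; split.
  by move=> t td; have [<- <-] := e t td; exact: pU.
exists C => // t s x td sd.
by have [<- <-] := e t td; have [<- <-] := e s sd; exact: UC.
Qed.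

(* C^1 dependence on t, in the sense of C11, of the first k derivatives in x. *)
Fixpoint reg k U V : Prop := C11 L d U V /\
  if k is k'.+1 then exists U1 V1,
    (forall t, `|t| < d -> deriv_is (U t) (U1 t) /\ deriv_is (V t) (V1 t)) /\ reg k' U1 V1
  else True.

Lemma reg_C11 k U V : reg k U V -> C11 L d U V.
Proof. by case: k => [|k] []. Qed.

Lemma regW k U V : reg k.+1 U V -> reg k U V.
Proof.
elim: k U V => [|k IH] U V; first by move=> [].
by move=> [CU [U1 [V1 [dU rU]]]]; split => //; exists U1, V1; split => //; exact: IH.
Qed.

Lemma reg_ext k U V U' V' : (forall t, `|t| < d -> U t = U' t /\ V t = V' t) ->
  reg k U V -> reg k U' V'.
Proof.
move=> e; case: k => [|k] [CU]; first by move=> _; split=> //; exact: C11_ext e CU.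
move=> [U1 [V1 [dU rU]]]; split; first exact: C11_ext e CU.
by exists U1, V1; split=> // t td; have [<- <-] := e t td; exact: dU.
Qed.

Lemma regD k U V U' V' : reg k U V -> reg k U' V' ->
  reg k (fun t x => U t x + U' t x) (fun t x => V t x + V' t x).
Proof.
elim: k U V U' V' => [|k IH] U V U' V'.
  by move=> [CU _] [CU' _]; split=> //; exact: C11D.
move=> [CU [U1 [V1 [dU rU]]]] [CU' [U1' [V1' [dU' rU']]]]; split; first exact: C11D.
exists (fun t x => U1 t x + U1' t x), (fun t x => V1 t x + V1' t x); split; last exact: IH.
move=> t td; have [? ?] := dU t td; have [? ?] := dU' t td.
by split; exact: deriv_isD.
Qed.

Lemma regM k U V U' V' : reg k U V -> reg k U' V' ->
  reg k (fun t x => U t x * U' t x) (fun t x => V t x * U' t x + U t x * V' t x).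
Proof.
elim: k U V U' V' => [|k IH] U V U' V'.
  by move=> [CU _] [CU' _]; split=> //; exact: C11M.
move=> rU rU'; have [rUk rUk'] := conj (regW rU) (regW rU').
case: rU rU' => [CU [U1 [V1 [dU rU]]]] [CU' [U1' [V1' [dU' rU']]]].
split; first exact: C11M.
pose V2 t x := (V1 t x * U' t x + U1 t x * V' t x) + (V t x * U1' t x + U t x * V1' t x).
exists (fun t x => U1 t x * U' t x + U t x * U1' t x), V2; split.
  move=> t td; have [h1 h2] := dU t td; have [h3 h4] := dU' t td; split.
    exact: deriv_isM.
  apply: deriv_is_eq (deriv_isD (deriv_isM h2 h3) (deriv_isM h1 h4)) _ => x.
  by rewrite /V2; ring.
exact: (regD (IH _ _ _ _ rU rUk') (IH _ _ _ _ rUk rU')).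
Qed.

Lemma reg_scalar k (a b : R -> R) : C11 L d (fun t _ => a t) (fun t _ => b t) ->
  reg k (fun t _ => a t) (fun t _ => b t).
Proof.
elim: k a b => [|k IH] a b Cab; split=> //.
exists (fun _ _ => 0), (fun _ _ => 0); split.
  by move=> t _; split; exact: deriv_is_cst.
by apply: (IH (fun=> 0) (fun=> 0)); apply: C11_cst; exact: cper_cst.
Qed.

Lemma reg_cst k (a : R) : reg k (fun _ _ => a) (fun _ _ => 0).
Proof.
by apply: (@reg_scalar k (fun=> a) (fun=> 0)); apply: C11_cst; exact: cper_cst.
Qed.

Lemma reg_time k : reg k (fun t _ => t) (fun _ _ => 1).
Proof. by apply: (@reg_scalar k id (fun=> 1)); exact: C11_time. Qed.

Lemma regZ k (a : R) U V : reg k U V ->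
  reg k (fun t x => a * U t x) (fun t x => a * V t x).
Proof.
move=> rU; apply: reg_ext (regM (reg_cst k a) rU) => t td; split=> //.
by apply/funext => x; rewrite mul0r add0r.
Qed.

Lemma regB k U V U' V' : reg k U V -> reg k U' V' ->
  reg k (fun t x => U t x - U' t x) (fun t x => V t x - V' t x).
Proof.
move=> rU rU'; apply: reg_ext (regD rU (regZ (-1) rU')) => t td.
by split; apply/funext => x; rewrite mulN1r.
Qed.

(** One derivative in x is gained because the derivative of [antider L (U t)] is U t minus its mean,
    and the mean depends on t alone. *)
Lemma reg_antider k U V : reg k U V ->
  reg k.+1 (fun t => antider L (U t)) (fun t => antider L (V t)).
Proof.
move=> rU; have CU := reg_C11 rU.
split; first exact: (C11_op (bounded_op_antider L0) CU).
exists (fun t x => U t x - mean L (U t)), (fun t x => V t x - mean L (V t)); split.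
  by move=> t td; have [? ?] := CU.1 t td; split; exact: antider_deriv.
apply: (regB rU); apply: (@reg_scalar k (fun t => mean L (U t)) (fun t => mean L (V t))).
exact: (C11_op (bounded_op_mean L0) CU).
Qed.

(* U'' = U^3 - U - (t/2) S(U^2), together with its linearization satisfied by
   V = dU/dt, gains two derivatives. *)
Lemma reg_bootstrap S D k U V U1 V1 : bounded_op L S D ->
  (forall k U V, reg k U V -> reg k (fun t => S (U t)) (fun t => S (V t))) ->
  reg k U V ->
  (forall t, `|t| < d -> [/\ deriv_is (U t) (U1 t), deriv_is (V t) (V1 t),
    deriv_is (U1 t) (fun x => U t x ^+ 3 - U t x - t / 2 * S (fun y => U t y ^+ 2) x) &
    deriv_is (V1 t) (fun x => (3 * U t x ^+ 2 - 1) * V t x -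
      2^-1 * S (fun y => U t y ^+ 2) x - t * S (fun y => U t y * V t y) x)]) ->
  reg k.+2 U V.
Proof.
move=> [Sp _ SZ _] Sreg rU dU; have CU := reg_C11 rU.
have r2 := regM rU rU.
have rF := regB (regB (regM r2 rU) rU) (regZ 2^-1 (regM (reg_time k) (Sreg _ _ _ r2))).
split=> //; exists U1, V1; split; first by move=> t td; have [] := dU t td.
apply: reg_ext (reg_antider rF) => t td.
have [h1 h2 h3 h4] := dU t td; have [pU pV] := CU.1 t td.
have der2 f f' f'' : deriv_is f f' -> deriv_is f' f'' -> cper L f -> continuous f'' ->
    antider L f'' = f'.
  move=> df df' pf cf''.
  have cf' := deriv_is_continuous df'.
  apply: antiderK => //; first by split=> //; exact: deriv_is_periodic df pf.2.
  exact: mean_deriv df pf cf'.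
have pU2 : cper L (fun y => U t y ^+ 2) by cper_auto.
have pUV : cper L (fun y => U t y * V t y) by cper_auto.
have [pA1 pA2] := conj (Sp _ pU2) (Sp _ pUV).
have eV : S (fun x => V t x * U t x + U t x * V t x) = fun x => 2 * S (fun x => U t x * V t x) x.
  have -> : (fun x => V t x * U t x + U t x * V t x) = fun x => 2 * (U t x * V t x).
    by apply/funext => x; ring.
  by apply/funext => x; exact: SZ.
split.
- have pF := cperB (cperB (cperX 3 pU) pU) (cperM (cper_cst L (t / 2)) pA1).
  rewrite -(der2 _ _ _ h1 h3 pU pF.1).
  by congr (antider L _); apply/funext => x; ring.
- have pF := cperB (cperB (cperM (cperB (cperM (cper_cst L 3) (cperX 2 pU)) (cper_cst L 1)) pV)
    (cperM (cper_cst L 2^-1) pA1)) (cperM (cper_cst L t) pA2).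
  rewrite -(der2 _ _ _ h2 h4 pV pF.1).
  by congr (antider L _); apply/funext => x; rewrite eV; field.
Qed.

Definition antider3 f := antider L (antider L (antider L f)).

Lemma bounded_op_antider3 : bounded_op L antider3 (4 * L * (4 * L * (4 * L))).
Proof.
have HA := bounded_op_antider L0.
exact: (bounded_op_comp HA (bounded_op_comp HA HA)).
Qed.

Lemma reg_antider3 k U V : reg k U V ->
  reg k (fun t => antider3 (U t)) (fun t => antider3 (V t)).
Proof. by do 3 move/reg_antider; do 3 move/regW. Qed.

End C11_calculus.

(** * The branch of odd solutions *)

Section branch.
Context {R : realType}.
Variables (u p : R -> R) (L : R).
Hypotheses (L0 : 0 < L) (du : deriv_is u p)
  (dp : deriv_is p (fun x => u x ^+ 3 - u x)) (uL : periodic u L) (u0 : u 0 = 0).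

Variables (K S : (R -> R) -> R -> R) (CK CS : R).
Hypotheses (CK0 : 0 <= CK) (HK : bounded_op L K CK) (CS0 : 0 <= CS) (HS : bounded_op L S CS)
  (pK : forall f, cper L f -> odd_periodic L (K f))
  (K_deriv : forall f, cper L f -> (forall x, f (- x) = - f x) ->
     exists2 g, deriv_is (K f) g & deriv_is g (fun x => (3 * u x ^+ 2 - 1) * K f x + f x))
  (S_odd : forall f, cper L f -> (forall x, f (- x) = f x) -> forall x, S f (- x) = - S f x)
  (S_reg : forall d k U V, reg L d k U V ->
     reg L d k (fun t => S (U t)) (fun t => S (V t))).

Let pu : cper L u. Proof. by split=> //; exact: deriv_is_continuous du. Qed.
Let uo : forall x, u (- x) = - u x. Proof. exact: (stationary_odd L0 du dp uL u0). Qed.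

(** K stands for the Green operator after odd projection and S for J^3; only the listed properties
    matter. Fixed points are odd because K takes odd values, so their sources are odd too and K
    really inverts the linearized equation on them. *)
Lemma odd_branch_abstract : exists (d : R) (U V U1 : R -> R -> R),
  [/\ 0 < d, reg L d 6 U V, U 0 = u,
      forall t, `|t| < d -> odd_periodic L (U t) /\ odd_periodic L (V t) &
      forall t, `|t| < d -> deriv_is (U t) (U1 t) /\
        deriv_is (U1 t) (fun x => U t x ^+ 3 - U t x - t / 2 * S (fun y => U t y ^+ 2) x)].
Proof.
pose Q f x := - 2^-1 * K (S f) x.
have [CQ CQ0 HQ] : exists2 C, 0 <= C & bounded_op L Q C.
  have HQ := bounded_opZ (- 2^-1) (bounded_op_comp HK HS).
  eexists; last exact: HQ.
  by rewrite !mulr_ge0.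
have [d [w [v [d0 Cwv wE vE w0]]]] := implicit_solution L0 CK0 CQ0 HK HQ pu.
have [_ KD KZ _] := HK; have [Sp _ _ _] := HS.
(* With U = u + w, the equation for U reads w'' = (3 u^2 - 1) w + h. Likewise [k] is the source in
   the equation for v. *)
pose h t x := 3 * u x * w t x ^+ 2 + w t x ^+ 3 - t / 2 * S (fun y => (u y + w t y) ^+ 2) x.
pose k t x := (6 * u x * w t x + 3 * w t x ^+ 2) * v t x -
  2^-1 * S (fun y => (u y + w t y) ^+ 2) x - t * S (fun y => (u y + w t y) * v t y) x.
have pwv t : `|t| < d -> cper L (w t) /\ cper L (v t) by move=> /(Cwv.1 t).
have wE2 t : `|t| < d -> w t = K (h t) /\ cper L (h t).
  move=> td; have [pw pv] := pwv t td.
  have pU2 : cper L (fun y => (u y + w t y) ^+ 2) by cper_auto.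
  have pn : cper L (fun y => 3 * u y * w t y ^+ 2 + w t y ^+ 3) by cper_auto.
  have pS := Sp _ pU2.
  split; last exact: (cperB pn (cperM (cper_cst _ _) pS)).
  apply/funext => x; rewrite wE// /Q /h (bounded_op_sub x HK pn (cperM (cper_cst _ (t / 2)) pS)).
  by rewrite KZ//; field.
have vE2 t : `|t| < d -> v t = K (k t) /\ cper L (k t).
  move=> td; have [pw pv] := pwv t td.
  have pU2 : cper L (fun y => (u y + w t y) ^+ 2) by cper_auto.
  have pUV : cper L (fun y => (u y + w t y) * v t y) by cper_auto.
  have pn : cper L (fun y => (6 * u y * w t y + 3 * w t y ^+ 2) * v t y) by cper_auto.
  have pS := cperM (cper_cst L 2^-1) (Sp _ pU2); have pS2 := cperM (cper_cst L t) (Sp _ pUV).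
  split; last exact: (cperB (cperB pn pS) pS2).
  apply/funext => x; rewrite vE// /Q /k (bounded_op_sub x HK (cperB pn pS) pS2).
  rewrite (bounded_op_sub x HK pn pS) !KZ//; [|exact: Sp..].
  by field.
have wo t : `|t| < d -> odd_periodic L (w t).
  by move=> td; have [-> ph] := wE2 t td; exact: pK.
have vo t : `|t| < d -> odd_periodic L (v t).
  by move=> td; have [-> ph] := vE2 t td; exact: pK.
have ho t x : `|t| < d -> h t (- x) = - h t x.
  move=> td; have [_ _ w_o] := wo t td; have [pw pv] := pwv t td.
  rewrite /h uo w_o S_odd; first by ring.
    by cper_auto.
  by move=> y; rewrite uo w_o; ring.
have ko t x : `|t| < d -> k t (- x) = - k t x.
  move=> td; have [_ _ w_o] := wo t td; have [_ _ v_o] := vo t td.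
  have [pw pv] := pwv t td.
  rewrite /k uo w_o v_o !S_odd; first by ring.
  - by cper_auto.
  - by move=> y; rewrite uo w_o v_o; ring.
  - by cper_auto.
  - by move=> y; rewrite uo w_o; ring.
pose U t x := u x + w t x.
have dU t : `|t| < d -> exists U1, deriv_is (U t) U1 /\
    deriv_is U1 (fun x => U t x ^+ 3 - U t x - t / 2 * S (fun y => U t y ^+ 2) x).
  move=> td; have [e ph] := wE2 t td.
  have [g dg dg'] := K_deriv ph (fun x => ho t x td).
  rewrite -e in dg dg'.
  exists (fun x => p x + g x); split; first exact: deriv_isD.
  apply: deriv_is_eq (deriv_isD dp dg') _ => x; rewrite /h /U; ring.
have dV t : `|t| < d -> exists V1, deriv_is (v t) V1 /\
    deriv_is V1 (fun x => (3 * U t x ^+ 2 - 1) * v t x -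
      2^-1 * S (fun y => U t y ^+ 2) x - t * S (fun y => U t y * v t y) x).
  move=> td; have [e pk] := vE2 t td.
  have [g dg dg'] := K_deriv pk (fun x => ko t x td).
  rewrite -e in dg dg'.
  exists g; split => //.
  apply: deriv_is_eq dg' _ => x; rewrite /k /U; ring.
have /choice[U1 dU1] : forall t, exists U1, `|t| < d -> deriv_is (U t) U1 /\
    deriv_is U1 (fun x => U t x ^+ 3 - U t x - t / 2 * S (fun y => U t y ^+ 2) x).
  move=> t; have [td|td] := boolP (`|t| < d); last by exists (cst 0).
  by have [U1 ?] := dU t td; exists U1.
have /choice[V1 dV1] : forall t, exists V1, `|t| < d -> deriv_is (v t) V1 /\
    deriv_is V1 (fun x => (3 * U t x ^+ 2 - 1) * v t x -
      2^-1 * S (fun y => U t y ^+ 2) x - t * S (fun y => U t y * v t y) x).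
  move=> t; have [td|td] := boolP (`|t| < d); last by exists (cst 0).
  by have [V1 ?] := dV t td; exists V1.
exists d, U, v, U1; split => //.
- have r0 : reg L d 0 U v.
    split=> //; apply: C11_ext _ (C11D (C11_cst d L0 pu) Cwv) => t td; split => //.
    by apply/funext => x; rewrite add0r.
  have boot n : reg L d n U v -> reg L d n.+2 U v.
    move=> r; apply: (reg_bootstrap L0 (U1 := U1) (V1 := V1) HS _ r).
      by move=> j U' V'; exact: S_reg.
    by move=> t td; have [? ?] := dU1 t td; have [? ?] := dV1 t td.
  (* Each round gains two derivatives, so three rounds reach the order six of the solution space. *)
  by apply/boot/boot/boot.
- by apply/funext => x; rewrite /U w0 addr0.
- move=> t td; split; last exact: vo.
  have [cw wL w_o] := wo t td.
  have [cU UL] := cperD pu (conj cw wL); split => //.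
  by move=> x; rewrite /U uo w_o opprD.
Qed.

End branch.

Section branch_instance.
Context {R : realType}.
Variables (u p : R -> R) (L : R).
Hypotheses (L0 : 0 < L) (du : deriv_is u p)
  (dp : deriv_is p (fun x => u x ^+ 3 - u x)) (uL : periodic u L) (u0 : u 0 = 0)
  (nt : ~ exists a, forall x, u x = a).

Lemma green_odd_part_bounded : exists2 C, 0 <= C &
  bounded_op L (fun f => green u p L (odd_part f)) C.
Proof.
have [C C0 CP] := green_bounded L0 du dp uL u0 nt.
exists C; first exact: ltW.
have cont f : cper L f -> continuous (odd_part f).
  by move=> pf; have [] := odd_part_odd_periodic pf.
split.
- by move=> f /odd_part_odd_periodic /(green_odd_periodic L0 du dp uL u0 nt)[].
- by move=> f g pf pg x; rewrite odd_partD; apply: greenD => //; exact: cont.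
- by move=> a f pf x; rewrite odd_partZ; apply: greenZ => //; exact: cont.
- move=> f M pf fM.
  exact: (CP _ _ (odd_part_odd_periodic pf) (odd_part_bounded fM)).
Qed.

Lemma antider3_even f : cper L f -> (forall x, f (- x) = f x) ->
  forall x, antider3 L f (- x) = - antider3 L f x.
Proof.
move=> pf fe; have p1 := antider_cper L0 pf; have p2 := antider_cper L0 p1.
exact: (antider_even L0 p2 (antider_odd p1 (antider_even L0 pf fe))).
Qed.

Lemma odd_branch : exists (d : R) (U V U1 : R -> R -> R),
  [/\ 0 < d, reg L d 6 U V, U 0 = u,
      forall t, `|t| < d -> odd_periodic L (U t) /\ odd_periodic L (V t) &
      forall t, `|t| < d -> deriv_is (U t) (U1 t) /\
        deriv_is (U1 t) (fun x => U t x ^+ 3 - U t x - t / 2 * antider3 L (fun y => U t y ^+ 2) x)].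
Proof.
have [CK CK0 HK] := green_odd_part_bounded.
have HS := bounded_op_antider3 L0.
apply: (odd_branch_abstract L0 du dp uL u0 CK0 HK _ HS).
- by rewrite !mulr_ge0// ltW.
- by move=> f pf; exact: (green_odd_periodic L0 du dp uL u0 nt (odd_part_odd_periodic pf)).
- by move=> f pf fo; rewrite odd_part_id//; exact: (green_deriv L0 du dp uL u0 nt pf.1).
- exact: antider3_even.
- by move=> d k U V; exact: reg_antider3.
Qed.

End branch_instance.

(** * Weak derivatives on the torus *)

Section test_functions.
Context {R : realType}.
Implicit Types (L : R) (f g phi psi : R -> R).
Local Notation mu := (@lebesgue_measure R).

Definition smooth phi := forall n (x : R), derivable (phi^`(n)%classic) x 1.

(** Smoothness without computing iterated derivatives: it suffices to place the function in a class
    stable under differentiation. *)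
Lemma smooth_closed (A : set (R -> R)) :
  (forall f, A f -> exists2 g, A g & deriv_is f g) -> forall f, A f -> smooth f.
Proof.
move=> AP f Af n.
have [g Ag ->] : exists2 g, A g & f^`(n)%classic = g.
  elim: n => [|n [g Ag e]]; first by exists f.
  have [h Ah gh] := AP g Ag; exists h => //.
  by rewrite derive1nS e (deriv_is_derive1 gh).
have [h _ gh] := AP g Ag; exact: deriv_is_derivable gh.
Qed.

Lemma smooth_deriv phi : smooth phi -> deriv_is phi (phi^`()%classic).
Proof. by move=> sp x; rewrite derive1E; apply: DeriveDef => //; exact: (sp 0%N x). Qed.

Lemma smooth_derive1 phi : smooth phi -> smooth (phi^`()%classic).
Proof. by move=> sp n x; rewrite -derive1Sn; exact: sp. Qed.

Lemma smooth_prim phi psi : deriv_is phi psi -> smooth psi -> smooth phi.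
Proof.
move=> dp sp [|n] x; first exact: deriv_is_derivable dp x.
by rewrite derive1Sn (deriv_is_derive1 dp); exact: sp.
Qed.

Lemma smooth_continuous phi : smooth phi -> continuous phi.
Proof. by move=> sp; exact: deriv_is_continuous (smooth_deriv sp). Qed.

Lemma test_cper L phi : test_torus L phi -> cper L phi.
Proof. by move=> [pL sp]; split=> //; exact: smooth_continuous. Qed.

Lemma test_derive1 L phi : test_torus L phi -> test_torus L (phi^`()%classic).
Proof.
move=> [pL sp]; split; last exact: smooth_derive1.
exact: deriv_is_periodic (smooth_deriv sp) pL.
Qed.

Lemma test_deriv L phi : test_torus L phi -> deriv_is phi (phi^`()%classic).
Proof. by move=> [_ /smooth_deriv]. Qed.

Lemma test_derive1n L phi n : test_torus L phi -> test_torus L (phi^`(n)%classic).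
Proof.
by move=> tp; elim: n => [|n IH]; [|rewrite derive1nS; exact: test_derive1].
Qed.

Lemma smooth_cst (a : R) : smooth (fun=> a).
Proof.
apply: (@smooth_closed [set f | exists b, f = fun=> b]); last by exists a.
move=> _ [b ->]; exists (fun=> 0); first by exists 0.
exact: deriv_is_cst.
Qed.

Lemma test_cst L (a : R) : test_torus L (fun=> a).
Proof. by split=> //; exact: smooth_cst. Qed.

Lemma derive1n_cst (a : R) n : (0 < n)%N -> (fun=> a)^`(n)%classic = fun=> 0 :> R.
Proof.
have d b : (fun=> b)^`()%classic = fun=> 0 :> R by exact: deriv_is_derive1 (deriv_is_cst b).
by elim: n => // -[|n] IH _; [rewrite derive1n1 d|rewrite derive1nS IH].
Qed.

Lemma smoothB f g : smooth f -> smooth g -> smooth (fun x => f x - g x).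
Proof.
move=> sf sg.
apply: (@smooth_closed [set h | exists f g, [/\ smooth f, smooth g & h = fun x => f x - g x]]);
  last by exists f, g.
move=> _ [f1 [g1 [s1 s2 ->]]].
exists (fun x => f1^`()%classic x - g1^`()%classic x).
  exists (f1^`()%classic), (g1^`()%classic).
  exact: And3 (smooth_derive1 s1) (smooth_derive1 s2) erefl.
exact: deriv_isB (smooth_deriv s1) (smooth_deriv s2).
Qed.

Lemma test_antider L psi : 0 < L -> test_torus L psi -> test_torus L (antider L psi).
Proof.
move=> L0 tp; have [pL sp] := tp; have pp := test_cper tp.
have sA : smooth (antider L psi).
  exact: (smooth_prim (antider_deriv pp) (smoothB sp (@smooth_cst (mean L psi)))).
by split=> //; exact: (antider_cper L0 pp).2.
Qed.

(** Zero mean is the only obstruction to a periodic primitive, and J returns zero-mean functions, so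
    the construction can be iterated. *)
Lemma test_iter_prim L psi j : 0 < L -> test_torus L psi ->
  exists2 phi, test_torus L phi & phi^`(j.+1)%classic = fun x => psi x - mean L psi.
Proof.
move=> L0 tp; pose phi n := iter n (antider L) psi.
have tphi n : test_torus L (phi n) by elim: n => [|n IH]; [exact: tp|exact: test_antider].
exists (phi j.+1); first exact: tphi.
elim: j => [|j IH].
  by rewrite derive1n1; exact: deriv_is_derive1 (antider_deriv (test_cper tp)).
rewrite derive1Sn.
have pj := test_cper (tphi j.+1).
have -> : (phi j.+2)^`()%classic = phi j.+1; last exact: IH.
rewrite (deriv_is_derive1 (antider_deriv pj)) (mean_antider L0 (test_cper (tphi j))).
by apply/funext => y; rewrite subr0.
Qed.

Section bump.
Variables (L a N : R).
Let s1 y := sin (pi / L * y).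
Let c1 y := cos (pi / L * y).
Let s2 y := sin (pi / L * (a - y)).
Let c2 y := cos (pi / L * (a - y)).
Let E y := expR (- N * (s1 y * s2 y)).

(** A logistic function of N s1 s2. The product s1 s2 is positive on (0, a) and negative on (a, L)
    when 0 < a < L, so for large N this is a smooth approximation of the indicator of [0, a]. Both
    sines change sign after L, hence the periodicity. *)
Definition bump (y : R) := (1 + E y)^-1.

(** An algebra stable under differentiation that contains [bump], as [smooth_closed] requires; the
    derivative of each generator is a polynomial in the generators. *)
Inductive bump_alg : (R -> R) -> Prop :=
| BAcst b : bump_alg (fun=> b)
| BAs1 : bump_alg s1 | BAc1 : bump_alg c1 | BAs2 : bump_alg s2 | BAc2 : bump_alg c2
| BAexp : bump_alg E | BAbump : bump_alg bump
| BAadd f g : bump_alg f -> bump_alg g -> bump_alg (fun y => f y + g y)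
| BAmul f g : bump_alg f -> bump_alg g -> bump_alg (fun y => f y * g y).

Let E1_neq0 y : 1 + E y != 0.
Proof. by rewrite gt_eqF// addr_gt0// expR_gt0. Qed.

Let d1 (y : R) : is_derive y 1 (fun z => pi / L * z) (pi / L).
Proof. by have := deriv_isZ (pi / L) (@deriv_is_id R) y; rewrite mulr1. Qed.

Let d2 (y : R) : is_derive y 1 (fun z => pi / L * (a - z)) (- (pi / L)).
Proof. derive_ring. Qed.

Let ds1 : deriv_is s1 (fun y => pi / L * c1 y).
Proof.
move=> y; apply: is_derive_eq (is_derive1_comp (is_derive_sin _) (d1 y)) _.
by rewrite mulrC.
Qed.
Let dc1 : deriv_is c1 (fun y => - (pi / L) * s1 y).
Proof.
move=> y; apply: is_derive_eq (is_derive1_comp (is_derive_cos _) (d1 y)) _.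
by rewrite mulrC mulrN mulNr.
Qed.
Let ds2 : deriv_is s2 (fun y => - (pi / L) * c2 y).
Proof.
move=> y; apply: is_derive_eq (is_derive1_comp (is_derive_sin _) (d2 y)) _.
by rewrite mulrC.
Qed.
Let dc2 : deriv_is c2 (fun y => pi / L * s2 y).
Proof.
move=> y; apply: is_derive_eq (is_derive1_comp (is_derive_cos _) (d2 y)) _.
by rewrite mulrNN mulrC.
Qed.
Let dE : deriv_is E (fun y => - N * (pi / L * (c1 y * s2 y + -1 * (s1 y * c2 y))) * E y).
Proof.
move=> y; have h1 := ds1 y; have h2 := ds2 y.
have h3 : is_derive y 1 (fun z => - N * (s1 z * s2 z))
   (- N * (pi / L * (c1 y * s2 y + -1 * (s1 y * c2 y)))) by derive_ring.
by apply: is_derive_eq (is_derive1_comp (is_derive_expR _) h3) _; rewrite mulrC.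
Qed.
Let dbump : deriv_is bump (fun y => - (1) *
  ((- N * (pi / L * (c1 y * s2 y + -1 * (s1 y * c2 y))) * E y) * (bump y * bump y))).
Proof.
move=> y; have h1 := dE y.
have h2 : is_derive y 1 (fun z => 1 + E z)
   (- N * (pi / L * (c1 y * s2 y + -1 * (s1 y * c2 y))) * E y) by derive_ring.
apply: is_derive_eq (is_deriveV (f := fun z => 1 + E z) (E1_neq0 y) h2) _.
by rewrite /bump -exprVn /GRing.scale/= -expr2; ring.
Qed.

Lemma bump_smooth : smooth bump.
Proof.
apply: (@smooth_closed bump_alg); last exact: BAbump.
move=> f; elim=> {f}.
- by move=> b; exists (fun=> 0); [exact: BAcst|exact: deriv_is_cst].
- by exists (fun y => pi / L * c1 y) => //; apply: (BAmul (BAcst _)); exact: BAc1.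
- by exists (fun y => - (pi / L) * s1 y) => //; apply: (BAmul (BAcst _)); exact: BAs1.
- by exists (fun y => - (pi / L) * c2 y) => //; apply: (BAmul (BAcst _)); exact: BAc2.
- by exists (fun y => pi / L * s2 y) => //; apply: (BAmul (BAcst _)); exact: BAs2.
- by eexists; [|exact: dE]; do ![apply: BAmul|apply: BAadd|apply: BAcst|apply: BAs1|
    apply: BAs2|apply: BAc1|apply: BAc2|apply: BAexp].
- eexists; [|exact: dbump].
  apply: BAmul; first exact: BAcst.
  apply: BAmul; last by apply: BAmul; exact: BAbump.
  apply: BAmul; last exact: BAexp.
  apply: BAmul; first exact: BAcst.
  apply: BAmul; first exact: BAcst.
  apply: BAadd; first by apply: BAmul; [exact: BAc1|exact: BAs2].
  by apply: BAmul; [exact: BAcst|apply: BAmul; [exact: BAs1|exact: BAc2]].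
- move=> f g _ [f' Af df] _ [g' Ag dg]; exists (fun y => f' y + g' y).
    exact: BAadd.
  exact: deriv_isD.
- move=> f g Bf [f' Af df] Bg [g' Ag dg]; exists (fun y => f' y * g y + f y * g' y).
    by apply: BAadd; exact: BAmul.
  exact: deriv_isM.
Qed.

Hypothesis L0 : 0 < L.

Lemma bump_test : test_torus L bump.
Proof.
split; last exact: bump_smooth.
move=> y; rewrite /bump /E; congr ((1 + expR (_ * _))^-1).
have -> : s1 (y + L) = - s1 y.
  by rewrite /s1 mulrDr divfK ?gt_eqF// sinDpi.
have -> : s2 (y + L) = - s2 y; last by rewrite mulrNN.
have e : pi / L * (a - y) = pi / L * (a - (y + L)) + pi.
  by field; rewrite gt_eqF.
by rewrite /s2 [in RHS]e sinDpi opprK.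
Qed.

Lemma bump_bounded y : 0 <= bump y <= 1.
Proof.
have e0 := expR_ge0 (- N * (s1 y * s2 y)).
rewrite /bump invr_ge0 -/(E y) in e0 *; apply/andP; split; first lra.
by rewrite invf_le1; lra.
Qed.

End bump.

End test_functions.

(** * Integrable functions orthogonal to all test functions *)

Section integrable_on_period.
Context {R : realType}.
Implicit Types (L : R) (u v g phi : R -> R).
Local Notation mu := (@lebesgue_measure R).
Local Notation intL L v := (mu.-integrable `[0, L] (EFin \o v)).

Lemma intL_cont L v : continuous v -> intL L v.
Proof. exact: continuous_integrable_itv. Qed.

Lemma intLZ L (a : R) v : intL L v -> intL L (fun x => a * v x).
Proof. by move=> iv; apply: eq_integrable (integrableZl _ a iv). Qed.

Lemma intLB L u v : intL L u -> intL L v -> intL L (fun x => u x - v x).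
Proof. by move=> iu iv; apply: eq_integrable (integrableB _ iu iv). Qed.

Lemma continuous_measurable_itv L v : continuous v -> measurable_fun `[0, L] v.
Proof.
move=> cv; apply: measurable_funTS.
exact: continuous_measurable_fun.
Qed.

Lemma intLM L v phi : intL L v -> continuous phi -> intL L (fun x => v x * phi x).
Proof.
move=> iv cphi.
have cn : {within `[0, L], continuous (fun x => `|phi x|)}.
  by apply: continuous_subspaceT => x; apply: cvg_norm; exact: cphi.
have [L0|L0] := ltP L 0.
  have -> : `[0, L]%classic = set0 :> set R by rewrite set_itv_ge// bnd_simp -ltNge.
  exact: integrable_set0.
have [c _ cP] := EVT_max L0 cn.
have -> : EFin \o (fun x => v x * phi x) = (fun x => (EFin \o v) x * (EFin \o phi) x)%E by [].
apply: integrableMl => //; first exact: continuous_measurable_itv.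
exists `|phi c|; split; first exact: num_real.
by move=> M cM x xL; apply: le_trans (ltW cM); exact: cP.
Qed.

Lemma intL_measurable L v : intL L v -> measurable_fun `[0, L] v.
Proof. by move=> /integrableP[/measurable_EFinP]. Qed.

Lemma ae_neq (c : R) : {ae mu, forall y : R, y <> c}.
Proof.
exists [set c]; split; [exact: measurable_set1|exact: lebesgue_measure_set1|].
by move=> y /= /contrapT.
Qed.

Lemma RintL_ae L u v : ae_eq_torus L u v -> measurable_fun `[0, L] u ->
  measurable_fun `[0, L] v ->
  (\int[mu]_(x in `[0, L]) u x = \int[mu]_(x in `[0, L]) v x)%R.
Proof.
move=> uv mu_ mv; rewrite /Rintegral; congr fine.
apply: ae_eq_integral => //; try exact/measurable_EFinP.
by move: uv; apply: (@filterS _ _ (ae_filter_ringOfSetsType mu)) => x /= h /h ->.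
Qed.

Lemma geometric_exp_cvg (p : R) : 0 < p -> (fun n => expR (- n%:R * p)) @ \oo --> (0 : R).
Proof.
move=> p0.
have -> : (fun n => expR (- n%:R * p)) = (fun n => expR (- p) ^+ n).
  by apply/funext => n; rewrite mulNr -mulrN expRM_natl.
by apply: cvg_expr; rewrite ger0_norm ?expR_ge0// expR_lt1 oppr_lt0.
Qed.

Lemma bump_cvg1 L a (y : R) : 0 < sin (pi / L * y) * sin (pi / L * (a - y)) ->
  (fun n => bump L a n%:R y) @ \oo --> (1 : R).
Proof.
move=> p0; suff : (fun n => bump L a n%:R y) @ \oo --> ((1 + 0)^-1 : R) by rewrite addr0 invr1.
by rewrite /bump; apply: cvgV; [rewrite addr0|apply: cvgD; [exact: cvg_cst|exact: geometric_exp_cvg]].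
Qed.

Lemma bump_cvg0 L a (y : R) : sin (pi / L * y) * sin (pi / L * (a - y)) < 0 ->
  (fun n => bump L a n%:R y) @ \oo --> (0 : R).
Proof.
move=> p0; rewrite /bump; set p := _ * _ in p0 *.
have np0 : 0 < - p by rewrite oppr_gt0.
apply: (@squeeze_cvgr _ _ _ _ (fun=> 0) (fun n => expR (- n%:R * - p))); last first.
- exact: geometric_exp_cvg.
- exact: cvg_cst.
apply: nearW => n; have e0 := expR_gt0 (- n%:R * p).
apply/andP; split; first by rewrite invr_ge0 addr_ge0// ltW.
by rewrite mulrN expRN lef_pV2 ?posrE// ?addr_gt0// lerDr.
Qed.

(** Dominated convergence along the bumps, which are bounded by 1 and converge to the indicator of
    [0, x] except at 0, x and L. *)
Lemma orthogonal_bumps L g (x : R) : 0 < x < L -> intL L g ->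
  (forall phi, test_torus L phi -> \int[mu]_(y in `[0, L]) (g y * phi y) = 0) ->
  \int[mu]_(y in `[0, x]) g y = 0.
Proof.
move=> /andP[x0 xL] ig gphi.
have L0 : 0 < L := lt_trans x0 xL.
have gb n : intL L (fun y => g y * bump L x n%:R y).
  by apply: intLM => //; apply: smooth_continuous; exact: bump_smooth.
pose f : measurableTypeR R -> \bar R := (EFin \o g) \_ `[0, x].
have mf : measurable_fun `[0, L] f.
  apply/measurable_restrict => //.
  have -> : `[0, L]%classic `&` `[0, x] = `[0, x]%classic :> set R.
    by apply/setIidr/subset_itvl; rewrite bnd_simp ltW.
  apply/measurable_EFinP; apply: measurable_funS (intL_measurable ig) => //.
  by apply/subset_itvl; rewrite bnd_simp ltW.
have sin_pos (z : R) : 0 < z < L -> 0 < sin (pi / L * z).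
  move=> /andP[z0 zL]; apply: sin_gt0_pi.
  have p0 := pi_gt0 R; rewrite mulr_gt0 ?divr_gt0//= mulrAC ltr_pdivrMr//.
  by rewrite ltr_pM2l.
have cvg_f : {ae mu, forall y, `[0, L]%classic y ->
    (fun n => (g y * bump L x n%:R y)%:E) @ \oo --> f y}.
  apply: (@filterS3 _ _ (ae_filter_ringOfSetsType mu) _ _ _ _ _ (ae_neq 0) (ae_neq x) (ae_neq L)).
  move=> y /eqP y0 /eqP yx /eqP yL.
  rewrite /= in_itv/= => /andP[y0' yL'].
  have {}y0 : 0 < y by rewrite lt_neqAle eq_sym y0.
  have {}yL : y < L by rewrite lt_neqAle yL.
  have s1 : 0 < sin (pi / L * y) by apply: sin_pos; rewrite y0.
  have toE (l : R) : (fun n => g y * bump L x n%:R y) @ \oo --> l ->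
      (fun n => (g y * bump L x n%:R y)%:E) @ \oo --> l%:E.
    by move=> cl; apply/fine_cvgP; split; first exact: nearW.
  rewrite /f patchE; case: ifPn => [|].
    rewrite inE/= in_itv/= => /andP[_ yx'].
    apply: toE; rewrite -[X in _ --> X]mulr1; apply: cvgM; first exact: cvg_cst.
    apply: bump_cvg1; rewrite mulr_gt0// sin_pos// subr_gt0 lt_neqAle yx yx'/=.
    by rewrite ltrBlDr (lt_trans xL)// ltrDl.
  rewrite notin_setE/= in_itv/= (ltW y0)/= => /negP; rewrite -ltNge => xy.
  apply: toE; rewrite -[X in _ --> X](mulr0 (g y)); apply: cvgM; first exact: cvg_cst.
  apply: bump_cvg0; rewrite pmulr_rlt0// -oppr_gt0 -sinN -mulrN opprB sin_pos//.
  by rewrite subr_gt0 xy/= ltrBlDr (lt_trans yL)// ltrDl.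
have dom : {ae mu, forall y n, `[0, L]%classic y ->
    (`|(g y * bump L x n%:R y)%:E| <= `|g y|%:E)%E}.
  apply: aeW => y n _; rewrite abse_EFin lee_fin normrM -[leRHS]mulr1.
  apply: ler_wpM2l => //.
  by have /andP[b0 b1] := bump_bounded L x n%:R y; rewrite ger0_norm.
have ign : mu.-integrable `[0, L] (fun y => `|g y|%:E).
  by have := integrable_abse ig.
have [_ _] := @dominated_convergence _ _ _ mu _ (measurable_itv _)
   (fun n y => (g y * bump L x n%:R y)%:E) f (fun y => `|g y|%:E)
   (fun n => measurable_int mu (gb n)) mf cvg_f ign dom.
set J := (X in X @ \oo --> _).
have -> : J = fun=> 0%E.
  apply/funext => n; rewrite /J /=; rewrite -[LHS]fineK; last exact: integrable_fin_num (gb n).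
  by rewrite -/(Rintegral _ _ _) gphi//; exact: bump_test.
move=> cv; have fE : (\int[mu]_(y in `[0%R, L]) f y = 0)%E.
  by apply: (cvg_unique _ cv) => //; exact: cvg_cst.
rewrite /Rintegral.
have -> : `[0, x]%classic = `[0, L]%classic `&` `[0, x] :> set R.
  by apply/esym/setIidr/subset_itvl; rewrite bnd_simp ltW.
by rewrite integral_mkcondr fE.
Qed.

(** All integrals over [0, x] vanish, so their derivative does, and by Lebesgue differentiation this
    derivative is g almost everywhere. *)
Lemma orthogonal_test0 L g : 0 < L -> intL L g ->
  (forall phi, test_torus L phi -> \int[mu]_(y in `[0, L]) (g y * phi y) = 0) ->
  ae_eq_torus L g (cst 0).
Proof.
move=> L0 ig gphi.
have F0 x : 0 < x < L -> \int[mu]_(y in `[0, x]) g y = 0.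
  by move=> xL; exact: orthogonal_bumps xL ig gphi.
(* The extension by zero is integrable on the line, where the differentiation theorem is applied. *)
pose h := g \_ `[0, L].
have ih : mu.-integrable setT (EFin \o h).
  by rewrite /h -restrict_EFin; apply/(integrable_mkcond _ _).1.
have ihy y : mu.-integrable [set` Interval (BLeft 0) (BRight y)] (EFin \o h).
  exact: integrableS ih.
have lh : locally_integrable [set: R] h by exact: integrable_locally.
have := FTC1 ihy lh.
move=> H.
apply: (@filterS3 _ _ (ae_filter_ringOfSetsType mu) _ _ _ _ _ (ae_neq 0) (ae_neq L) H).
move=> y /eqP y0 /eqP yL Hy.
rewrite in_itv/= => /andP[y0' yL'].
have {}y0 : 0 < y by rewrite lt_neqAle eq_sym y0.
have {}yL : y < L by rewrite lt_neqAle yL.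
have hy : h y = g y by rewrite /h patchE mem_set//= in_itv/= y0' yL'.
have [|_] := Hy _; first by rewrite lte_fin.
rewrite hy => <-.
have d0 : is_derive y 1 (fun=> 0 : R) 0 by exact: is_derive_cst.
rewrite derive1E; apply: (@derive_val _ _ _ _ _ _ _ _).
apply: near_eq_is_derive d0; near=> z.
have z0 : 0 < z by near: z; exact: lt_nbhsr.
have zL : z < L by near: z; exact: lt_nbhsl.
rewrite -[LHS](F0 z) ?z0//; apply: eq_Rintegral => t; rewrite inE/= in_itv/= => /andP[t0 tz].
by rewrite /h patchE mem_set//= in_itv/= t0 (le_trans tz)// ltW.
Unshelve. all: by end_near. Qed.

End integrable_on_period.

(** * Uniqueness of weak derivatives and comparison with classical ones *)

Section weak_derivative.
Context {R : realType}.
Implicit Types (L : R) (u v g phi : R -> R).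
Local Notation mu := (@lebesgue_measure R).
Local Notation intL L v := (mu.-integrable `[0, L] (EFin \o v)).

Lemma ae_eq_torus_sym L u v : ae_eq_torus L u v -> ae_eq_torus L v u.
Proof. by apply: (@filterS _ _ (ae_filter_ringOfSetsType mu)) => x h /h. Qed.

Lemma RintLD L u v : intL L u -> intL L v ->
  \int[mu]_(x in `[0, L]) (u x + v x) = \int[mu]_(x in `[0, L]) u x + \int[mu]_(x in `[0, L]) v x.
Proof. by move=> iu iv; rewrite RintegralD. Qed.

Lemma RintLB L u v : intL L u -> intL L v ->
  \int[mu]_(x in `[0, L]) (u x - v x) = \int[mu]_(x in `[0, L]) u x - \int[mu]_(x in `[0, L]) v x.
Proof. by move=> iu iv; rewrite RintegralB. Qed.

Lemma RintLZ L (a : R) v : intL L v ->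
  \int[mu]_(x in `[0, L]) (a * v x) = a * \int[mu]_(x in `[0, L]) v x.
Proof. by move=> iv; rewrite RintegralZl. Qed.

(** The du Bois-Reymond lemma for j-th derivatives. Every psi - mean psi is such a derivative, so g
    minus its average is orthogonal to every psi. *)
Lemma orthogonal_derivn L g j : 0 < L -> (0 < j)%N -> intL L g ->
  (forall phi, test_torus L phi -> \int[mu]_(x in `[0, L]) (g x * (phi^`(j)%classic) x) = 0) ->
  exists c, ae_eq_torus L g (cst c).
Proof.
move=> L0; case: j => // j _ ig gphi.
pose c := (\int[mu]_(x in `[0, L]) g x) / L; exists c.
have icst : intL L (fun=> c) by apply: intL_cont => x; exact: cvg_cst.
have : ae_eq_torus L (fun x => g x - c) (cst 0).
  apply: orthogonal_test0 => //; first exact: intLB.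
  move=> psi tpsi; have cpsi := (test_cper tpsi).1.
  have [phi tphi e] := test_iter_prim j L0 tpsi.
  have := gphi phi tphi; rewrite e => H.
  have ipsi := intL_cont L cpsi.
  have igpsi := intLM ig cpsi.
  have e1 : (fun x => g x * (psi x - mean L psi)) = fun x => g x * psi x - mean L psi * g x.
    by apply/funext => x; ring.
  have e2 : (fun x => (g x - c) * psi x) = fun x => g x * psi x - c * psi x.
    by apply/funext => x; ring.
  rewrite e1 (RintLB igpsi (intLZ _ ig)) RintLZ// in H.
  rewrite e2 (RintLB igpsi (intLZ c ipsi)) RintLZ//.
  move: H; rewrite (Rintegral_prim L0 cpsi) /mean /c => /subr0_eq ->.
  by field; rewrite gt_eqF.
by apply: (@filterS _ _ (ae_filter_ringOfSetsType mu)) => x h /h /subr0_eq.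
Qed.

Lemma is_wderiv_uniq L j u v v' : 0 < L -> is_wderiv L j u v -> is_wderiv L j u v' ->
  ae_eq_torus L v v'.
Proof.
move=> L0 [iv vP] [iv' vP'].
have : ae_eq_torus L (fun x => v x - v' x) (cst 0).
  apply: orthogonal_test0 => //; first exact: intLB.
  move=> phi tphi; have cphi := (test_cper tphi).1.
  have := vP phi tphi; rewrite vP'// => /(mulrI (unitrX _ (unitrN1 _))) e.
  have -> : (fun x => (v x - v' x) * phi x) = fun x => v x * phi x - v' x * phi x.
    by apply/funext => x; ring.
  by rewrite (RintLB (intLM iv cphi) (intLM iv' cphi)) e subrr.
by apply: (@filterS _ _ (ae_filter_ringOfSetsType mu)) => x h /h /subr0_eq.
Qed.

Lemma wderivP L j u v : 0 < L -> is_wderiv L j u v ->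
  is_wderiv L j u (wderiv L j u) /\ ae_eq_torus L (wderiv L j u) v.
Proof.
move=> L0 uv; have wP : is_wderiv L j u (wderiv L j u) by apply: getPex; exists v.
by split=> //; exact: is_wderiv_uniq wP uv.
Qed.

Lemma is_wderiv_ae L j u u' v : ae_eq_torus L u u' -> measurable_fun `[0, L] u ->
  measurable_fun `[0, L] u' -> is_wderiv L j u v -> is_wderiv L j u' v.
Proof.
move=> uu' mu_ mu' [iv vP]; split=> // phi tphi.
have cphi := (test_cper (test_derive1n j tphi)).1.
rewrite -vP//; apply: RintL_ae.
- by apply: (@filterS _ _ (ae_filter_ringOfSetsType mu)) uu' => x h /h ->.
- by apply: measurable_funM => //; exact: continuous_measurable_itv.
- by apply: measurable_funM => //; exact: continuous_measurable_itv.
Qed.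

(** The conclusion is an equality of functions and not only almost everywhere: both sides choose an
    element of the same set. This permits rewriting under nested weak derivatives. *)
Lemma wderiv_ae L j u u' : ae_eq_torus L u u' -> measurable_fun `[0, L] u ->
  measurable_fun `[0, L] u' -> wderiv L j u = wderiv L j u'.
Proof.
move=> uu' mu_ mu'; congr get; apply/funext => v; apply/propext; split.
  exact: is_wderiv_ae.
by apply: is_wderiv_ae => //; exact: ae_eq_torus_sym.
Qed.

Lemma by_parts_torus L f f' phi : 0 < L -> deriv_is f f' -> cper L f -> continuous f' ->
  test_torus L phi ->
  \int[mu]_(x in `[0, L]) (f x * (phi^`()%classic) x) =
  - \int[mu]_(x in `[0, L]) (f' x * phi x).
Proof.
move=> L0 df [cf fL] cf' tphi.
have [cphi phiL] := test_cper tphi; have [cphi' _] := test_cper (test_derive1 tphi).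
have c1 : continuous (fun x => f' x * phi x).
  by move=> x; apply: cvgM; [exact: cf'|exact: cphi].
have c2 : continuous (fun x => f x * (phi^`()%classic) x).
  by move=> x; apply: cvgM; [exact: cf|exact: cphi'].
have d1 := deriv_isM df (test_deriv tphi).
have c3 : continuous (fun x => f' x * phi x + f x * (phi^`()%classic) x).
  by move=> x; apply: cvgD; [exact: c1|exact: c2].
have := Rintegral_deriv L0 d1 c3.
rewrite (RintLD (intL_cont L c1) (intL_cont L c2)) -[L in f L]add0r -[L in phi L]add0r.
by rewrite fL phiL subrr addrC => /eqP; rewrite addr_eq0 => /eqP.
Qed.

Definition chain n (f : nat -> R -> R) := forall j, (j < n)%N -> deriv_is (f j) (f j.+1).

Lemma chain_cper L n (f : nat -> R -> R) : chain n f -> cper L (f 0%N) -> continuous (f n) ->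
  forall j, (j <= n)%N -> cper L (f j).
Proof.
move=> cf p0 cn j jn; split.
  move: jn; rewrite leq_eqVlt => /predU1P[->//|/cf]; exact: deriv_is_continuous.
elim: j jn => [_|j IH jn]; first by case: p0.
by apply: deriv_is_periodic (cf j jn) _; apply: IH; exact: ltnW.
Qed.

Lemma is_wderiv_chain L n (f : nat -> R -> R) : 0 < L -> chain n f -> cper L (f 0%N) ->
  continuous (f n) -> is_wderiv L n (f 0%N) (f n).
Proof.
move=> L0 cf p0 cn; split; first exact: intL_cont.
move=> phi tphi.
elim: n f cf p0 cn => [|n IH] f cf p0 cn; first by rewrite expr0 mul1r.
have p1 := chain_cper cf p0 cn (isT : (1 <= n.+1)%N).
rewrite derive1nS (by_parts_torus L0 (cf 0%N isT) p0 p1.1 (test_derive1n n tphi)).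
by rewrite (IH (fun j => f j.+1)) ?exprS ?mulN1r ?mulNr// => j jn; exact: cf.
Qed.

Lemma wderiv_chain L n (f : nat -> R -> R) : 0 < L -> chain n f -> cper L (f 0%N) ->
  continuous (f n) -> ae_eq_torus L (wderiv L n (f 0%N)) (f n).
Proof. by move=> L0 cf p0 cn; have [_ +] := wderivP L0 (is_wderiv_chain L0 cf p0 cn). Qed.

Lemma L2_continuous L f : continuous f -> L2_torus L f.
Proof.
move=> cf; split; first exact: continuous_measurable_itv.
by apply: intL_cont => x; apply: cvgM; exact: cf.
Qed.

(** The primitive of (f - g)^2 vanishes over a period, hence is periodic; being nondecreasing it is
    constant. *)
Lemma ae_eq_continuous L f g : 0 < L -> cper L f -> cper L g -> ae_eq_torus L f g -> f = g.
Proof.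
move=> L0 [cf fL] [cg gL] fg.
pose h x := (f x - g x) ^+ 2.
have ch : continuous h.
  by move=> x; apply: cvgM; apply: cvgB; solve [exact: cf|exact: cg].
have h0 x : 0 <= h x := sqr_ge0 _.
have hI : prim h L = 0.
  rewrite -Rintegral_prim// (@RintL_ae _ _ _ (cst 0)).
  - by rewrite /Rintegral integral0.
  - apply: (@filterS _ _ (ae_filter_ringOfSetsType mu)) fg => x e xL.
    by rewrite /h e// subrr expr0n.
  - exact: continuous_measurable_itv.
  - exact: measurable_cst.
have hL : periodic h L by move=> x; rewrite /h fL gL.
have PL : periodic (prim h) L by move=> x; rewrite prim_shift// hI addr0.
apply/funext => x; apply/subr0_eq/eqP; rewrite -sqrf_eq0; apply/eqP.
exact: (deriv_is_periodic_ge0 L0 (prim_deriv ch) PL h0 x).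
Qed.

End weak_derivative.

(** * Gluing a function on one period into a continuous periodic function *)

Section periodic_extension.
Context {R : realType}.
Implicit Types (L : R) (f g : R -> R).

Lemma periodic_extension L f : 0 < L -> {within `[0, L], continuous f} -> f 0 = f L ->
  exists2 g, cper L g & forall x, 0 <= x <= L -> g x = f x.
Proof.
move=> L0 /(continuous_within_itvP _ L0)[ci c0 cL] f0L.
pose g x := f (x - L * (Num.floor (x / L))%:~R).
have gz x (k : int) : g (x + L * k%:~R) = g x.
  rewrite /g mulrDl [L * _]mulrC mulfK ?gt_eqF// floorDrz ?intr_int//.
  rewrite intrKfloor rmorphD mulrDr; congr f; ring.
have gL x : g (x + L) = g x by have := gz x 1; rewrite mulr1.
have gE0 x : 0 <= x < L -> g x = f x.
  move=> /andP[x0 xL]; rewrite /g; have -> : Num.floor (x / L) = 0.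
    by apply: floor_def; rewrite divr_ge0 ?(ltW L0)//= add0r ltr_pdivrMr// mul1r.
  by rewrite mulr0 subr0.
have gE x : 0 <= x <= L -> g x = f x.
  move=> /andP[x0]; rewrite le_eqVlt => /predU1P[->|xL]; last by rewrite gE0// x0.
  by rewrite -[in LHS](add0r L) gL gE0 ?lexx.
exists g => //; split => // x0.
suff H y : 0 <= y < L -> {for y, continuous g}.
  pose k := Num.floor (x0 / L).
  (* Translation by a multiple of L reduces continuity to points of [0, L). At 0 the one-sided
     limits at 0 and at L are glued, elsewhere g agrees with f nearby. *)
  have -> : g = g \o (fun x => x - L * k%:~R).
    by apply/funext => x /=; rewrite -[in LHS](subrK (L * k%:~R) x) gz.
  apply: continuous_comp; first by apply: cvgB; [exact: cvg_id|exact: cvg_cst].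
  apply: H; have /andP[k1 k2] := floor_itv (x0 / L).
  rewrite ler_pdivlMr// in k1; rewrite ltr_pdivrMr// rmorphD mulrDl mul1r in k2.
  by rewrite [L * _]mulrC; apply/andP; split; [rewrite subr_ge0|rewrite ltrBlDl].
move=> /andP[y0 yL]; have [e|yn] := eqVneq y 0.
  rewrite e {y y0 yL e}.
  apply/cvgrPdist_lt => e e0.
  move/cvgrPdist_lt : c0 => /(_ e e0); move/cvgrPdist_lt : cL => /(_ e e0).
  rewrite !near_withinE !near_simpl => nL n0.
  have gg0 : g 0 = f 0 by rewrite gE0// lexx.
  have [d1 /= d10 H1] := n0; have [d2 /= d20 H2] := nL.
  near=> x.
  have x1 : `|x| < d1.
    by near: x; exists d1 => //= z; rewrite /ball/= sub0r normrN.
  have x2 : `|x| < d2.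
    by near: x; exists d2 => //= z; rewrite /ball/= sub0r normrN.
  have x3 : `|x| < L.
    by near: x; exists L => //= z; rewrite /ball/= sub0r normrN.
  move: x3; rewrite ltr_norml => /andP[x3 x4].
  have [x0'|x0'|->] := ltgtP 0 x.
  - rewrite gg0 (gE x) ?(ltW x0') ?(ltW x4)//.
    by apply: H1 => //=; rewrite sub0r normrN.
  - rewrite gg0 -gL gE; last by apply/andP; split; lra.
    rewrite f0L; apply: H2 => /=; last lra.
    by rewrite (_ : L - (x + L) = - x) ?normrN//; ring.
  - by rewrite subrr normr0.
have {}y0 : 0 < y.
  by rewrite lt_neqAle eq_sym yn.
have cf : {for y, continuous f} by apply: ci; rewrite in_itv/= y0.
apply: (cvg_trans _ (_ : f @ y --> g y)); last by rewrite gE0 ?(ltW y0).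
apply: near_eq_cvg; near=> x; rewrite gE//.
by apply/andP; split; apply/ltW; near: x; [exact: lt_nbhsr|exact: lt_nbhsl].
Unshelve. all: by end_near. Qed.

End periodic_extension.

(** * Primitives of integrable functions and classical regularity *)

Section L1_primitive.
Context {R : realType}.
Implicit Types (L : R) (u v g phi : R -> R).
Local Notation mu := (@lebesgue_measure R).
Local Notation intL L v := (mu.-integrable `[0, L] (EFin \o v)).

Lemma RintL_le L u v : intL L u -> intL L v -> (forall x, 0 <= x <= L -> u x <= v x) ->
  \int[mu]_(x in `[0, L]) u x <= \int[mu]_(x in `[0, L]) v x.
Proof.
by move=> iu iv uv; apply: le_Rintegral => // x; rewrite /= in_itv/=; exact: uv.
Qed.

Lemma intL_norm L v : intL L v -> intL L (fun x => `|v x|).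
Proof. by move=> /integrable_abse. Qed.

Lemma RintL_norm_le L v (M : R) : 0 < L -> intL L v ->
  (forall x, 0 <= x <= L -> `|v x| <= M) -> `|\int[mu]_(x in `[0, L]) v x| <= M * L.
Proof.
move=> L0 iv vM; have cM : continuous (fun _ : R => M) by move=> x; exact: cvg_cst.
apply: le_trans (le_normr_Rintegral _ iv) _ => //.
apply: le_trans (RintL_le (intL_norm iv) (intL_cont L cM) vM) _.
rewrite Rintegral_prim// (@prim_unique _ _ (fun x => M * x))//; last by rewrite mulr0.
by apply: deriv_is_eq (deriv_isZ M deriv_is_id) _ => x; rewrite mulr1.
Qed.

Lemma intL_sub L x v : x <= L -> intL L v -> intL x v.
Proof.
by move=> xL; apply: integrableS => //; apply: subset_itvl; rewrite bnd_simp.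
Qed.

Lemma L1_prim_norm_le L x v : 0 <= x <= L -> intL L v ->
  `|\int[mu]_(y in `[0, x]) v y| <= \int[mu]_(y in `[0, L]) `|v y|.
Proof.
move=> /andP[x0 xL] iv; have ivx := intL_sub xL iv.
apply: le_trans (le_normr_Rintegral _ ivx) _ => //.
rewrite /Rintegral fine_le//.
- exact: integrable_fin_num (intL_norm ivx).
- exact: integrable_fin_num (intL_norm iv).
apply: ge0_subset_integral => //.
- exact: measurable_int (intL_norm iv).
- by apply: subset_itvl; rewrite bnd_simp.
Qed.

(** F is only the primitive of an integrable function, so v is approximated in L^1 by continuous
    functions, for which the classical formula holds; the primitives are then uniformly close. *)
Lemma L1_prim_parts L v phi : 0 < L -> intL L v -> test_torus L phi ->
  let F x := \int[mu]_(y in `[0, x]) v y in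
  \int[mu]_(x in `[0, L]) (F x * (phi^`()%classic) x) =
  F L * phi L - \int[mu]_(x in `[0, L]) (v x * phi x).
Proof.
move=> L0 iv tphi F; have tphi' := test_derive1 tphi.
have [cphi pphi] := test_cper tphi; have [cphi' pphi'] := test_cper tphi'.
have [M1 M10 M1P] := periodic_bounded L0 pphi cphi.
have [M2 M20 M2P] := periodic_bounded L0 pphi' cphi'.
have iF : intL L F.
  apply: continuous_compact_integrable; first exact: segment_compact.
  exact: (parameterized_integral_continuous (ltW L0) iv).
have muL : (mu `[0%R, L] < +oo)%E.
  by rewrite lebesgue_measure_itv/=; case: ifP => _; rewrite ltry.
have [g_ [cg ig gv]] := approximation_continuous_integrable (measurable_itv _) muL iv.
apply/eqP; rewrite -subr_eq0 -normr_le0.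
apply/ler_addgt0Pl => e e0; rewrite addr0.
(* One summand for each error: the integral against the derivative of phi, the boundary term, and
   the integral of v against phi. *)
pose K := M2 * L + M1 + M1.
have K0 : 0 < K by rewrite /K !addr_gt0// mulr_gt0.
have [n nP] : exists n, \int[mu]_(x in `[0, L]) `|v x - g_ n x| <= e / K.
  move/fine_cvgP : gv => [_ /cvgrPdist_le/(_ (e / K))].
  have eK : 0 < e / K by rewrite divr_gt0.
  move=> /(_ eK)[n _ /(_ n (leqnn n))] /=; rewrite sub0r normrN => h.
  by exists n; apply: le_trans (ler_norm _) h.
pose g := g_ n; pose w x := v x - g x.
have [cgn ign] := conj (cg n) (ig n).
have iw : intL L w by exact: intLB.
set D := (X in `|X| <= _).
have wF x : 0 <= x <= L -> F x - prim g x = \int[mu]_(y in `[0, x]) w y.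
  move=> /andP[x0 xL].
  have [->|xn0] := eqVneq x 0.
    by rewrite /F prim0 set_itv1 !Rintegral_set1 subrr.
  have {}x0 : 0 < x by rewrite lt_neqAle eq_sym xn0.
  by rewrite /F -Rintegral_prim// RintegralB//; [exact: intL_sub iv|exact: intL_cont].
have gparts : \int[mu]_(x in `[0, L]) (prim g x * (phi^`()%classic) x) =
    prim g L * phi L - \int[mu]_(x in `[0, L]) (g x * phi x).
  have c1 : continuous (fun x => g x * phi x).
    by move=> x; apply: cvgM; [exact: cgn|exact: cphi].
  have c2 : continuous (fun x => prim g x * (phi^`()%classic) x).
    by move=> x; apply: cvgM; [exact: prim_continuous|exact: cphi'].
  have c3 : continuous (fun x => g x * phi x + prim g x * (phi^`()%classic) x).
    by move=> x; apply: cvgD; [exact: c1|exact: c2].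
  have := Rintegral_deriv L0 (deriv_isM (prim_deriv cgn) (test_deriv tphi)) c3.
  rewrite (RintLD (intL_cont L c1) (intL_cont L c2)) prim0 mul0r subr0 => <-.
  by rewrite addrAC subrr add0r.
have ipg := intL_cont L (prim_continuous cgn).
have i1 : intL L (fun x => (F x - prim g x) * (phi^`()%classic) x).
  by apply: intLM => //; exact: intLB.
have i2 : intL L (fun x => w x * phi x) by exact: intLM.
have DE : D = \int[mu]_(x in `[0, L]) ((F x - prim g x) * (phi^`()%classic) x) -
    (F L - prim g L) * phi L + \int[mu]_(x in `[0, L]) (w x * phi x).
  have -> : (fun x => (F x - prim g x) * (phi^`()%classic) x) =
      fun x => F x * (phi^`()%classic) x - prim g x * (phi^`()%classic) x.
    by apply/funext => x; rewrite mulrBl.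
  have -> : (fun x => w x * phi x) = fun x => v x * phi x - g x * phi x.
    by apply/funext => x; rewrite mulrBl.
  rewrite (RintLB (intLM iF cphi') (intLM ipg cphi')) (RintLB (intLM iv cphi) (intLM ign cphi)).
  by rewrite gparts /D; ring.
pose N := \int[mu]_(x in `[0, L]) `|w x|.
have NF x : 0 <= x <= L -> `|F x - prim g x| <= N.
  by move=> xL; rewrite wF//; exact: L1_prim_norm_le.
have LL : 0 <= L <= L by rewrite lexx ltW.
have b1 : `|\int[mu]_(x in `[0, L]) ((F x - prim g x) * (phi^`()%classic) x)| <= N * M2 * L.
  by apply: RintL_norm_le => // x xL; rewrite normrM; apply: ler_pM => //; exact: NF.
have b2 : `|(F L - prim g L) * phi L| <= N * M1.
  by rewrite normrM; apply: ler_pM => //; exact: NF.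
have b3 : `|\int[mu]_(x in `[0, L]) (w x * phi x)| <= N * M1.
  apply: le_trans (le_normr_Rintegral _ i2) _ => //.
  rewrite mulrC /N -RintLZ; last exact: intL_norm.
  apply: RintL_le; [exact: intL_norm|exact/intLZ/intL_norm|].
  by move=> x _; rewrite normrM mulrC; apply: ler_wpM2r.
have NK : N * K <= e by rewrite -ler_pdivlMr.
rewrite DE; apply: le_trans (ler_normD _ _) _.
apply: le_trans (lerD (le_trans (ler_normB _ _) (lerD b1 b2)) b3) _.
by apply: le_trans NK; rewrite /K; lra.
Qed.

Lemma zero_mean_primitive L f : 0 < L -> cper L f -> mean L f = 0 ->
  exists g, [/\ cper L g, mean L g = 0 & deriv_is g f].
Proof.
move=> L0 pf mf; exists (antider L f).
split; [exact: antider_cper|exact: mean_antider|].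
by apply: deriv_is_eq (antider_deriv pf) _ => x; rewrite mf subr0.
Qed.

(** The fifth weak derivative has zero integral, so its primitive extends to a continuous periodic
    function, which differs from the fourth weak derivative by a constant. Four zero-mean
    antiderivatives lead back to u, up to a constant again. *)
Lemma H6_regular L u : 0 < L -> H6_torus L u ->
  exists f : nat -> R -> R, [/\ chain 4 f, f 0%N = u & continuous (f 4%N)].
Proof.
move=> L0 [cu uL H6].
have pu : cper L u by [].
have [v5 [[iv5 v5P] _]] := H6 5%N isT.
have [v4 [[iv4 v4P] _]] := H6 4%N isT.
have t1 := test_cst L 1.
(* Testing against the constant 1 shows that weak derivatives of positive order have zero
   integral. *)
have int0 j (v : R -> R) : (0 < j)%N -> is_wderiv L j u v -> \int[mu]_(x in `[0, L]) v x = 0.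
  move=> j0 [iv /(_ _ t1)]; rewrite derive1n_cst//.
  have -> : (fun x => u x * 0) = cst 0 by apply/funext => x; rewrite mulr0.
  have -> : (fun x => v x * 1) = v by apply/funext => x; rewrite mulr1.
  rewrite {1}/Rintegral integral0 => /esym/eqP.
  by rewrite mulf_eq0 signr_eq0/= => /eqP.
have I5 : \int[mu]_(x in `[0, L]) v5 x = 0 by apply: (int0 5%N).
have I4 : \int[mu]_(x in `[0, L]) v4 x = 0 by apply: (int0 4%N).
pose F x := \int[mu]_(y in `[0, x]) v5 y.
have cF : {within `[0, L], continuous F}.
  exact: (parameterized_integral_continuous (ltW L0) iv5).
have FL : F L = 0 by [].
have F0 : F 0 = F L by rewrite FL /F set_itv1 Rintegral_set1.
have [H pH HF] := periodic_extension L0 cF F0.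
have iF : intL L F by apply: continuous_compact_integrable; [exact: segment_compact|].
have iH := intL_cont L pH.1.
have [c v4c] : exists c, ae_eq_torus L (fun x => v4 x - H x) (cst c).
  apply: (@orthogonal_derivn _ L _ 1) => //; first exact: intLB.
  move=> phi tphi; rewrite derive1n1.
  have [cphi' _] := test_cper (test_derive1 tphi).
  have -> : (fun x => (v4 x - H x) * (phi^`()%classic) x) =
     fun x => v4 x * (phi^`()%classic) x - H x * (phi^`()%classic) x.
    by apply/funext => x; rewrite mulrBl.
  rewrite (RintLB (intLM iv4 cphi') (intLM iH cphi')).
  have := v4P _ (test_derive1 tphi); rewrite -derive1Sn (v5P _ tphi).
  rewrite -signr_odd /= expr1 mulN1r -signr_odd /= expr0 mul1r => <-.
  have -> : \int[mu]_(x in `[0, L]) (H x * (phi^`()%classic) x) =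
      \int[mu]_(x in `[0, L]) (F x * (phi^`()%classic) x).
    by apply: eq_Rintegral => x; rewrite inE/= in_itv/= => xL; rewrite HF.
  by rewrite (L1_prim_parts L0 iv5 tphi) -/(F L) FL mul0r sub0r subrr.
pose X4 x := H x + c.
have pX4 : cper L X4 := cperD pH (cper_cst L c).
have v4X : ae_eq_torus L v4 X4.
  apply: (@filterS _ _ (ae_filter_ringOfSetsType mu)) v4c => x h /h.
  by rewrite /X4 /cst => <-; rewrite addrC subrK.
have mX4 : mean L X4 = 0.
  rewrite /mean -Rintegral_prim//; last by case: pX4.
  rewrite -(RintL_ae v4X) ?I4 ?mul0r//; first exact: intL_measurable.
  by apply: continuous_measurable_itv; case: pX4.
have [X3 [pX3 mX3 d3]] := zero_mean_primitive L0 pX4 mX4.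
have [X2 [pX2 mX2 d2]] := zero_mean_primitive L0 pX3 mX3.
have [X1 [pX1 mX1 d1]] := zero_mean_primitive L0 pX2 mX2.
have [X0 [pX0 mX0 d0]] := zero_mean_primitive L0 pX1 mX1.
pose f (a : R) (j : nat) := match j with
  | 0%N => fun x => X0 x + a | 1%N => X1 | 2%N => X2 | 3%N => X3 | _ => X4 end.
have cf a : chain 4 (f a).
  move=> [|[|[|[|//]]]] _ //=.
  by apply: deriv_is_eq (deriv_isD d0 (deriv_is_cst a)) _ => x; rewrite addr0.
have pf0 a : cper L (f a 0%N) := cperD pX0 (cper_cst L a).
have [_ XP] := is_wderiv_chain L0 (cf 0) (pf0 0) pX4.1.
(* Both functions have the same fourth weak derivative, so their difference is constant by du
   Bois-Reymond. *)
have [a ua] : exists a, ae_eq_torus L (fun x => u x - f 0 0%N x) (cst a).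
  apply: (@orthogonal_derivn _ L _ 4) => //.
    by apply: intLB; apply: intL_cont; [|case: (pf0 0)].
  move=> phi tphi.
  have [cphi4 _] := test_cper (test_derive1n 4 tphi).
  have [cphi _] := test_cper tphi.
  have -> : (fun x => (u x - f 0 0%N x) * (phi^`(4)%classic) x) =
     fun x => u x * (phi^`(4)%classic) x - f 0 0%N x * (phi^`(4)%classic) x.
    by apply/funext => x; rewrite mulrBl.
  rewrite (RintLB (intLM (intL_cont L cu) cphi4) (intLM (intL_cont L (pf0 0).1) cphi4)).
  rewrite (v4P _ tphi) (XP _ tphi) -mulrBr.
  rewrite (RintL_ae (v := fun x => X4 x * phi x)) ?subrr ?mulr0//.
  - by apply: (@filterS _ _ (ae_filter_ringOfSetsType mu)) v4X => x h /h ->.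
  - apply: measurable_funM; first exact: intL_measurable.
    exact: continuous_measurable_itv.
  - apply: measurable_funM; apply: continuous_measurable_itv => //.
    by case: pX4.
exists (f a); split => //; last by case: pX4.
apply: (ae_eq_continuous L0 (pf0 a) pu); apply: ae_eq_torus_sym.
apply: (@filterS _ _ (ae_filter_ringOfSetsType mu)) ua => x h /h /=.
by rewrite /cst => <-; ring.
Qed.

End L1_primitive.

(** * From the weak stationary equation to a second-order equation *)

Section stationary_classical.
Context {R : realType}.
Implicit Types (L : R) (u v g phi : R -> R).
Local Notation mu := (@lebesgue_measure R).
Local Notation intL L v := (mu.-integrable `[0, L] (EFin \o v)).

Lemma W_derive1 (y : R) : (@W R)^`()%classic y = y ^+ 3 - y.
Proof.
have d : deriv_is (@W R) (fun y => y ^+ 3 - y).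
  by move=> z; rewrite /W; apply: is_derive_eq; rewrite /GRing.scale/=; lra.
by rewrite (deriv_is_derive1 d).
Qed.

Lemma wderiv_intL L j u v : 0 < L -> is_wderiv L j u v -> intL L (wderiv L j u).
Proof. by move=> L0 /(wderivP L0)[[]]. Qed.

(** The inner Laplacian is a chosen representative, known only almost everywhere; this exchanges it
    for the classical second derivative inside the outer one. *)
Lemma laplacian_nonlinear_ae L (f : nat -> R -> R) : 0 < L -> cper L (f 0%N) -> chain 2 f ->
  continuous (f 2%N) ->
  laplacian L (fun x => laplacian L (f 0%N) x - ((@W R)^`()%classic) (f 0%N x)) =
  wderiv L 2 (fun x => f 2%N x - (f 0%N x ^+ 3 - f 0%N x)).
Proof.
move=> L0 p0 cf c2; have w2 := is_wderiv_chain L0 cf p0 c2.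
have cN : cper L (fun x => f 0%N x ^+ 3 - f 0%N x) by cper_auto.
have -> : (fun x => laplacian L (f 0%N) x - ((@W R)^`()%classic) (f 0%N x)) =
    fun x => laplacian L (f 0%N) x - (f 0%N x ^+ 3 - f 0%N x).
  by apply/funext => x; rewrite W_derive1.
apply: wderiv_ae.
- apply: (@filterS _ _ (ae_filter_ringOfSetsType mu)) (wderivP L0 w2).2 => x h /h.
  by rewrite /laplacian => ->.
- apply: measurable_funB; last exact: continuous_measurable_itv cN.1.
  exact: intL_measurable (wderiv_intL L0 w2).
- apply: measurable_funB; last exact: continuous_measurable_itv cN.1.
  exact: continuous_measurable_itv.
Qed.

Lemma cubic_chain L (f : nat -> R -> R) : chain 4 f -> cper L (f 0%N) -> continuous (f 4%N) ->
  exists N : nat -> R -> R, [/\ chain 4 N, N 0%N = (fun x => f 0%N x ^+ 3 - f 0%N x) &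
    forall j, (j <= 4)%N -> cper L (N j)].
Proof.
move=> cf p0 c4; have pf := chain_cper cf p0 c4.
have [p1 p2 p3 p4] := And4 (pf 1%N isT) (pf 2%N isT) (pf 3%N isT) (pf 4%N isT).
pose N (j : nat) (x : R) : R := match j with
  | 0%N => f 0%N x ^+ 3 - f 0%N x
  | 1%N => (3 * f 0%N x ^+ 2 - 1) * f 1%N x
  | 2%N => 6 * f 0%N x * f 1%N x ^+ 2 + (3 * f 0%N x ^+ 2 - 1) * f 2%N x
  | 3%N => 6 * f 1%N x ^+ 3 + 18 * f 0%N x * f 1%N x * f 2%N x +
      (3 * f 0%N x ^+ 2 - 1) * f 3%N x
  | _ => 36 * f 1%N x ^+ 2 * f 2%N x + 18 * f 0%N x * f 2%N x ^+ 2 +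
      24 * f 0%N x * f 1%N x * f 3%N x + (3 * f 0%N x ^+ 2 - 1) * f 4%N x
  end.
have [d0 d1 d2 d3] := And4 (cf 0%N isT) (cf 1%N isT) (cf 2%N isT) (cf 3%N isT).
exists N; split=> //.
  move=> [|[|[|[|//]]]] _ x; have [h0 h1 h2 h3] := And4 (d0 x) (d1 x) (d2 x) (d3 x);
  rewrite /N; derive_ring.
by move=> [|[|[|[|[|//]]]]] _; rewrite /N; cper_auto.
Qed.

(** Put H = u'' - (u^3 - u). The equation says that H'' has zero second weak derivative, so H'' is
    constant, and being the derivative of a periodic function it is zero. The same argument gives H'
    = 0, and H is the constant c. *)
Lemma stationary_classical L u : 0 < L -> H6_torus L u -> stationary L u ->
  exists (p : R -> R) c, deriv_is u p /\ deriv_is p (fun x => u x ^+ 3 - u x + c).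
Proof.
move=> L0 uH stat; have [f [cf f0 c4]] := H6_regular L0 uH.
have p0 : cper L (f 0%N) by rewrite f0; case: uH.
have [v6 [[iv6 v6P] _]] : exists v, is_wderiv L 6 (f 0%N) v /\ L2_torus L v.
  by rewrite f0; case: uH => _ _; exact.
have pf := chain_cper cf p0 c4.
have [N [cN N0 pN]] := cubic_chain cf p0 c4.
have chain2 (g : nat -> R -> R) : chain 4 g -> chain 2 g.
  by move=> cg [|[|//]] _; [exact: (cg 0%N)|exact: (cg 1%N)].
pose H (j : nat) (x : R) := f j.+2 x - N j x.
have cH : chain 2 H.
  move=> [|[|//]] _; first exact: deriv_isB (cf 2%N isT) (cN 0%N isT).
  exact: deriv_isB (cf 3%N isT) (cN 1%N isT).
have pH j : (j <= 2)%N -> cper L (H j).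
  by move=> j2; apply: cperB; [apply: pf|apply: pN]; case: j j2 => [|[|[|]]].
have stE : stat_op L u = wderiv L 2 (H 2%N).
  rewrite /stat_op -f0 (laplacian_nonlinear_ae L0 p0 (chain2 _ cf) (pf 2%N isT).1).
  have -> : (fun x => f 2%N x - (f 0%N x ^+ 3 - f 0%N x)) = H 0%N by rewrite /H N0.
  have w2 := is_wderiv_chain L0 cH (pH 0%N isT) (pH 2%N isT).1.
  apply: wderiv_ae.
  - exact: (wderivP L0 w2).2.
  - exact: intL_measurable (wderiv_intL L0 w2).
  - exact: continuous_measurable_itv (pH 2%N isT).1.
have iH2 := intL_cont L (pH 2%N isT).1.
(* The sixth weak derivative of u supplies the second weak derivative of H'' even though only four
   classical ones are available. *)
have w4 : is_wderiv L 2 (H 2%N) (fun x => v6 x - N 4%N x).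
  split; first by apply: intLB => //; exact: intL_cont (pN 4%N isT).1.
  move=> phi tphi; have [cphi _] := test_cper tphi.
  have [cphi2 _] := test_cper (test_derive1n 2 tphi).
  have -> : (fun x => H 2%N x * (phi^`(2)%classic) x) =
      fun x => f 4%N x * (phi^`(2)%classic) x - N 2%N x * (phi^`(2)%classic) x.
    by apply/funext => x; rewrite mulrBl.
  have -> : (fun x => (v6 x - N 4%N x) * phi x) = fun x => v6 x * phi x - N 4%N x * phi x.
    by apply/funext => x; rewrite mulrBl.
  have [i4 iN4 iN2] := And3 (intL_cont L c4) (intL_cont L (pN 4%N isT).1) (intL_cont L (pN 2%N isT).1).
  rewrite (RintLB (intLM i4 cphi2) (intLM iN2 cphi2)) (RintLB (intLM iv6 cphi) (intLM iN4 cphi)).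
  have cN2 : chain 2 (fun j => N j.+2) by move=> [|[|//]] _; [exact: (cN 2%N)|exact: (cN 3%N)].
  have [_ N2P] := is_wderiv_chain L0 cN2 (pN 2%N isT) (pN 4%N isT).1.
  have sgn n : ~~ odd n -> (-1) ^+ n = 1 :> R by rewrite -signr_odd => /negPf ->.
  have [_ f4P] := is_wderiv_chain L0 cf p0 c4.
  have e4 := f4P _ (test_derive1n 2 tphi); have e6 := v6P phi tphi.
  have e2 := N2P phi tphi.
  rewrite (sgn 4%N isT) mul1r in e4; rewrite (sgn 6%N isT) mul1r in e6.
  rewrite (sgn 2%N isT) mul1r in e2.
  by rewrite (sgn 2%N isT) mul1r e2 -e4 -e6.
have [_ w4P] := (wderivP L0 w4).1.
have [c Hc] : exists c, ae_eq_torus L (H 2%N) (cst c).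
  apply: (@orthogonal_derivn _ L _ 2) => // phi tphi.
  rewrite (w4P phi tphi) (RintL_ae (v := cst 0)).
  - by rewrite /Rintegral integral0 mulr0.
  - apply: (@filterS _ _ (ae_filter_ringOfSetsType mu)) stat => x h xL.
    by rewrite -stE h// mul0r.
  - apply: measurable_funM; first exact: intL_measurable (wderiv_intL L0 w4).
    by apply: continuous_measurable_itv; case: (test_cper tphi).
  - exact: measurable_cst.
have H2 : H 2%N = cst c := ae_eq_continuous L0 (pH 2%N isT) (cper_cst L c) Hc.
have [d0 d1] := conj (cH 0%N isT) (cH 1%N isT).
have c0 : c = 0.
  by rewrite -(mean_cst L0 c) -(mean_deriv L0 d1 (pH 1%N isT) (pH 2%N isT).1) H2.
have H1 x : H 1%N x = 0.
  have e : H 1%N = fun=> H 1%N 0.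
    by apply/funext => y; apply: deriv_is0_cst; rewrite H2 c0 in d1; exact: d1.
  by rewrite e -(mean_cst L0 (H 1%N 0)) -e (mean_deriv L0 d0 (pH 0%N isT) (pH 1%N isT).1).
have H0 x : H 0%N x = H 0%N 0.
  apply: deriv_is0_cst; apply: deriv_is_eq d0 _ => y; exact: H1.
exists (f 1%N), (H 0%N 0); rewrite -f0; split; first exact: (cf 0%N).
apply: deriv_is_eq (cf 1%N isT) _ => x.
by rewrite -(H0 x) /H N0; ring.
Qed.

End stationary_classical.

(** * From uniform estimates to curves in the Sobolev space *)

Section sobolev_curves.
Context {R : realType}.
Implicit Types (L d : R) (u v g : R -> R).
Local Notation mu := (@lebesgue_measure R).

Lemma odd_periodic_Xspace L (f : nat -> R -> R) : 0 < L -> chain 6 f -> odd_periodic L (f 0%N) ->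
  continuous (f 6%N) -> Xspace L (f 0%N).
Proof.
move=> L0 cf [c0 fL fo] c6.
have pf := chain_cper cf (conj c0 fL) c6.
have f00 : f 0%N 0 = 0 by have := fo 0; rewrite oppr0; lra.
split=> //; last by rewrite -(add0r L) fL.
split; last by rewrite Rintegral_prim// prim_odd_period.
split=> // j j6; exists (f j); split; last exact: L2_continuous (pf j j6).1.
apply: is_wderiv_chain => //; last by case: (pf j j6).
by move=> i ij; apply: cf; exact: leq_trans ij j6.
Qed.

(** Each of the seven squared terms of the norm is at most L M^2. Thus sup estimates on the
    derivatives control the Sobolev norm. *)
Lemma Hdot6_norm_le L (M : R) (f : nat -> R -> R) : 0 < L -> chain 6 f ->
  (forall j, (j <= 6)%N -> cper L (f j)) -> (forall j x, (j <= 6)%N -> `|f j x| <= M) ->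
  Hdot6_norm L (f 0%N) <= Num.sqrt (7 * L) * M.
Proof.
move=> L0 cf pf fM.
have M0 : 0 <= M := le_trans (normr_ge0 _) (fM 0%N 0 isT).
rewrite -(ger0_norm M0) -sqrtr_sqr -sqrtrM; last by rewrite mulr_ge0// ltW.
apply: ler_wsqrtr.
have term (j : 'I_7) : \int[mu]_(x in `[0, L]) (wderiv L j (f 0%N) x ^+ 2) <= L * M ^+ 2.
  have j6 : (j <= 6)%N by rewrite -ltnS.
  have cj : chain j f by move=> i ij; apply: cf; exact: leq_trans ij j6.
  have wj := is_wderiv_chain L0 cj (pf 0%N isT) (pf j j6).1.
  have [[iw _] aew] := wderivP L0 wj.
  rewrite (RintL_ae (v := fun x => f j x ^+ 2)).
  - have c2 : continuous (fun x => f j x ^+ 2).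
      by move=> x; apply: cvgM; exact: (pf j j6).1.
    apply: le_trans (ler_norm _) _; rewrite mulrC.
    apply: (RintL_norm_le L0 (intL_cont L c2)) => x _.
    by apply: normM_le; exact: fM.
  - by apply: (@filterS _ _ (ae_filter_ringOfSetsType mu)) aew => x h /h ->.
  - by apply: measurable_funX; exact: intL_measurable.
  - by apply: measurable_funX; exact: continuous_measurable_itv (pf j j6).1.
apply: le_trans (ler_sum _ (fun j _ => term j)) _.
rewrite sumr_const card_ord -[_ *+ 7]mulr_natl; lra.
Qed.

Lemma Hdot6_norm_ge0 L u : 0 <= Hdot6_norm L u.
Proof. exact: sqrtr_ge0. Qed.

Lemma chainB n (f g : nat -> R -> R) : chain n f -> chain n g ->
  chain n (fun j x => f j x - g j x).
Proof. by move=> cf cg j jn; exact: deriv_isB (cf j jn) (cg j jn). Qed.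

Lemma chainZ n (a : R) (f : nat -> R -> R) : chain n f -> chain n (fun j x => a * f j x).
Proof. by move=> cf j jn; exact: deriv_isZ (cf j jn). Qed.

(** The nested existential quantifiers of [reg] become sequences indexed by the order of the
    derivative, the form used by the norm estimate. *)
Lemma reg_chain L d n (U V : R -> R -> R) : reg L d n U V ->
  exists F G : nat -> R -> R -> R, [/\ F 0%N = U, G 0%N = V,
    forall t, `|t| < d -> chain n (F^~ t) /\ chain n (G^~ t) &
    forall j, (j <= n)%N -> C11 L d (F j) (G j)].
Proof.
elim: n U V => [|n IH] U V.
  by move=> [CU _]; exists (fun=> U), (fun=> V).
move=> [CU [U1 [V1 [dU /IH[F [G [F0 G0 cFG CFG]]]]]]].
exists (fun j => if j is j'.+1 then F j' else U), (fun j => if j is j'.+1 then G j' else V).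
split=> //.
- move=> t td; have [cF cG] := cFG t td; have [dUt dVt] := dU t td.
  split=> -[|j] jn; [by rewrite /= F0|exact: cF|by rewrite /= G0|exact: cG].
- by move=> [|j] jn //; exact: CFG.
Qed.

Lemma C11_uniform L d n (F G : nat -> R -> R -> R) :
  (forall j, (j <= n)%N -> C11 L d (F j) (G j)) ->
  exists2 C, 0 <= C & forall j t s x, (j <= n)%N -> `|t| < d -> `|s| < d ->
    [/\ `|F j s x - F j t x| <= C * `|s - t|, `|G j s x - G j t x| <= C * `|s - t| &
        `|F j s x - F j t x - (s - t) * G j t x| <= C * (s - t) ^+ 2].
Proof.
elim: n => [|n IH] H.
  have [_ [C C0 CP]] := H 0%N isT; exists C => // j t s x; rewrite leqn0 => /eqP -> td sd.
  by have [] := CP t s x td sd.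
have [C C0 CP] := IH (fun j jn => H j (leqW jn)).
have [_ [D D0 DP]] := H n.+1 (leqnn _).
exists (C + D); first exact: addr_ge0.
move=> j t s x; rewrite leq_eqVlt => /predU1P[->|jn] td sd.
  have [_ _ h1 h2 h3] := DP t s x td sd.
  have [i1 i2] := conj (mulr_ge0 C0 (normr_ge0 (s - t))) (mulr_ge0 C0 (sqr_ge0 (s - t))).
  by split; [apply: (le_trans h1)|apply: (le_trans h2)|apply: (le_trans h3)]; rewrite mulrDl lerDr.
have [h1 h2 h3] := CP j t s x jn td sd.
have [i1 i2] := conj (mulr_ge0 D0 (normr_ge0 (s - t))) (mulr_ge0 D0 (sqr_ge0 (s - t))).
by split; [apply: (le_trans h1)|apply: (le_trans h2)|apply: (le_trans h3)]; rewrite mulrDl lerDl.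
Qed.

Lemma cvg0_le_dist (f : R -> R) (F : set_system R) (t C : R) : Filter F -> F --> t ->
  (\forall s \near F, 0 <= f s <= C * `|s - t|) -> f @ F --> 0.
Proof.
move=> FF Ft fC.
apply: (@squeeze_cvgr _ _ _ _ (fun=> 0) (fun s => C * `|s - t|)) => //; first exact: cvg_cst.
suff h : (fun s => C * `|s - t|) @ F --> C * `|t - t| by rewrite subrr normr0 mulr0 in h.
apply: cvgM; first exact: cvg_cst.
by apply: cvg_norm; apply: cvgB; [exact: Ft|exact: cvg_cst].
Qed.

Lemma reg_C1_curve L d (U V : R -> R -> R) : 0 < L -> reg L d 6 U V ->
  (forall t, `|t| < d -> odd_periodic L (U t) /\ odd_periodic L (V t)) ->
  C1_curve (Xspace L) (Hdot6_norm L) d U /\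
  exists C, forall t s, `|t| < d -> `|s| < d ->
    Hdot6_norm L (fun x => U s x - U t x) <= C * `|s - t|.
Proof.
move=> L0 rU oUV; have [F [G [F0 G0 cFG CFG]]] := reg_chain rU.
have [C C0 CP] := C11_uniform CFG.
have pF j t : (j <= 6)%N -> `|t| < d -> cper L (F j t) by move=> j6 td; exact: ((CFG j j6).1 t td).1.
have pG j t : (j <= 6)%N -> `|t| < d -> cper L (G j t) by move=> j6 td; exact: ((CFG j j6).1 t td).2.
split; last first.
  exists (Num.sqrt (7 * L) * C) => t s td sd.
  have [[cFt _] [cFs _]] := conj (cFG t td) (cFG s sd).
  rewrite -F0 -mulrA; apply: (Hdot6_norm_le L0 (chainB cFs cFt)).
    by move=> j j6; exact: cperB (pF j s j6 sd) (pF j t j6 td).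
  by move=> j x j6; have [] := CP j t s x j6 td sd.
exists V => t td; have [oU oV] := oUV t td; have [cFt cGt] := cFG t td.
split.
- rewrite -F0 in oU *.
  exact: (odd_periodic_Xspace (f := F^~ t) L0 cFt oU (pF 6%N t isT td).1).
- rewrite -G0 in oV *.
  exact: (odd_periodic_Xspace (f := G^~ t) L0 cGt oV (pG 6%N t isT td).1).
(* Dividing the second-order remainder by h leaves a bound proportional to |h| for every derivative
   in x. *)
- apply: (@cvg0_le_dist _ _ 0 (Num.sqrt (7 * L) * C)).
    exact: nbhs_dnbhs.
  near=> h; rewrite Hdot6_norm_ge0/= subr0.
  have h0 : h != 0 by near: h; exact: nbhs_dnbhs_neq.
  have thd : `|t + h| < d.
    have hd : `|h| < d - `|t| by near: h; apply: dnbhs0_lt; rewrite subr_gt0.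
    by apply: le_lt_trans (ler_normD _ _) _; rewrite -ltrBrDl.
  have [cFs _] := cFG _ thd.
  rewrite -F0 -G0 -mulrA.
  apply: (Hdot6_norm_le L0 (chainB (chainZ h^-1 (chainB cFs cFt)) cGt)).
    move=> j j6; apply: cperB (pG j t j6 td).
    exact: (cperM (cper_cst L h^-1) (cperB (pF j _ j6 thd) (pF j t j6 td))).
  move=> j x j6; have [_ _] := CP j t (t + h) x j6 td thd.
  have -> : t + h - t = h by ring.
  move=> H.
  have -> : h^-1 * (F j (t + h) x - F j t x) - G j t x =
      h^-1 * (F j (t + h) x - F j t x - h * G j t x) by field.
  rewrite normrM normfV ler_pdivrMl ?normr_gt0//; apply: (le_trans H).
  by rewrite -[h ^+ 2]real_normK ?num_real//; lra.
- apply: (@cvg0_le_dist _ _ t (Num.sqrt (7 * L) * C)); first exact: cvg_id.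
  near=> s; rewrite Hdot6_norm_ge0/=.
  have sd : `|s| < d.
    near: s; have := @norm_continuous _ R^o t => /cvgrPdist_lt.
    move=> /(_ (d - `|t|)); rewrite subr_gt0 => /(_ td).
    apply: filterS => s; rewrite distrC => h.
    by have := le_lt_trans (ler_norm _) h; lra.
  have [_ cGs] := cFG s sd.
  rewrite -G0 -mulrA; apply: (Hdot6_norm_le L0 (chainB cGs cGt)).
    by move=> j j6; exact: cperB (pG j s j6 sd) (pG j t j6 td).
  by move=> j x j6; have [] := CP j t s x j6 td sd.
Unshelve. all: by end_near. Qed.

Lemma antider3_deriv L q : 0 < L -> cper L q -> exists s1 s2 : R -> R,
  [/\ cper L (antider3 L q), deriv_is (antider3 L q) s1, deriv_is s1 s2, cper L s2 &
      deriv_is s2 (fun x => q x - mean L q)].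
Proof.
move=> L0 pq; have p1 := antider_cper L0 pq; have p2 := antider_cper L0 p1.
exists (antider L (antider L q)), (antider L q); split.
- exact: antider_cper.
- by apply: deriv_is_eq (antider_deriv p2) _ => x; rewrite (mean_antider L0 p1) subr0.
- by apply: deriv_is_eq (antider_deriv p1) _ => x; rewrite (mean_antider L0 pq) subr0.
- exact: p1.
- exact: antider_deriv.
Qed.

(** Here u'' - W'(u) is -(t/2) J^3(u^2). Three derivatives of J^3(u^2) give u^2 minus its mean and a
    fourth one removes the mean, so the bi-Laplacian of this term is -t u u_x. *)
Lemma perturbed_equation L (t : R) (u u1 : R -> R) : 0 < L -> cper L u -> deriv_is u u1 ->
  deriv_is u1 (fun x => u x ^+ 3 - u x - t / 2 * antider3 L (fun y => u y ^+ 2) x) ->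
  ae_eq_torus L (G L t u) (cst 0).
Proof.
move=> L0 pu du du1.
have pq : cper L (fun y => u y ^+ 2) by cper_auto.
have [s1 [s2 [pS]]] := antider3_deriv L0 pq.
move: (antider3 L _) pS du1 => S pS du1 dS ds1 ps2 ds2.
have pF := cperB (cperB (cperX 3 pu) pu) (cperM (cper_cst L (t / 2)) pS).
pose f (j : nat) : R -> R := match j with
  | 0%N => u | 1%N => u1 | _ => fun x => u x ^+ 3 - u x - t / 2 * S x end.
have cf : chain 2 f by move=> [|[|//]].
have cf1 : chain 1 f by move=> [|//].
have cu1 := deriv_is_continuous du1.
have w1 := wderiv_chain L0 cf1 pu cu1.
pose H (j : nat) x := - (t / 2) * (match j with 0%N => S | 1%N => s1 | _ => s2 end) x.
have cH : chain 2 H by move=> [|[|//]] _; exact: deriv_isZ.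
have pH0 : cper L (H 0%N) by exact: (cperM (cper_cst L (- (t / 2))) pS).
have pH2 : cper L (H 2%N) by exact: (cperM (cper_cst L (- (t / 2))) ps2).
have wH := is_wderiv_chain L0 cH pH0 pH2.1.
pose H4 x := - (t / 2) * (2 * (u x * u1 x)).
(* The third and fourth derivatives of [H 0], classical as well, so the outer Laplacian is computed
   along a second chain of length two. *)
pose K (j : nat) : R -> R := match j with
  | 0%N => H 2%N | 1%N => fun x => - (t / 2) * (u x ^+ 2 - mean L (fun y => u y ^+ 2)) | _ => H4 end.
have cK : chain 2 K.
  move=> [|[|//]] _; first exact: deriv_isZ.
  by move=> x; have := du x => ?; rewrite /K /H4; derive_ring.
have cH4 : continuous H4.
  move=> x; apply: cvgM; first exact: cvg_cst.
  apply: cvgM; first exact: cvg_cst.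
  by apply: cvgM; [exact: pu.1|exact: cu1].
have wK := wderiv_chain L0 cK pH2 cH4.
have stE : stat_op L u = wderiv L 2 (K 0%N).
  rewrite /stat_op (laplacian_nonlinear_ae L0 (f := f) pu cf pF.1).
  have -> : (fun x => f 2%N x - (f 0%N x ^+ 3 - f 0%N x)) = H 0%N.
    by apply/funext => x; rewrite /f /H; ring.
  apply: wderiv_ae.
  - exact: (wderivP L0 wH).2.
  - exact: intL_measurable (wderiv_intL L0 wH).
  - exact: continuous_measurable_itv pH2.1.
apply: (@filterS2 _ _ (ae_filter_ringOfSetsType mu)) w1 wK => x h1 h2 xL.
by rewrite /G stE (h2 xL) (h1 xL) /= /H4 /cst; field.
Qed.

End sobolev_curves.

Unset Implicit Arguments.

Theorem theorem2p21 (R : realType) (L0 L : R) (ui : R -> R)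
  (hL0 : is_L0 L0) (hL : L0 <= L) (hE : ~ Eset L)
  (hX : Xspace L ui) (hnt : nontrivial ui) (hsol : stationary L ui) :
  exists (delta0 : R) (ud : R -> R -> R),
    [/\ 0 < delta0,
        C1_curve (Xspace L) (Hdot6_norm L) delta0 ud,
        forall delta, `|delta| < delta0 ->
          ae_eq_torus L (G L delta (ud delta)) (cst 0) &
        exists C : R, forall delta, `|delta| < delta0 ->
          Hdot6_norm L (fun x => ud delta x - ui x) <= C * `|delta| ].
Proof.
have Lpos : 0 < L by case: hL0 => h _ _; exact: lt_le_trans h hL.
have [[uH umean] u0 _] := hX.
have [p [c [du dp]]] := stationary_classical Lpos uH hsol.
have uL : periodic ui L by case: uH.
have c0 : c = 0.
  apply: (zero_mean_ode_const Lpos du dp uL hnt).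
  by rewrite -Rintegral_prim//; exact: deriv_is_continuous du.
have {}dp : deriv_is p (fun x => ui x ^+ 3 - ui x).
  by apply: deriv_is_eq dp _ => x; rewrite c0 addr0.
have [d [U [V [U1 [d0 rU U0 oUV dU]]]]] := odd_branch Lpos du dp uL u0 hnt.
have [curve [C CP]] := reg_C1_curve Lpos rU oUV.
exists d, U; split => //.
- move=> t td; have [dUt dU1t] := dU t td; have [[cU UL _] _] := oUV t td.
  exact: (perturbed_equation Lpos (conj cU UL) dUt dU1t).
- exists C => t td; have := CP 0 t; rewrite normr0 U0 subr0; exact.
Qed.
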